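(* Let $b:\mathbb{R}^r\to\mathbb{R}^r$ and $\sigma=(\sigma^i_j):\mathbb{R}^r\to\mathbb{R}^{r\times l}$ be measurable and satisfy: 1. there is a constant $K$ such that for all $y\in\mathbb{R}^r$ $$\langle y,b(y)\rangle+\sum_{i,j}[\sigma^i_j(y)]^2\le K^2(1+|y|^2);$$ 2. for each $N$ there exists a constant $L_N$ such that for all $y,z\in\mathbb{R}^r$ with $|y|\le N$ and $|z|\le N$ $$\sum_i|b^i(y)-b^i(z)|+\sum_{i,j}|\sigma^i_j(y)-\sigma^i_j(z)|\le L_N|y-z|.$$ Let $x\in\mathbb{R}^r$ and $\epsilon\in(0,1]$. Then the stochastic differential equation $$\dot X^\epsilon_t=b(X^\epsilon_t)+\epsilon\,\sigma(X^\epsilon_t)\,\dot w_t,\qquad X^\epsilon_0=x,\qquad t\in[0,T],$$ has a solution, and the solution is unique in the sense that for any two solutions $X^\epsilon_{t,1}$ and $X^\epsilon_{t,2}$ $$P\Big\{\sup_{0\le s\le T}|X^\epsilon_{s,1}-X^\epsilon_{s,2}|=0\Big\}=1.$$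
   Context: $(\Omega,\mathcal{F},(\mathcal{F}_t)_{t\in[0,T]},P)$ is a filtered probability space, $0<T<\infty$, and $w$ is a given $l$-dimensional standard Brownian motion adapted to $(\mathcal{F}_t)$. Here $b=(b^1,\dots,b^r)$ is a vector field on $\mathbb{R}^r$, and $\sigma=(\sigma^i_j)$ is a matrix-valued function with $r$ rows (index $i$) and $l$ columns (index $j$); $\langle\cdot,\cdot\rangle$ and $|\cdot|$ are the Euclidean inner product and norm. A solution of the equation is a continuous adapted random process $X^\epsilon_t$ that satisfies $$X^\epsilon_t=x+\int_0^t b(X^\epsilon_s)\,ds+\epsilon\int_0^t\sigma(X^\epsilon_s)\,dw_s$$ with probability 1 for every $t\in[0,T]$ (Itô stochastic integral). The number $\epsilon$ is a small perturbation parameter. *)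

(* Defs.v *)
From HB Require Import structures.
From mathcomp Require Import all_boot all_order all_algebra.
From mathcomp Require Import all_classical all_reals all_analysis.

Set Implicit Arguments.
Unset Strict Implicit.
Unset Printing Implicit Defensive.

Import Order.TTheory GRing.Theory Num.Theory.
Import numFieldNormedType.Exports.
Local Open Scope classical_set_scope.
Local Open Scope ring_scope.

(* The library norm `|y| on 'cV[R]_n is the max norm, hence these. *)
Definition edot (R : realType) (n : nat) (y z : 'cV[R]_n) : R :=
  \sum_i y i 0 * z i 0.

Definition enorm (R : realType) (n : nat) (y : 'cV[R]_n) : R :=
  Num.sqrt (edot y y).

Definition borel_set (S : topologicalType) : set_system S := <<s @open S >>.

(* [f] is measurable from (U, G) to [S] with its Borel sigma-algebra. *)
Definition measurable_wrt (U : Type) (S : topologicalType)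
    (G : set_system U) (f : U -> S) : Prop :=
  forall B : set S, borel_set B -> G (f @^-1` B).

Definition borel_fun (S S' : topologicalType) (f : S -> S') : Prop :=
  measurable_wrt (@borel_set S) f.

Section stochastic_calculus.
Context (R : realType) (d : measure_display) (Omega : measurableType d).
Variables (P : probability Omega R) (T : R) (F : R -> set_system Omega).

Definition is_filtration : Prop :=
  [/\ forall t, 0 <= t <= T -> sigma_algebra setT (F t),
      forall t, 0 <= t <= T -> F t `<=` @measurable d Omega
    & forall s t : R, 0 <= s -> s <= t -> t <= T -> F s `<=` F t].

Definition is_adapted (S : topologicalType) (X : R -> Omega -> S) : Prop :=
  forall t, 0 <= t <= T -> measurable_wrt (F t) (X t).

(* Path continuity is almost sure: [F] need not contain the null sets, and then
   limits of continuous adapted processes have in general no adapted version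
   all of whose paths are continuous. *)
Definition is_continuous (S : topologicalType) (X : R -> Omega -> S) : Prop :=
  {ae P, forall omega, {within `[0, T], continuous (fun t => X t omega)}}.

(* Standard [l]-dimensional Brownian motion relative to the filtration [F]:
   increments after time [s] are independent of [F s]. *)
Record is_brownian (l : nat) (w : R -> Omega -> 'cV[R]_l) : Prop := {
  brownian_adapted : is_adapted w ;
  brownian_start : {ae P, forall omega, w 0 omega = 0} ;
  brownian_continuous : is_continuous w ;
  brownian_independent : forall s t : R, 0 <= s -> s < t -> t <= T ->
    forall (A : set Omega) (B : set 'cV[R]_l), F s A -> borel_set B ->
    P (A `&` [set omega | B (w t omega - w s omega)%R]) =
    (P A * P [set omega | B (w t omega - w s omega)%R])%E ;
  brownian_gaussian : forall s t : R, 0 <= s -> s < t -> t <= T ->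
    forall B : 'I_l -> set R, (forall j, measurable (B j)) ->
    P [set omega | forall j, B j (w t omega j 0 - w s omega j 0)] =
    (\prod_(j < l) normal_prob 0 (Num.sqrt (t - s)) (B j))%E }.

(* [Y n] tends to 0 in probability. The outer measure [mu_ext P] agrees with [P]
   on events; it is needed because a functional of almost surely continuous
   paths is only measurable up to null sets. *)
Definition cvg_prob0 (Y : nat -> Omega -> \bar R) : Prop :=
  forall delta : R, 0 < delta ->
    (fun n => mu_ext P [set omega | (delta%:E < Y n omega)%E]) @ \oo --> 0%E.

(* The step process equal to [step_val k] on [step_time k, step_time k.+1[ for
   [k < step_size]. *)
Record step_process := {
  step_size : nat ;
  step_time : nat -> R ;
  step_val : nat -> Omega -> R }.

Definition is_simple (f : step_process) : Prop :=
  [/\ step_time f 0 = 0,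
      step_time f (step_size f) = T,
      forall k, (k < step_size f)%N -> step_time f k < step_time f k.+1
    & forall k, (k < step_size f)%N ->
        measurable_wrt (F (step_time f k)) (step_val f k) /\
        exists C : R, forall omega, `|step_val f k omega| <= C].

Definition step_eval (f : step_process) (t : R) (omega : Omega) : R :=
  \sum_(k < step_size f)
    step_val f k omega * \1_(`[step_time f k, step_time f k.+1[%classic) t.

Definition step_integral (beta : R -> Omega -> R) (f : step_process)
    (t : R) (omega : Omega) : R :=
  \sum_(k < step_size f) step_val f k omega *
    (beta (Num.min (step_time f k.+1) t) omega
     - beta (Num.min (step_time f k) t) omega).

Definition ito_integrand (f : R -> Omega -> R) : Prop :=
  is_adapted f /\
  {ae P, forall omega, measurable_fun `[0, T] (fun s => f s omega) /\
    (\int[lebesgue_measure]_(s in `[0%R, T]) ((f s omega) ^+ 2)%:E < +oo)%E}.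

(* [I t] is the Ito integral of [f] over [0, t] with respect to the real
   Brownian motion [beta], for every [t] in [0, T]. This determines each [I t]
   up to a null set. *)
Definition is_ito_integral (beta f I : R -> Omega -> R) : Prop :=
  ito_integrand f /\
  exists fn : nat -> step_process,
    [/\ forall n, is_simple (fn n),
        cvg_prob0 (fun n omega => \int[lebesgue_measure]_(s in `[0%R, T])
          ((step_eval (fn n) s omega - f s omega) ^+ 2)%:E)%E
      & forall t, 0 <= t <= T -> cvg_prob0 (fun n omega =>
          `|step_integral beta (fn n) t omega - I t omega|%:E)].

(* [X] solves dX = b(X) dt + eps sigma(X) dw, X_0 = x, on [0, T]. *)
Record is_solution (r l : nat) (w : R -> Omega -> 'cV[R]_l)
    (b : 'cV[R]_r -> 'cV[R]_r) (sigma : 'cV[R]_r -> 'M[R]_(r, l))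
    (eps : R) (x : 'cV[R]_r) (X : R -> Omega -> 'cV[R]_r) : Prop := {
  solution_adapted : is_adapted X ;
  solution_continuous : is_continuous X ;
  solution_drift : {ae P, forall omega, forall i : 'I_r,
    lebesgue_measure.-integrable `[0, T] (fun s => (b (X s omega) i 0)%:E)} ;
  solution_equation : exists M : 'I_r -> 'I_l -> R -> Omega -> R,
    (forall i j, is_ito_integral (fun t omega => w t omega j 0)
       (fun t omega => sigma (X t omega) i j) (M i j)) /\
    forall t, 0 <= t <= T -> {ae P, forall omega, forall i : 'I_r,
      X t omega i 0 = x i 0
        + \int[lebesgue_measure]_(s in `[0, t]) b (X s omega) i 0
        + eps * \sum_(j < l) M i j t omega} }.

End stochastic_calculus.

(* Main.v *)
Require Import Defs.
From HB Require Import structures.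
From mathcomp Require Import all_boot all_order all_algebra.
From mathcomp Require Import all_classical all_reals all_analysis.
From mathcomp Require Import measurable_realfun ring lra.
Set Implicit Arguments.
Unset Strict Implicit.
Unset Printing Implicit Defensive.
Import Order.TTheory GRing.Theory Num.Theory.
Import numFieldNormedType.Exports.
Local Open Scope classical_set_scope.
Local Open Scope ring_scope.

(** Existence and uniqueness are both derived from estimates on finite time
    grids. On a grid an equation with frozen coefficients is a recursion: the
    state moves by B (t' - t) + S (w t' - w t), where B and S are known at time t.

    The increment of w is independent of the past, centred, and has a second
    moment at most proportional to t' - t, so the expectation of |Y|^2 grows over
    one step by at most (t' - t) times that of 2 <Y, B> + (t' - t) |B|^2 + 2 |S|^2
    ([one_step]). If this expression is at most c (kappa + |Y|^2) + a, then a
    discrete Gronwall argument, stopped when kappa + |Y|^2 first exceeds lambda,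
    bounds the probability that this ever happens
    ([discrete_maximal_inequality]). Three choices of Y give all that is needed:
    - an Euler scheme with truncated coefficients does not explode, by the growth
      condition with kappa = 1 ([euler_nonexplosion]);
    - two schemes with coefficients frozen at different values stay close to one
      another, by the local Lipschitz condition, if each of them stays close to
      the values at which it is frozen ([comparison]);
    - the stochastic integrals of two simple processes are close at all grid
      times if the processes are close in mean square in time, which is
      Lenglart's inequality ([simple_lenglart]).

    Existence. Take Euler schemes whose coefficients are cut off outside balls of
    squared radius 4^n, with meshes so fine that, up to probability of order
    4^-n, consecutive schemes and their stochastic integrals differ by at most
    2^-n on all dyadic grids ([euler_levels]). By the Borel-Cantelli lemma and
    the continuity of paths the schemes converge uniformly on [0, T] almost
    surely. The limit is a solution: the frozen coefficients converge uniformly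
    to the coefficients along the limit path, and the frozen diffusion
    coefficients are simple processes that approximate the Ito integrand.

    Uniqueness. Freeze the coefficients at the values of a solution X on the
    dyadic grid of level n. The resulting scheme is close to X on this grid, in
    probability ([frozen_scheme_vanish]): the drift parts are close because X is
    continuous, the stochastic integrals because, by Lenglart's inequality, the
    frozen integrand may be exchanged for the simple integrands that define the
    Ito integral. The schemes of two solutions are therefore close to the values
    at which they are frozen, and the comparison shows that the two solutions
    coincide at dyadic times ([solutions_apart_vanish]). *)

(** * Gaussian moments and products of independent variables *)
Section gaussian_moments.
Context {R : realType}.
Local Notation mu := (@lebesgue_measure R).
Implicit Types s : R.

Lemma ge0_integral_normal_prob s (f : R -> \bar R) :
  (forall x, 0 <= f x)%E -> measurable_fun setT f ->
  (\int[normal_prob 0 s]_x f x = \int[mu]_x (f x * (normal_pdf 0 s x)%:E))%E.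
Proof.
move=> f0 mf.
rewrite -(Radon_Nikodym_SigmaFinite.change_of_variables (normal_prob_dominates 0 s))//.
have fint := Radon_Nikodym_SigmaFinite.f_integrable (normal_prob_dominates 0 s).
apply: ae_eq_integral => //.
- by apply: emeasurable_funM => //; exact: (measurable_int mu).
- apply: emeasurable_funM => //; apply/measurable_EFinP.
  exact: measurable_normal_pdf.
- apply: ae_eqe_mul2l; apply: integral_ae_eq => //.
  + by apply/measurable_EFinP; exact: measurable_normal_pdf.
  + by move=> E _ mE; rewrite -Radon_Nikodym_SigmaFinite.f_integral//;
      exact: normal_prob_dominates.
Qed.

(** The exponential factor turns the density of standard deviation s into that
    of standard deviation s sqrt 2, up to the factor sqrt 2. *)
Lemma normal_prob_mgf_sqr s : 0 < s ->
  (\int[normal_prob 0 s]_x (expR (x ^+ 2 / (4 * s ^+ 2)))%:E = (Num.sqrt 2)%:E)%E.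
Proof.
move=> s0; have s2 : 0 < Num.sqrt 2 * s by rewrite mulr_gt0// sqrtr_gt0.
rewrite ge0_integral_normal_prob//=; last first.
  apply/measurable_EFinP; apply: measurableT_comp => //.
  by apply: measurable_funM => //; exact: measurable_funX.
transitivity (\int[mu]_x ((Num.sqrt 2)%:E * (normal_pdf 0 (Num.sqrt 2 * s) x)%:E))%E.
  apply: eq_integral => x _; rewrite -!EFinM; congr (_%:E).
  rewrite !normal_pdfE ?gt_eqF// /normal_peak /normal_fun subr0.
  rewrite exprMn sqr_sqrtr//.
  have -> : 2 * s ^+ 2 * pi *+ 2 = 2 * (s ^+ 2 * pi *+ 2) :> R.
    by rewrite -mulrnAr -mulrA -mulrnAr.
  rewrite (sqrtrM _ (ler0n R 2)) [(Num.sqrt 2 * _)^-1]invfM -(mulrA (Num.sqrt 2)^-1) mulVKf ?gt_eqF ?sqrtr_gt0//.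
  rewrite mulrCA -expRD; congr (_ * expR _).
  have : s != 0 by rewrite gt_eqF.
  by move=> sn0; field.
rewrite ge0_integralZl//; last 2 first.
- by apply/measurable_EFinP; exact: measurable_normal_pdf.
- by move=> x _; rewrite lee_fin normal_pdf_ge0.
by rewrite integral_normal_pdf mule1.
Qed.

(** From u <= exp u - 1 at u = x^2 / (4 s^2); this is where the constant 2 in the
    later estimates comes from. *)
Lemma normal_prob_second_moment s : 0 < s ->
  (\int[normal_prob 0 s]_x (x ^+ 2)%:E <= (2 * s ^+ 2)%:E)%E.
Proof.
move=> s0; have s20 : 0 < 4 * s ^+ 2 by rewrite mulr_gt0// exprn_gt0.
have mexp : measurable_fun setT (fun x : R => expR (x ^+ 2 / (4 * s ^+ 2))).
  apply: measurableT_comp => //.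
  by apply: measurable_funM => //; exact: measurable_funX.
have msq : measurable_fun setT (fun x : R => x ^+ 2) by exact: measurable_funX.
have : (\int[normal_prob 0 s]_x (x ^+ 2 + 4 * s ^+ 2)%:E <=
        \int[normal_prob 0 s]_x ((4 * s ^+ 2)%:E *
            (expR (x ^+ 2 / (4 * s ^+ 2)))%:E))%E.
  apply: ge0_le_integral => //.
  - by move=> x _; rewrite lee_fin addr_ge0 ?sqr_ge0 ?ltW.
  - by apply/measurable_EFinP; apply: measurable_funD.
  - by apply: emeasurable_funM => //; apply/measurable_EFinP.
  - move=> x _; rewrite -EFinM lee_fin.
    have := expR_ge1Dx (x ^+ 2 / (4 * s ^+ 2)).
    move=> /(ler_wpM2l (ltW s20)); apply: le_trans.
    by rewrite mulrDr mulr1 [X in _ <= _ + X]mulrC divfK ?gt_eqF// addrC.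
rewrite ge0_integralZl//; last 2 first.
- by apply/measurable_EFinP.
- by rewrite lee_fin ltW.
rewrite normal_prob_mgf_sqr//.
under eq_integral do rewrite EFinD.
rewrite ge0_integralD//; last 3 first.
- by move=> x _; rewrite lee_fin sqr_ge0.
- by apply/measurable_EFinP.
- by move=> x _; rewrite lee_fin ltW.
rewrite integral_cst// [X in (_ + _ * X)%E]probability_setT mule1 -leeBrDr// -EFinM => /le_trans; apply.
rewrite -EFinB lee_fin.
have : Num.sqrt 2 <= 3 / 2 :> R.
  rewrite -(@ler_pXn2r _ 2)// ?nnegrE ?sqrtr_ge0 ?divr_ge0//.
  by rewrite sqr_sqrtr//; lra.
nra.
Qed.

Lemma normal_prob_integrable_id s : 0 < s ->
  (normal_prob 0 s).-integrable setT (fun x : R => x%:E).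
Proof.
move=> s0; apply/integrableP; split; first exact/measurable_EFinP.
apply: (@le_lt_trans _ _ (\int[normal_prob 0 s]_x (1 + x ^+ 2)%:E)%E).
  apply: ge0_le_integral => //.
  - by apply: measurableT_comp => //; exact/measurable_EFinP.
  - apply/measurable_EFinP; exact: measurable_funD.
  - move=> x _; rewrite /= lee_fin.
    by have := sqr_ge0 (`|x| - 1); rewrite sqrrB1 -(real_normK (num_real x)); nra.
under eq_integral do rewrite EFinD.
rewrite ge0_integralD//; last 2 first.
- by move=> x _; rewrite lee_fin sqr_ge0.
- by apply/measurable_EFinP; exact: measurable_funX.
rewrite integral_cst//= [X in (_ * X)%E]probability_setT mule1.
have := normal_prob_second_moment s0.
by case: (\int[_]_x _)%E => [r| |]//= _; rewrite -?EFinD ?ltry.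
Qed.

(** The substitution x := - x exchanges the positive and the negative part. *)
Lemma normal_prob_mean s : 0 < s -> (\int[normal_prob 0 s]_x x%:E = 0)%E.
Proof.
move=> s0.
have mpdf : measurable_fun setT (normal_pdf 0 s) := measurable_normal_pdf 0 s.
pose G := fun x : R => - x * normal_pdf 0 s x.
have pdfN x : normal_pdf 0 s (- x) = normal_pdf 0 s x.
  by rewrite !normal_pdfE ?gt_eqF// /normal_fun !subr0 sqrrN.
have HG : (\int[mu]_(x in `]-oo, 0%R]) (G x)%:E =
          \int[mu]_(x in `[0%R, +oo[) ((G \o -%R) x)%:E)%E.
  rewrite -{1}oppr0; apply: ge0_integration_by_substitutionNy.
    apply: continuous_subspaceT => x.
    apply: cvgM; first by apply: cvgN; exact: cvg_id.
    by apply: continuous_normal_pdf; rewrite gt_eqF.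
  move=> x; rewrite in_itv/= oppr0 => x0.
  by rewrite mulr_ge0 ?normal_pdf_ge0// oppr_ge0 ltW.
have -> : (fun x : R => x%:E) = EFin \o id by [].
rewrite integralE.
rewrite !ge0_integral_normal_prob//; last 2 first.
- by apply: measurable_funeneg; exact/measurable_EFinP.
- by apply: measurable_funepos; exact/measurable_EFinP.
suff -> : (\int[mu]_x ((EFin \o id)^\+ x * (normal_pdf 0 s x)%:E) =
           \int[mu]_x ((EFin \o id)^\- x * (normal_pdf 0 s x)%:E))%E.
  rewrite -ge0_integral_normal_prob//; last first.
    by apply: measurable_funeneg; exact/measurable_EFinP.
  rewrite subee// ge0_fin_numE ?integral_ge0//.
  have /integrableP[_] := normal_prob_integrable_id s0.
  apply: le_lt_trans; apply: ge0_le_integral => //.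
  - by apply: measurable_funeneg; exact/measurable_EFinP.
  - by apply: measurableT_comp => //; exact/measurable_EFinP.
  - by move=> x _; rewrite funenegE ge_max abse_ge0 andbT -abseN lee_abs.
transitivity (\int[mu]_(x in `[0%R, +oo[) ((G \o -%R) x)%:E)%E.
  rewrite [RHS]integral_mkcond; apply: eq_integral => x _.
  rewrite patchE; case: ifPn; rewrite (inE, notin_setE)/= in_itv/= andbT.
    move=> x0; rewrite funeposE /= /G opprK pdfN EFinM.
    by congr (_ * _)%E; apply/max_idPl; rewrite lee_fin.
  move=> /negP; rewrite -ltNge => x0; rewrite funeposE /=.
  suff -> : maxe x%:E 0 = 0%E by rewrite mul0e.
  by apply/max_idPr; rewrite lee_fin ltW.
rewrite -HG [LHS]integral_mkcond; apply: eq_integral => x _.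
rewrite patchE; case: ifPn; rewrite (inE, notin_setE)/= in_itv/=.
  move=> x0; rewrite funenegE /= /G EFinM.
  by congr (_ * _)%E; apply/esym/max_idPl; rewrite lee_fin oppr_ge0.
move=> /negP; rewrite -ltNge => x0; rewrite funenegE /=.
suff -> : maxe (- (x : R))%:E 0%E = 0%E by rewrite mul0e.
by apply/max_idPr; rewrite lee_fin oppr_le0 ltW.
Qed.

End gaussian_moments.

Section independence.
Context {R : realType} {d : measure_display} {Omega : measurableType d}.
Variable P : probability Omega R.

(** The product rule for events makes the law of (X, Y) the product of the two
    laws, and Fubini's theorem applies. *)
Lemma indep_expectation_prod (X Y : Omega -> R) :
  measurable_fun setT X -> measurable_fun setT Y ->
  (forall A B : set R, measurable A -> measurable B ->
     P (X @^-1` A `&` Y @^-1` B) = P (X @^-1` A) * P (Y @^-1` B))%E ->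
  P.-integrable setT (EFin \o X) -> P.-integrable setT (EFin \o Y) ->
  P.-integrable setT (EFin \o (fun x => X x * Y x)) /\
  (\int[P]_x (X x * Y x)%:E = (\int[P]_x (X x)%:E) * (\int[P]_x (Y x)%:E))%E.
Proof.
move=> mX mY XY iX iY.
have mXY : measurable_fun setT (fun x => (X x, Y x)) by exact: measurable_fun_pair.
pose f : R * R -> \bar R := fun z => (z.1 * z.2)%:E.
have mf : measurable_fun setT f.
  by apply/measurable_EFinP; apply: measurable_funM.
have mfa : measurable_fun setT (abse \o f) by exact: measurableT_comp.
pose PX := distribution P (mfun_Sub (mem_set mX)).
pose PY := distribution P (mfun_Sub (mem_set mY)).
pose PXY := distribution P (mfun_Sub (mem_set mXY)).
have prodE A : measurable A -> (PX \x PY)%E A = PXY A.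
  move=> mA; apply: (@product_measure_unique _ _ _ _ _ PX PY PXY) => //.
have eqPXY g : (\int[PXY]_z g z = \int[(PX \x PY)%E]_z g z)%E.
  by apply: eq_measure_integral => A mA _; exact/esym/prodE.
have iXa : (\int[PX]_x `|x%:E| = \int[P]_x `|(X x)%:E|)%E.
  rewrite ge0_integral_distribution//=.
  by apply: measurableT_comp => //; exact/measurable_EFinP.
have iYa : (\int[PY]_x `|x%:E| = \int[P]_x `|(Y x)%:E|)%E.
  rewrite ge0_integral_distribution//=.
  by apply: measurableT_comp => //; exact/measurable_EFinP.
have fX : (\int[PX]_x `|x%:E| < +oo)%E by rewrite iXa; have /integrableP[] := iX.
have fY : (\int[PY]_x `|x%:E| < +oo)%E by rewrite iYa; have /integrableP[] := iY.
have mabs : measurable_fun setT (fun y : R => `|y%:E|%E).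
  by apply: measurableT_comp => //; exact/measurable_EFinP.
have if12 : (PX \x PY)%E.-integrable setT f.
  apply/integrable12ltyP => //.
  have -> : (\int[PX]_x \int[PY]_y `|f (x, y)| =
             \int[PX]_x (`|x%:E| * \int[PY]_y `|y%:E|))%E.
    apply: eq_integral => x _.
    rewrite -ge0_integralZl//.
    by apply: eq_integral => y _; rewrite /f EFinM abseM.
  rewrite ge0_integralZr//; last exact: integral_ge0.
  by rewrite lte_mul_pinfty ?integral_ge0// ge0_fin_numE ?integral_ge0.
have iPXY : P.-integrable setT (f \o (fun x => (X x, Y x))).
  apply/integrableP; split; first exact: measurableT_comp.
  rewrite -[ltLHS](@ge0_integral_distribution _ _ _ _ _ P
    (mfun_Sub (mem_set mXY)) (abse \o f))//=.
  rewrite -/PXY eqPXY.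
  by have /integrableP[] := if12.
split; first exact: iPXY.
have -> : (\int[P]_x (X x * Y x)%:E = \int[PXY]_z f z)%E.
  by rewrite integral_distribution.
rewrite eqPXY.
rewrite -integral12_prod_meas1//.
have iX' : (\int[PX]_x x%:E = \int[P]_x (X x)%:E)%E.
  by rewrite integral_distribution//; exact/measurable_EFinP.
have iY' : (\int[PY]_x x%:E = \int[P]_x (Y x)%:E)%E.
  by rewrite integral_distribution//; exact/measurable_EFinP.
have iPX : PX.-integrable setT (EFin : R -> \bar R).
  by apply/integrableP; split => //; exact/measurable_EFinP.
have iPY : PY.-integrable setT (EFin : R -> \bar R).
  by apply/integrableP; split => //; exact/measurable_EFinP.
rewrite -iX' -iY' -(@fineK _ (\int[PY]_x x%:E)%E); last exact: integrable_fin_num.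
rewrite -integralZr//.
apply: eq_integral => x _; rewrite /fubini_F.
rewrite fineK; last exact: integrable_fin_num.
by rewrite -integralZl//; apply: eq_integral => y _; rewrite /f EFinM.
Qed.

End independence.

(** * Adapted random variables *)
Section borel.
Context {R : realType}.

Lemma measurable_borel (B : set R) : measurable B -> borel_set B.
Proof.
have -> : measurable B = <<s @RGenOpens.G R >> B.
  by have := congr1 (fun M => M B) (@RGenOpens.measurableE R).
move: B; apply: smallest_sub; first exact: smallest_sigma_algebra.
move=> _ [x [y ->]]; apply: sub_sigma_algebra; exact: itv_open.
Qed.

Lemma borel_measurable (B : set R) : borel_set B -> measurable B.
Proof.
move: B; apply: smallest_sub; last by move=> U; exact: open_measurable.
by split; [exact: measurable0|move=> A mA; rewrite setTD; exact: measurableC|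
  move=> A mA; exact: bigcup_measurable].
Qed.

Lemma continuous_borel (S S' : topologicalType) (f : S -> S') :
  continuous f -> borel_fun f.
Proof.
move=> cf.
have h : @borel_set S' `<=` [set B | borel_set (f @^-1` B)].
  apply: smallest_sub; last first.
    move=> U oU; apply: sub_sigma_algebra.
    by move/continuousP : cf; apply.
  have [h0 hC hU] := @smallest_sigma_algebra S setT open.
  split.
  - by rewrite /= preimage_set0.
  - by move=> A /= /hC; rewrite !setTD preimage_setC.
  - by move=> A /= hA; rewrite preimage_bigcup; exact: hU.
exact: h.
Qed.

End borel.

Section filtration.
Context {R : realType} {d : measure_display} {Omega : measurableType d}.
Variables (T : R) (F : R -> set_system Omega).
Hypothesis hF : is_filtration T F.

(** Stated in the measurable space generated by F t, so that the closure
    properties of measurable functions apply to adapted random variables. *)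
Definition adapted_at (t : R) (f : Omega -> R) :=
  measurable_fun [set: g_sigma_algebraType (F t)]
    (f : g_sigma_algebraType (F t) -> R).

Lemma filtration_gE t (A : set Omega) : 0 <= t <= T ->
  @measurable _ (g_sigma_algebraType (F t)) A = F t A.
Proof. by case: hF => hF1 _ _ /hF1 /sigma_algebra_id /(congr1 (fun M => M A)). Qed.

Lemma filtration_measurable t A : 0 <= t <= T -> F t A -> measurable A.
Proof. by case: hF => _ h _ /h; exact. Qed.

Lemma filtration_le s t A : 0 <= s -> s <= t -> t <= T -> F s A -> F t A.
Proof. by case: hF => _ _ h s0 st tT; exact: h. Qed.

Lemma adapted_atP t f : 0 <= t <= T ->
  adapted_at t f <-> measurable_wrt (F t) f.
Proof.
move=> t0T; split => [h B /borel_measurable mB|h _ B mB].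
  by rewrite -filtration_gE// -[_ @^-1` _]setTI; exact: h.
by rewrite setTI filtration_gE//; apply: h; exact: measurable_borel.
Qed.

Lemma adapted_at_measurable t f : 0 <= t <= T ->
  adapted_at t f -> measurable_fun setT f.
Proof.
move=> t0T /(adapted_atP _ t0T) h _ B mB; rewrite setTI.
by apply: (filtration_measurable t0T); apply: h; exact: measurable_borel.
Qed.

Lemma adapted_at_le s t f : 0 <= s -> s <= t -> t <= T ->
  adapted_at s f -> adapted_at t f.
Proof.
move=> s0 st tT.
have s1 : 0 <= s <= T by rewrite s0 (le_trans st).
have t1 : 0 <= t <= T by rewrite tT (le_trans s0).
move=> /(adapted_atP _ s1) h; apply/(adapted_atP _ t1) => B bB.
exact: (filtration_le s0 st tT (h B bB)).
Qed.

Lemma adapted_at_comp t (S : topologicalType) (X : Omega -> S) (g : S -> R) :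
  0 <= t <= T -> measurable_wrt (F t) X -> borel_fun g -> adapted_at t (g \o X).
Proof.
move=> t0T hX hg; apply/adapted_atP => // B bB.
by rewrite comp_preimage; apply: hX; exact: hg.
Qed.

Lemma adapted_at_coord t n (X : Omega -> 'cV[R]_n) i : 0 <= t <= T ->
  measurable_wrt (F t) X -> adapted_at t (fun omega => X omega i 0).
Proof.
move=> t0T hX.
apply: (@adapted_at_comp t _ X (fun v : 'cV[R]_n => v i 0)) => //.
by apply: continuous_borel => v; exact: coord_continuous.
Qed.

(** The open sets of R^n are countable unions of rational boxes. *)
Lemma coord_adapted_at t n (X : Omega -> 'cV[R]_n) : 0 <= t <= T ->
  (forall i, adapted_at t (fun omega => X omega i 0)) -> measurable_wrt (F t) X.
Proof.
move=> t0T hX.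
pose G := [set B : set 'cV[R]_n | @measurable _ (g_sigma_algebraType (F t)) (X @^-1` B)].
suff h : @borel_set 'cV[R]_n `<=` G by move=> B /h; rewrite /G/= filtration_gE.
apply: smallest_sub; rewrite /G.
  split => /=.
  - by rewrite preimage_set0; exact: measurable0.
  - by move=> A hA; rewrite setTD preimage_setC; exact: measurableC.
  - by move=> A hA; rewrite preimage_bigcup; exact: bigcup_measurable.
move=> U oU /=.
pose box (q : 'cV[rat]_n * nat) : set 'cV[R]_n :=
  [set u | forall i, `|u i 0 - ratr (q.1 i 0)| < q.2.+1%:R^-1].
have -> : U = \bigcup_q (if `[< box q `<=` U >] then box q else set0).
  apply/seteqP; split => [v Uv|v [q _]]; last by case: asboolP => // h /h.
  have /nbhs_ballP[e /= e0 ballU] : nbhs v U by exact: open_nbhs_nbhs.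
  have [k ke] : exists k, k.+1%:R^-1 < e / 2.
    have e20 : 0 < e / 2 by rewrite divr_gt0.
    exists (Num.trunc (e / 2)^-1).
    by rewrite invf_plt ?posrE// truncnS_gt// invr_ge0 ltW.
  have k0 : 0 < k.+1%:R^-1 :> R by rewrite invr_gt0.
  have /choice[q hq] : forall i, exists q, `|v i 0 - ratr q| < k.+1%:R^-1.
    move=> i.
    have [q] := rat_in_itvoo (ltr_pwDr k0 (lexx (v i 0))).
    rewrite in_itv/= => /andP[h1 h2]; exists q.
    by rewrite distrC gtr0_norm ?subr_gt0// ltrBlDl.
  exists (\col_i q i, k) => //.
  rewrite asboolT; first by move=> i; rewrite mxE.
  move=> u hu; apply: ballU; split => // i j; rewrite ord1.
  have := hu i; rewrite mxE => hui; have := hq i => hqi.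
  rewrite /ball/=.
  have -> : v i 0 - u i 0 = (v i 0 - ratr (q i)) - (u i 0 - ratr (q i)) by ring.
  rewrite (le_lt_trans (ler_normB _ _))//.
  by rewrite (lt_trans (ltrD hqi hui))// (splitr e) ltrD.
rewrite preimage_bigcup; apply: countable_bigcupT_measurable; first exact: countableP.
move=> q; case: asboolP => _; last by rewrite preimage_set0; exact: measurable0.
have -> : X @^-1` box q = \bigcap_(i in [set: 'I_n])
   ((fun omega => X omega i 0) @^-1` [set x | `|x - ratr (q.1 i 0)| < q.2.+1%:R^-1]).
  by apply/seteqP; split => [w h i _|w h i]; [exact: h|exact: (h i I)].
apply: fin_bigcap_measurable; first exact: finite_finset.
move=> i _; rewrite -[_ @^-1` _]setTI; apply: hX => //.
apply: open_measurable.
have -> : [set x | `|x - ratr (q.1 i 0)| < q.2.+1%:R^-1] = ball (ratr (q.1 i 0) : R) (q.2.+1%:R^-1).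
  by apply/seteqP; split => x; rewrite /ball/= distrC.
exact: ball_open.
Qed.

End filtration.

(** * Brownian increments over one time step *)
Section integral_law.
Context {R : realType} {d d' : measure_display} {Omega : measurableType d}.
Context {U : measurableType d'}.
Variables (P : probability Omega R) (Q : probability U R) (X : Omega -> U).
Hypotheses (mX : measurable_fun setT X).
Hypothesis XQ : forall A, measurable A -> P (X @^-1` A) = Q A.

Lemma ge0_integral_law (f : U -> \bar R) : measurable_fun setT f ->
  (forall y, 0 <= f y)%E -> (\int[P]_x f (X x) = \int[Q]_y f y)%E.
Proof.
move=> mf f0.
rewrite -[LHS](@ge0_integral_distribution _ _ _ _ _ P (mfun_Sub (mem_set mX)))//.
by apply: eq_measure_integral => A mA _; exact: XQ.
Qed.

Lemma integral_law (f : U -> \bar R) : measurable_fun setT f ->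
  Q.-integrable setT f -> (\int[P]_x f (X x) = \int[Q]_y f y)%E.
Proof.
move=> mf iQ.
rewrite -[LHS](@integral_distribution _ _ _ _ _ P (mfun_Sub (mem_set mX)))//.
  by apply: eq_measure_integral => A mA _; exact: XQ.
apply/integrableP; split; first exact: measurableT_comp.
rewrite [ltLHS](ge0_integral_law (f := abse \o f)).
- by have /integrableP[] := iQ.
- exact: measurableT_comp.
- by move=> y; exact: abse_ge0.
Qed.

End integral_law.

Section brownian_increments.
Context {R : realType} {d : measure_display} {Omega : measurableType d}.
Variables (P : probability Omega R) (T : R) (F : R -> set_system Omega).
Hypothesis hF : is_filtration T F.
Variables (l : nat) (w : R -> Omega -> 'cV[R]_l).
Hypothesis hw : is_brownian P T F w.

Definition increment (s t : R) (j : 'I_l) (omega : Omega) : R :=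
  w t omega j 0 - w s omega j 0.

Lemma increment_measurable s t j : 0 <= s -> s <= t -> t <= T ->
  measurable_fun setT (increment s t j).
Proof.
move=> s0 st tT.
have s1 : 0 <= s <= T by rewrite s0 (le_trans st).
have t1 : 0 <= t <= T by rewrite tT (le_trans s0).
apply: measurable_funB.
- apply: (adapted_at_measurable hF t1); apply: (adapted_at_coord hF) => //.
  exact: (brownian_adapted hw).
- apply: (adapted_at_measurable hF s1); apply: (adapted_at_coord hF) => //.
  exact: (brownian_adapted hw).
Qed.

Section positive_length.
Variables s t : R.
Hypotheses (s0 : 0 <= s) (st : s < t) (tT : t <= T).
Let st' : s <= t := ltW st.
Let s1 : 0 <= s <= T. Proof. by rewrite s0 (le_trans st'). Qed.
Let sd : 0 < Num.sqrt (t - s). Proof. by rewrite sqrtr_gt0 subr_gt0. Qed.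
Let mincr j := @increment_measurable s t j s0 st' tT.

Lemma increment_law j (B : set R) : measurable B ->
  P (increment s t j @^-1` B) = normal_prob 0 (Num.sqrt (t - s)) B.
Proof.
move=> mB.
pose C k : set R := if k == j then B else setT.
have mC k : measurable (C k) by rewrite /C; case: ifP.
have := brownian_gaussian hw s0 st tT mC.
rewrite (bigD1 j)//= big1 ?mule1; last first.
  by move=> k kj; rewrite /C (negbTE kj) probability_setT.
rewrite /C eqxx => <-; congr (P _); apply/seteqP; split=> omega /=.
  by move=> h k; case: eqP => // ->.
by move/(_ j); rewrite eqxx.
Qed.

Lemma increment_law2 j k (B C : set R) : j != k -> measurable B -> measurable C ->
  P (increment s t j @^-1` B `&` increment s t k @^-1` C) =
  (P (increment s t j @^-1` B) * P (increment s t k @^-1` C))%E.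
Proof.
move=> jk mB mC; rewrite !increment_law//.
pose D i : set R := if i == j then B else if i == k then C else setT.
have mD i : measurable (D i) by rewrite /D; case: ifP => // _; case: ifP.
have := brownian_gaussian hw s0 st tT mD.
rewrite (bigD1 j)//= (bigD1 k) 1?eq_sym//= big1 ?mule1; last first.
  by move=> i /andP[ij ik]; rewrite /D (negbTE ij) (negbTE ik) probability_setT.
rewrite /D eqxx eq_sym (negbTE jk) eqxx => <-; congr (P _).
apply/seteqP; split=> omega /=.
  move=> [h1 h2] i; case: eqP => [->//|_]; by case: eqP => [->|].
move=> h; split; first by have := h j; rewrite eqxx.
by have := h k; rewrite eq_sym (negbTE jk) eqxx.
Qed.

Lemma increment_integrable j : P.-integrable setT (EFin \o increment s t j).
Proof.
apply/integrableP; split; first exact/measurable_EFinP.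
rewrite [ltLHS](ge0_integral_law (Q := normal_prob 0 (Num.sqrt (t - s)))
    (mincr j) (@increment_law j) (f := fun x => `|x%:E|%E)).
- by have /integrableP[] := normal_prob_integrable_id sd.
- by apply: measurableT_comp => //; exact/measurable_EFinP.
- by move=> y; exact: abse_ge0.
Qed.

Lemma increment_mean j : (\int[P]_x (increment s t j x)%:E = 0)%E.
Proof.
rewrite [LHS](integral_law (Q := normal_prob 0 (Num.sqrt (t - s)))
    (mincr j) (@increment_law j) (f := fun x => x%:E)).
- exact: normal_prob_mean.
- exact/measurable_EFinP.
- exact: normal_prob_integrable_id.
Qed.

Lemma increment_sqr j :
  (\int[P]_x (increment s t j x ^+ 2)%:E <= (2 * (t - s))%:E)%E.
Proof.
rewrite [leLHS](ge0_integral_law (Q := normal_prob 0 (Num.sqrt (t - s)))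
    (mincr j) (@increment_law j) (f := fun x => (x ^+ 2)%:E)).
- rewrite (le_trans (normal_prob_second_moment sd))//.
  by rewrite sqr_sqrtr// subr_ge0.
- by apply/measurable_EFinP; exact: measurable_funX.
- by move=> x; rewrite lee_fin sqr_ge0.
Qed.

Lemma increment_integrable_sqr j :
  P.-integrable setT (EFin \o (fun x => increment s t j x ^+ 2)).
Proof.
apply/integrableP; split.
  by apply/measurable_EFinP; apply: measurable_funX; exact: mincr.
under eq_integral do rewrite /= ger0_norm ?sqr_ge0//.
by rewrite (le_lt_trans (increment_sqr j)) ?ltry.
Qed.

Lemma increment_cross j k : j != k ->
  P.-integrable setT (EFin \o (fun x => increment s t j x * increment s t k x)) /\
  (\int[P]_x (increment s t j x * increment s t k x)%:E = 0)%E.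
Proof.
move=> jk.
have [] := @indep_expectation_prod _ _ _ P _ _ (mincr j) (mincr k).
- by move=> A B mA mB; exact: increment_law2.
- exact: increment_integrable.
- exact: increment_integrable.
by move=> h1 h2; split => //; rewrite h2 increment_mean mul0e.
Qed.

(** Independence of the increment from the past is granted for events; this is
    its consequence for expectations. *)
Lemma adapted_increment_prod (c xi : Omega -> R) (C : R) (g : 'cV[R]_l -> R) :
  adapted_at F s c -> (forall omega, `|c omega| <= C) -> continuous g ->
  (forall omega, xi omega = g (w t omega - w s omega)) ->
  measurable_fun setT xi -> P.-integrable setT (EFin \o xi) ->
  P.-integrable setT (EFin \o (fun omega => c omega * xi omega)) /\
  (\int[P]_x (c x * xi x)%:E = (\int[P]_x (c x)%:E) * (\int[P]_x (xi x)%:E))%E.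
Proof.
move=> hc cC cg /funext xiE mg ig.
have mc := adapted_at_measurable hF s1 hc.
apply: indep_expectation_prod => //.
- move=> A B mA mB.
  rewrite xiE.
  have := brownian_independent hw s0 st tT (A := c @^-1` A) (B := g @^-1` B).
  apply.
    by move/(adapted_atP hF _ s1) : hc; apply; exact: measurable_borel.
  by apply: continuous_borel => //; exact: measurable_borel.
- apply: measurable_bounded_integrable => //.
    by rewrite (le_lt_trans (probability_le1 P measurableT)) ?ltry.
  exists C; split; first exact: num_real.
  by move=> x Cx omega _ /=; rewrite (le_trans (cC omega))// ltW.
Qed.

End positive_length.

Definition bounded_fun_by (C : R) (f : Omega -> R) := forall omega, `|f omega| <= C.

Lemma bounded_integrable (f : Omega -> R) C : measurable_fun setT f ->
  bounded_fun_by C f -> P.-integrable setT (EFin \o f).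
Proof.
move=> mf fC; apply: measurable_bounded_integrable => //.
  by rewrite (le_lt_trans (probability_le1 P measurableT)) ?ltry.
exists C; split; first exact: num_real.
by move=> x Cx omega _ /=; rewrite (le_trans (fC omega))// ltW.
Qed.

(** After expanding the square, the terms that are linear in the increments
    vanish because the increments are centred and independent of the past, and
    the products of increments of distinct coordinates vanish because these are
    independent of each other. Only the squares remain. *)
Lemma one_step_scalar s t (u : Omega -> R) (S : 'I_l -> Omega -> R) (C : R) :
  0 <= s -> s <= t -> t <= T ->
  adapted_at F s u -> (forall j, adapted_at F s (S j)) ->
  bounded_fun_by C u -> (forall j, bounded_fun_by C (S j)) ->
  (\int[P]_x ((u x + \sum_j S j x * increment s t j x) ^+ 2)%:E <=
   \int[P]_x (u x ^+ 2 + 2 * (t - s) * \sum_j S j x ^+ 2)%:E)%E.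
Proof.
move=> s0 st tT hu hS uC SC.
have s1 : 0 <= s <= T by rewrite s0 (le_trans st).
have mu_ := adapted_at_measurable hF s1 hu.
have mS j := adapted_at_measurable hF s1 (hS j).
move: st; rewrite le_eqVlt => /predU1P[stE|st].
  subst t; rewrite le_eqVlt; apply/orP; left; apply/eqP; apply: eq_integral => x _.
  rewrite subrr mulr0 mul0r addr0 big1 ?addr0// => j _.
  by rewrite /increment subrr mulr0.
have C0 : 0 <= C by rewrite (le_trans _ (uC point)).
have bM f g : bounded_fun_by C f -> bounded_fun_by C g ->
    bounded_fun_by (C * C) (fun x => f x * g x).
  by move=> fC gC x; rewrite normrM ler_pM.
have mincr j := @increment_measurable s t j s0 (ltW st) tT.
have lin c j : adapted_at F s c -> bounded_fun_by (C * C) c ->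
    P.-integrable setT (EFin \o (fun x => c x * increment s t j x)) /\
    (\int[P]_x (c x * increment s t j x)%:E = 0)%E.
  move=> hc cC.
  have [] // := @adapted_increment_prod s t s0 st tT c (increment s t j) _
    (fun v => v j 0) hc cC _ _ (mincr j) (increment_integrable s0 st tT j).
  - by move=> v; exact: coord_continuous.
  - by move=> x; rewrite !mxE.
  - by rewrite increment_mean// mule0.
have crossjk c j k : adapted_at F s c -> bounded_fun_by (C * C) c ->
    P.-integrable setT (EFin \o (fun x => increment s t j x * increment s t k x)) ->
    P.-integrable setT
      (EFin \o (fun x => c x * (increment s t j x * increment s t k x))) /\
    (\int[P]_x (c x * (increment s t j x * increment s t k x))%:E =
     (\int[P]_x (c x)%:E) *
      \int[P]_x (increment s t j x * increment s t k x)%:E)%E.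
  move=> hc cC ijk.
  apply: (@adapted_increment_prod s t s0 st tT c _ _
    (fun v => v j 0 * v k 0) hc cC) => //; last exact: measurable_funM.
  - have cc i : continuous (fun v : 'cV[R]_l => v i 0).
      by move=> v; exact: coord_continuous.
    by move=> v; exact: (cvgM (cc j v) (cc k v)).
  - by move=> x; rewrite !mxE.
have sqE x : (u x + \sum_j S j x * increment s t j x) ^+ 2 =
    u x ^+ 2 + \sum_j (2 * (u x * S j x)) * increment s t j x +
    \sum_j \sum_k (S j x * S k x) * (increment s t j x * increment s t k x).
  rewrite sqrrD expr2; congr (_ + _ + _).
    rewrite -mulr_natl mulr_sumr mulr_sumr; apply: eq_bigr => j _; ring.
  rewrite expr2 mulr_suml; apply: eq_bigr => j _.
  rewrite mulr_sumr; apply: eq_bigr => k _; ring.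
have i1 : P.-integrable setT (EFin \o (fun x => u x ^+ 2)).
  apply: (@bounded_integrable _ (C * C)); first exact: measurable_funX.
  by rewrite /= ; under eq_fun do rewrite expr2; exact: bM.
have iuS j : P.-integrable setT (EFin \o (fun x => u x * S j x * increment s t j x)) /\
    (\int[P]_x (u x * S j x * increment s t j x)%:E = 0)%E.
  by apply: lin; [exact: (measurable_funM hu (hS j))|exact: bM].
have i2 j : P.-integrable setT (fun x => (2 * (u x * S j x) * increment s t j x)%:E) /\
    (\int[P]_x (2 * (u x * S j x) * increment s t j x)%:E = 0)%E.
  have [h1 h2] := iuS j.
  have E : (fun x => (2 * (u x * S j x) * increment s t j x)%:E) =
           (fun x => (2 * (u x * S j x * increment s t j x))%:E).
    by apply/funext => x; rewrite -!mulrA.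
  rewrite E; split; first exact: (integrableZl measurableT 2 h1).
  have := integralZl measurableT h1 2.
  by rewrite h2 mule0.
have ijk j k : P.-integrable setT
    (EFin \o (fun x => increment s t j x * increment s t k x)).
  have [->|jk] := eqVneq j k; first exact: increment_integrable_sqr.
  by have [] := increment_cross s0 st tT jk.
have i3 j k := @crossjk _ j k (measurable_funM (hS j) (hS k))
  (bM _ _ (SC j) (SC k)) (ijk j k).
have i3' j : P.-integrable setT (fun x => \sum_k (S j x * S k x *
    (increment s t j x * increment s t k x))%:E).
  by apply: integrable_sum => // k _; exact: (i3 j k).1.
under eq_integral do rewrite sqE !EFinD.
under eq_integral do rewrite -!sumEFin.
under eq_integral => x _.
  under [X in (_ + X)%E]eq_bigr do rewrite -sumEFin.
  over.
rewrite integralD//; last 2 first.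
- apply: integrableD => //; apply: integrable_sum => // j _; exact: (i2 j).1.
- by apply: integrable_sum => // j _; exact: i3'.
rewrite integralD//; last first.
  by apply: integrable_sum => // j _; exact: (i2 j).1.
rewrite integral_sum//; last by move=> j; exact: (i2 j).1.
rewrite big1 ?adde0; last by move=> j _; exact: (i2 j).2.
under [leRHS]eq_integral do rewrite EFinD.
have iS j : P.-integrable setT (EFin \o (fun x => S j x ^+ 2)).
  apply: (@bounded_integrable _ (C * C)); first exact: measurable_funX.
  by rewrite /= ; under eq_fun do rewrite expr2; exact: bM.
have iS' : P.-integrable setT (fun x => \sum_j (2 * (t - s) * S j x ^+ 2)%:E).
  by apply: integrable_sum => // j _; exact: (integrableZl measurableT _ (iS j)).
under [leRHS]eq_integral do rewrite mulr_sumr -sumEFin.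
rewrite [leRHS]integralD//.
rewrite leeD2lE; last exact: integrable_fin_num.
rewrite integral_sum// integral_sum; last 2 first.
- by [].
- by move=> j; exact: (integrableZl measurableT _ (iS j)).
apply: lee_sum => j _.
rewrite integral_sum//; last by move=> k; exact: (i3 j k).1.
rewrite (bigD1 j)//= big1 ?adde0; last first.
  move=> k kj; rewrite (i3 j k).2.
  have jk : j != k by rewrite eq_sym.
  by have [_ ->] := increment_cross s0 st tT jk; rewrite mule0.
rewrite (i3 j j).2.
have -> : (\int[P]_x (2 * (t - s) * S j x ^+ 2)%:E =
    (2 * (t - s))%:E * \int[P]_x (S j x ^+ 2)%:E)%E.
  exact: (integralZl measurableT (iS j)).
rewrite muleC; apply: lee_wpmul2r; first by apply: integral_ge0 => x _; rewrite lee_fin; exact: sqr_ge0.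
exact: increment_sqr.
Qed.

(** The event A belongs to the past: multiplying the coefficients by its
    indicator keeps them adapted and makes them bounded everywhere. *)
Lemma one_step (I : finType) s t (A : set Omega) (u : I -> Omega -> R)
    (S : I -> 'I_l -> Omega -> R) (C : R) :
  0 <= s -> s <= t -> t <= T -> F s A ->
  (forall i, adapted_at F s (u i)) -> (forall i j, adapted_at F s (S i j)) ->
  (forall i omega, A omega -> `|u i omega| <= C) ->
  (forall i j omega, A omega -> `|S i j omega| <= C) ->
  (\int[P]_(x in A)
      (\sum_i (u i x + \sum_j S i j x * increment s t j x) ^+ 2)%:E <=
   \int[P]_(x in A)
      (\sum_i (u i x ^+ 2 + 2 * (t - s) * \sum_j S i j x ^+ 2))%:E)%E.
Proof.
move=> s0 st tT FA hu hS uC SC.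
have s1 : 0 <= s <= T by rewrite s0 (le_trans st).
have mA := filtration_measurable hF s1 FA.
have m1 : adapted_at F s \1_A.
  by apply/measurable_indicP; rewrite (filtration_gE hF).
have mincr j := @increment_measurable s t j s0 st tT.
have mu_ i := adapted_at_measurable hF s1 (hu i).
have mS i j := adapted_at_measurable hF s1 (hS i j).
have ind (f : Omega -> R) : (\int[P]_(x in A) (f x)%:E =
                             \int[P]_x (\1_A x * f x)%:E)%E.
  rewrite integral_mkcond; apply: eq_integral => x _.
  by rewrite patchE indicE; case: ifP; rewrite ?mul1r ?mul0r.
rewrite !ind.
under eq_integral do rewrite mulr_sumr -sumEFin.
under [leRHS]eq_integral do rewrite mulr_sumr -sumEFin.
have mL i : measurable_fun setT
    (fun x => (\1_A x * (u i x + \sum_j S i j x * increment s t j x) ^+ 2)%:E).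
  apply/measurable_EFinP; apply: measurable_funM; first exact: measurable_indic.
  apply: measurable_funX; apply: measurable_funD => //; apply: measurable_sum => j.
  exact: measurable_funM.
have mR i : measurable_fun setT
    (fun x => (\1_A x * (u i x ^+ 2 + 2 * (t - s) * \sum_j S i j x ^+ 2))%:E).
  apply/measurable_EFinP; apply: measurable_funM; first exact: measurable_indic.
  apply: measurable_funD; first exact: measurable_funX.
  apply: measurable_funM => //; apply: measurable_sum => j; exact: measurable_funX.
have ts0 : 0 <= 2 * (t - s) by rewrite mulr_ge0// subr_ge0.
rewrite ge0_integral_sum//; last first.
  by move=> i x _; rewrite lee_fin mulr_ge0 ?sqr_ge0// indicE ler0n.
rewrite ge0_integral_sum//; last first.
  move=> i x _; rewrite lee_fin mulr_ge0 ?indicE// addr_ge0 ?sqr_ge0// mulr_ge0//.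
  by apply: sumr_ge0 => j _; exact: sqr_ge0.
apply: lee_sum => i _.
pose u' x := \1_A x * u i x; pose S' j x := \1_A x * S i j x.
have idem x : \1_A x = \1_A x ^+ 2 :> R.
  by rewrite indicE; case: (_ \in _); rewrite ?expr1n// expr0n.
have b1 (f : Omega -> R) : (forall omega, A omega -> `|f omega| <= C) ->
    bounded_fun_by `|C| (fun x => \1_A x * f x).
  move=> fC x; rewrite indicE; have [Ax|nAx] := pselect (A x).
    by rewrite mem_set// mul1r (le_trans (fC _ Ax))// ler_norm.
  by rewrite memNset// mul0r normr0.
have := @one_step_scalar s t u' S' `|C| s0 st tT
  (measurable_funM m1 (hu i)) (fun j => measurable_funM m1 (hS i j))
  (b1 _ (uC i)) (fun j => b1 _ (SC i j)).
congr (_ <= _)%E; apply: eq_integral => x _; congr (_%:E).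
  have -> : u' x + \sum_j S' j x * increment s t j x =
      \1_A x * (u i x + \sum_j S i j x * increment s t j x).
    by rewrite mulrDr mulr_sumr; congr (_ + _); apply: eq_bigr => j _; rewrite mulrA.
  by rewrite exprMn -idem.
rewrite [RHS]mulrDr /u' exprMn -idem; congr (_ + _).
rewrite mulrCA; congr (_ * _); rewrite mulr_sumr; apply: eq_bigr => j _.
by rewrite /S' exprMn -idem.
Qed.

(** * A maximal inequality on time grids *)
Section maximal_inequality.
Variables (I : finType) (m : nat) (g : nat -> R).
Hypothesis g_le : forall k, (k < m)%N -> g k <= g k.+1.
Hypothesis g_in : forall k, (k <= m)%N -> 0 <= g k <= T.
Variables (G : nat -> set Omega) (Y B : nat -> I -> Omega -> R).
Variable S : nat -> I -> 'I_l -> Omega -> R.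
Variables (a : nat -> Omega -> R) (C c kappa v0 al lambda : R).
Hypothesis FG : forall k, (k < m)%N -> F (g k) (G k).
Hypothesis G_decr : forall k, (k.+1 < m)%N -> G k.+1 `<=` G k.
Hypothesis adY : forall k i, (k <= m)%N -> adapted_at F (g k) (Y k i).
Hypothesis adB : forall k i, (k < m)%N -> adapted_at F (g k) (B k i).
Hypothesis adS : forall k i j, (k < m)%N -> adapted_at F (g k) (S k i j).
Hypothesis Y_rec : forall k i omega, (k < m)%N -> G k omega ->
  Y k.+1 i omega = Y k i omega + B k i omega * (g k.+1 - g k)
    + \sum_j S k i j omega * increment (g k) (g k.+1) j omega.
Hypothesis B_bnd : forall k i omega, (k < m)%N -> G k omega -> `|B k i omega| <= C.
Hypothesis S_bnd : forall k i j omega, (k < m)%N -> G k omega ->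
  `|S k i j omega| <= C.
Hypothesis meas_a : forall k, (k < m)%N -> measurable_fun setT (a k).
Hypothesis a_ge0 : forall k omega, 0 <= a k omega.
Hypothesis growth_Y : forall k omega, (k < m)%N -> G k omega ->
  2 * \sum_i Y k i omega * B k i omega
    + (g k.+1 - g k) * \sum_i B k i omega ^+ 2
    + 2 * \sum_i \sum_j S k i j omega ^+ 2
  <= c * (kappa + \sum_i Y k i omega ^+ 2) + a k omega.
Hypothesis al_bnd : (\sum_(k < m)
  ((g k.+1 - g k)%:E * \int[P]_(x in G k) (a k x)%:E) <= al%:E)%E.
Hypothesis Y_init : forall omega, kappa + \sum_i Y 0 i omega ^+ 2 <= v0.
Hypotheses (c_ge0 : 0 <= c) (kappa_ge0 : 0 <= kappa) (lambda_gt0 : 0 < lambda).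

Let V k omega := kappa + \sum_i Y k i omega ^+ 2.

(** Stopping is expressed by restricting expectations to the event that, so far,
    G has held and V has not exceeded lambda. *)
Fixpoint below (k : nat) : set Omega :=
  if k is k'.+1 then below k' `&` G k' `&` [set omega | V k omega <= lambda]
  else setT.

Let alive k := below k `&` G k.
Let exit k := alive k `&` [set omega | lambda < V k.+1 omega].

Let V_ge0 k omega : 0 <= V k omega.
Proof. by rewrite addr_ge0// sumr_ge0// => i _; exact: sqr_ge0. Qed.

Let adV k : (k <= m)%N -> adapted_at F (g k) (V k).
Proof.
move=> km; apply: measurable_funD => //; apply: measurable_sum => i.
by apply: measurable_funX; exact: adY.
Qed.

Let F_set k (A : set Omega) : (k <= m)%N ->
  measurable (A : set (g_sigma_algebraType (F (g k)))) -> F (g k) A.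
Proof. by move=> km; rewrite (filtration_gE hF)//; exact: g_in. Qed.

Let F_below k : (k <= m)%N -> F (g k) (below k).
Proof.
elim: k => [_|k IH km].
  by apply: F_set => //; exact: measurableT.
have gk1 := g_in (ltnW km); have gk2 := g_in km.
have lift A : F (g k) A -> F (g k.+1) A.
  apply: (filtration_le hF).
  - by case/andP : gk1.
  - exact: g_le.
  - by case/andP : gk2.
apply: F_set => //=; apply: measurableI; first apply: measurableI.
- by rewrite (filtration_gE hF)//; apply: lift; exact: IH (ltnW km).
- by rewrite (filtration_gE hF)//; apply: lift; exact: FG.
- have := adV km measurableT (measurable_itv `]-oo, lambda]).
  by rewrite setTI; congr measurable; apply/seteqP; split => x /=; rewrite in_itv.
Qed.

Let F_alive k : (k < m)%N -> F (g k) (alive k).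
Proof.
move=> km; apply: F_set; first exact: ltnW.
apply: measurableI; rewrite (filtration_gE hF)//; try exact: g_in (ltnW km).
- exact: F_below (ltnW km).
- exact: FG.
Qed.

Let mV k : (k <= m)%N -> measurable_fun setT (V k).
Proof. by move=> km; apply: (adapted_at_measurable hF (g_in km)); exact: adV. Qed.

Let mbelow k : (k <= m)%N -> measurable (below k).
Proof. by move=> km; apply: (filtration_measurable hF (g_in km)); exact: F_below. Qed.

Let malive k : (k < m)%N -> measurable (alive k).
Proof.
move=> km; apply: (filtration_measurable hF (g_in (ltnW km))); exact: F_alive.
Qed.

Let mexit k : (k < m)%N -> measurable (exit k).
Proof.
move=> km; apply: measurableI; first exact: malive.
have := mV km measurableT (measurable_itv `]lambda, +oo[).
by rewrite setTI; congr measurable; apply/seteqP; split => x /=; rewrite in_itv/= andbT.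
Qed.

Let V_alive k omega : alive k omega -> V k omega <= Num.max v0 lambda.
Proof.
case: k => [_|k [[_ /= h] _]]; first by rewrite le_max Y_init.
by rewrite le_max h orbT.
Qed.

Let D := 1 + Num.max v0 lambda.

Let Y_alive k i omega : alive k omega -> `|Y k i omega| <= D.
Proof.
move=> /V_alive h.
have : Y k i omega ^+ 2 <= Num.max v0 lambda.
  apply: le_trans h; rewrite /V (bigD1 i)//= addrCA lerDl addr_ge0// sumr_ge0//.
  by move=> j _; exact: sqr_ge0.
rewrite /D -(real_normK (num_real _)); move: (Num.max _ _) => M.
by have := sqr_ge0 (`|Y k i omega| - 1); rewrite sqrrB1; nra.
Qed.

(** By [one_step], where the growth hypothesis absorbs all the terms that are
    proportional to the time step. *)
Let step_expectation k : (k < m)%N ->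
  (\int[P]_(x in alive k) (V k.+1 x)%:E <=
   (1 + c * (g k.+1 - g k))%:E * \int[P]_(x in alive k) (V k x)%:E +
   (g k.+1 - g k)%:E * \int[P]_(x in G k) (a k x)%:E)%E.
Proof.
move=> km; have kg := g_le km.
have g1 := g_in (ltnW km); have g2 := g_in km.
set h := g k.+1 - g k; have h0 : 0 <= h by rewrite subr_ge0.
have g10 : 0 <= g k by case/andP : g1.
have g21 : g k.+1 <= T by case/andP : g2.
pose u i x := Y k i x + B k i x * h.
have adu i : adapted_at F (g k) (u i).
  apply: measurable_funD; first exact: (adY i (ltnW km)).
  by apply: measurable_funM => //; exact: adB.
have mA := malive km.
have mincr j := @increment_measurable (g k) (g k.+1) j g10 kg g21.
have mu_ i := adapted_at_measurable hF g1 (adu i).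
have mS i j := adapted_at_measurable hF g1 (adS i j km).
have C0 omega : alive k omega -> (I -> 0 <= C).
  by move=> [_ Gk] i; rewrite (le_trans _ (B_bnd i km Gk)).
have := @one_step I (g k) (g k.+1) (alive k) u (S k) (D + `|C| * h + `|C|) g10 kg g21 (F_alive km)
  adu (fun i j => adS i j km).
have D0 : 0 <= D by rewrite addr_ge0// le_max (ltW lambda_gt0) orbT.
have Ch0 : 0 <= `|C| * h by rewrite mulr_ge0.
have uC i omega : alive k omega -> `|u i omega| <= D + `|C| * h + `|C|.
  move=> Ak; rewrite (le_trans (ler_normD _ _))//.
  rewrite -[leLHS]addr0 lerD// lerD ?Y_alive//.
  rewrite normrM (ger0_norm h0) ler_wpM2r// (le_trans _ (ler_norm C))//.
  by case: Ak => _; exact: B_bnd.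
have SC i j omega : alive k omega -> `|S k i j omega| <= D + `|C| * h + `|C|.
  move=> [_ Gk]; rewrite (le_trans (S_bnd i j km Gk))// (le_trans (ler_norm _))//.
  by rewrite lerDr addr_ge0.
move=> /(_ uC SC) onestep.
have nn1 x : 0 <= \sum_i (u i x + \sum_j S k i j x * increment (g k) (g k.+1) j x) ^+ 2.
  by apply: sumr_ge0 => i _; exact: sqr_ge0.
have nn2 x : 0 <= \sum_i (u i x ^+ 2 + 2 * h * \sum_j S k i j x ^+ 2).
  apply: sumr_ge0 => i _; rewrite addr_ge0 ?sqr_ge0// mulr_ge0 ?mulr_ge0//.
  by apply: sumr_ge0 => j _; exact: sqr_ge0.
have m1 : measurable_fun setT (fun x =>
    \sum_i (u i x + \sum_j S k i j x * increment (g k) (g k.+1) j x) ^+ 2).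
  apply: measurable_sum => i; apply: measurable_funX; apply: measurable_funD => //.
  by apply: measurable_sum => j; exact: measurable_funM.
have m2 : measurable_fun setT (fun x =>
    \sum_i (u i x ^+ 2 + 2 * h * \sum_j S k i j x ^+ 2)).
  apply: measurable_sum => i; apply: measurable_funD; first exact: measurable_funX.
  by apply: measurable_funM => //; apply: measurable_sum => j; exact: measurable_funX.
have -> : (\int[P]_(x in alive k) (V k.+1 x)%:E =
    \int[P]_(x in alive k) (kappa%:E +
     (\sum_i (u i x + \sum_j S k i j x * increment (g k) (g k.+1) j x) ^+ 2)%:E))%E.
  apply: eq_integral => x /[!inE] -[_ Gk]; rewrite -EFinD; congr (_%:E).
  by rewrite /V; congr (_ + _); apply: eq_bigr => i _; rewrite Y_rec.
rewrite ge0_integralD//; last 2 first.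
- by move=> x _; rewrite lee_fin.
- by apply/measurable_EFinP; exact: measurable_funTS.
apply: (@le_trans _ _ (\int[P]_(x in alive k) (kappa%:E +
   (\sum_i (u i x ^+ 2 + 2 * h * \sum_j S k i j x ^+ 2))%:E))%E).
  rewrite ge0_integralD//; last 2 first.
  - by move=> x _; rewrite lee_fin.
  - by apply/measurable_EFinP; exact: measurable_funTS.
  exact: leeD2l.
have h1 : 0 <= 1 + c * h by rewrite addr_ge0// mulr_ge0.
apply: (@le_trans _ _ (\int[P]_(x in alive k) ((1 + c * h)%:E * (V k x)%:E + h%:E * (a k x)%:E))%E).
  apply: ge0_le_integral => //.
  - by move=> x _; rewrite -EFinD lee_fin addr_ge0.
  - by apply: emeasurable_funD => //; apply/measurable_EFinP; exact: measurable_funTS.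
  - apply: emeasurable_funD; apply: emeasurable_funM => //; apply/measurable_EFinP;
      apply: measurable_funTS; [exact: mV (ltnW km)|exact: meas_a].
  - move=> x [_ Gk]; rewrite -!EFinM -!EFinD lee_fin.
    have := growth_Y km Gk; rewrite -/h => gr.
    have key (e : R) :
        \sum_i ((Y k i x + B k i x * e) ^+ 2 + 2 * e * \sum_j S k i j x ^+ 2) =
        \sum_i Y k i x ^+ 2 + e * (2 * (\sum_i Y k i x * B k i x)
        + e * (\sum_i B k i x ^+ 2) + 2 * \sum_i \sum_j S k i j x ^+ 2).
      rewrite !mulrDr !mulr_sumr -!big_split/=; apply: eq_bigr => i _.
      by ring.
    rewrite /u key.
    by rewrite /V; have := ler_wpM2l h0 gr; nra.
rewrite ge0_integralD//; last 4 first.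
- by move=> x _; rewrite -EFinM lee_fin mulr_ge0.
- by apply: emeasurable_funM => //; apply/measurable_EFinP; apply: measurable_funTS; exact: mV (ltnW km).
- by move=> x _; rewrite -EFinM lee_fin mulr_ge0.
- by apply: emeasurable_funM => //; apply/measurable_EFinP; apply: measurable_funTS; exact: meas_a.
rewrite ge0_integralZl//; last 2 first.
- by apply/measurable_EFinP; apply: measurable_funTS; exact: mV (ltnW km).
- by move=> x _; rewrite lee_fin.
rewrite ge0_integralZl//; last 2 first.
- by apply/measurable_EFinP; apply: measurable_funTS; exact: meas_a.
- by move=> x _; rewrite lee_fin.
apply: leeD2l; apply: lee_wpmul2l; first by rewrite lee_fin.
apply: ge0_subset_integral => //.
- by apply: (filtration_measurable hF g1); exact: FG.
- by apply/measurable_EFinP; apply: measurable_funTS; exact: meas_a.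
- by move=> x _; rewrite lee_fin.
- by move=> x [].
Qed.

(** The energy of the paths that are still inside, plus lambda times the
    probability of an exit. As a path that exits carries energy at least lambda,
    this quantity is dominated by the energy of the stopped process. *)
Let U k : \bar R := (\int[P]_(x in below k) (V k x)%:E +
   lambda%:E * \sum_(j < k) P (exit j))%E.

Let step_U k : (k < m)%N -> (U k.+1 <= (1 + c * (g k.+1 - g k))%:E * U k +
   (g k.+1 - g k)%:E * \int[P]_(x in G k) (a k x)%:E)%E.
Proof.
move=> km; have kg := g_le km.
set h := g k.+1 - g k; have h0 : 0 <= h by rewrite subr_ge0.
have h1 : 0 <= 1 + c * h by rewrite addr_ge0// mulr_ge0.
have mVs A : measurable_fun A (EFin \o V k.+1).
  by apply/measurable_EFinP; apply: measurable_funTS; exact: mV km.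
have mVs' A : measurable_fun A (EFin \o V k).
  by apply/measurable_EFinP; apply: measurable_funTS; exact: mV (ltnW km).
have E0 : (0 <= \sum_(j < k) P (exit j))%E by apply: sume_ge0.
have split_alive : (\int[P]_(x in below k.+1) (V k.+1 x)%:E + lambda%:E * P (exit k) <=
     \int[P]_(x in alive k) (V k.+1 x)%:E)%E.
  have -> : alive k = below k.+1 `|` exit k.
    apply/seteqP; split => [x Ax|x [[]//|[]//]].
    by have [h'|h'] := leP (V k.+1 x) lambda; [left|right].
  rewrite ge0_integral_setU//; last 4 first.
  - exact: mbelow km.
  - exact: mexit.
  - by move=> x _; rewrite lee_fin.
  - apply/disj_setPS => x [[_ /= h2] [_ /=]].
    by rewrite ltNge h2.
  apply: leeD2l; rewrite -integral_cst; last exact: mexit.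
  apply: ge0_le_integral => //.
  - exact: mexit.
  - by move=> x _; rewrite lee_fin ltW.
  - by move=> x [_ /= h2]; rewrite lee_fin ltW.
have -> : (U k.+1 = \int[P]_(x in below k.+1) (V k.+1 x)%:E + lambda%:E * P (exit k) +
    lambda%:E * \sum_(j < k) P (exit j))%E.
  rewrite /U big_ord_recr/= ge0_muleDr//.
  by rewrite [X in (_ + X = _)%E]addeC addeA.
apply: le_trans (leeD2r _ split_alive) _.
apply: le_trans (leeD2r _ (step_expectation km)) _.
rewrite -/h addeAC; apply: leeD2r.
have -> : ((1 + c * h)%:E * U k = (1 + c * h)%:E * \int[P]_(x in below k) (V k x)%:E +
    (1 + c * h)%:E * (lambda%:E * \sum_(j < k) P (exit j)))%E.
  apply: ge0_muleDr; first by apply: integral_ge0 => x _; rewrite lee_fin.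
  by rewrite mule_ge0// lee_fin ltW.
apply: leeD.
  apply: lee_wpmul2l; first by rewrite lee_fin.
  apply: ge0_subset_integral => //.
  - exact: malive.
  - exact: mbelow (ltnW km).
  - by move=> x _; rewrite lee_fin.
  - by move=> x [].
rewrite -[leLHS]mul1e; apply: lee_wpmul2r; first by rewrite mule_ge0// lee_fin ltW.
by rewrite lee_fin lerDl mulr_ge0.
Qed.

Let alpha k : \bar R := ((g k.+1 - g k)%:E * \int[P]_(x in G k) (a k x)%:E)%E.

Let alpha_ge0 k : (k < m)%N -> (0 <= alpha k)%E.
Proof.
move=> km; apply: mule_ge0; first by rewrite lee_fin subr_ge0 g_le.
by apply: integral_ge0 => x _; rewrite lee_fin.
Qed.

Let v0_ge0 : 0 <= v0.
Proof. exact: le_trans (V_ge0 0 point) (Y_init point). Qed.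

(** Gronwall's lemma in discrete time, with 1 + u <= exp u. *)
Let U_bound k : (k <= m)%N ->
  (U k <= (expR (c * (g k - g 0%N)))%:E * (v0%:E + \sum_(j < k) alpha j))%E.
Proof.
elim: k => [_|k IH km].
  rewrite subrr mulr0 expR0 mul1e big_ord0 adde0 /U big_ord0 mule0 adde0/=.
  apply: (@le_trans _ _ (\int[P]_x v0%:E)%E).
    apply: ge0_le_integral => //.
    - by move=> x _; rewrite lee_fin.
    - by apply/measurable_EFinP; exact: mV.
    - by move=> x _; rewrite lee_fin Y_init.
  by rewrite integral_cst// [X in (_ * X)%E]probability_setT mule1.
have kg := g_le km; set h := g k.+1 - g k; have h0 : 0 <= h by rewrite subr_ge0.
have h1 : 0 <= 1 + c * h by rewrite addr_ge0// mulr_ge0.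
have gk0 : g 0%N <= g k.
  elim: k km {IH kg h h0 h1} => // k IHk km.
  exact: le_trans (IHk (ltnW km)) (g_le (ltnW km)).
have S0 : (0 <= v0%:E + \sum_(j < k) alpha j)%E.
  rewrite adde_ge0 ?lee_fin//; apply: sume_ge0 => j _; apply: alpha_ge0.
  exact: ltn_trans (ltn_ord j) km.
apply: le_trans (step_U km) _.
have -> : c * (g k.+1 - g 0%N) = c * h + c * (g k - g 0%N) by rewrite /h; ring.
rewrite big_ord_recr/= addeA [leRHS]ge0_muleDr ?alpha_ge0//.
apply: leeD.
  rewrite expRD EFinM -muleA.
  apply: (@le_trans _ _ ((1 + c * h)%:E *
     ((expR (c * (g k - g 0%N)))%:E * (v0%:E + \sum_(j < k) alpha j)))%E).
    by apply: lee_wpmul2l; [rewrite lee_fin|exact: IH (ltnW km)].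
  apply: lee_wpmul2r; first by rewrite mule_ge0// lee_fin expR_ge0.
  by rewrite lee_fin expR_ge1Dx.
rewrite -/(alpha k) -[leLHS]mul1e; apply: lee_wpmul2r; first exact: alpha_ge0.
rewrite lee_fin -expR0 ler_expR addr_ge0// mulr_ge0// subr_ge0//.
Qed.

(** As long as G holds, the first time at which V exceeds lambda is an exit, and
    lambda times the probability of the exits is part of the energy [U]. *)
Lemma discrete_maximal_inequality :
  (P (\bigcup_(k in `I_m)
      (G k `&` [set omega | (lambda < kappa + \sum_i Y k.+1 i omega ^+ 2)%R])) <=
   (expR (c * T) * (v0 + al) / lambda)%:E)%E.
Proof.
have sub : \bigcup_(k in `I_m) (G k `&` [set omega | (lambda < V k.+1 omega)%R])
    `<=` \big[setU/set0]_(j < m) exit j.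
  move=> omega [k /= km [Gk Vk]]; rewrite -bigcup_mkord.
  have claim : (exists2 j, (j < k)%N & exit j omega) \/ below k omega.
    elim: k km Gk {Vk} => [_ _|k IH km Gk1]; first by right.
    have Gk := G_decr km Gk1.
    have [[j jk Ej]|bk] := IH (ltnW km) Gk; first by left; exists j => //; exact: ltnW.
    have [h|h] := leP (V k.+1 omega) lambda; first by right.
    by left; exists k.
  have [[j jk Ej]|bk] := claim; last by exists k.
  by exists j => //=; exact: ltn_trans km.
have al0 : (\sum_(j < m) alpha j <= al%:E)%E := al_bnd.
have gm : g m - g 0%N <= T.
  have /andP[_ h1] := g_in (leqnn m); have /andP[h2 _] := g_in (leq0n m).
  by rewrite lerBlDr (le_trans h1)// lerDl.
have T0 : 0 <= T by have /andP[h1 h2] := g_in (leqnn m); exact: le_trans h1 h2.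
have am0 : (0 <= \sum_(j < m) alpha j)%E by apply: sume_ge0 => j _; exact: alpha_ge0.
have al_ge0 : 0 <= al by rewrite -lee_fin (le_trans am0).
have E0 : (0 <= \sum_(j < m) P (exit j))%E by apply: sume_ge0.
have mU : measurable (\big[setU/set0]_(j < m) exit j).
  by apply: bigsetU_measurable => j _; exact: mexit.
have mL : measurable (\bigcup_(k in `I_m) (G k `&` [set omega | (lambda < V k.+1 omega)%R])).
  apply: bigcup_measurable => k /= km; apply: measurableI.
    by apply: (filtration_measurable hF (g_in (ltnW km))); exact: FG.
  have := mV km measurableT (measurable_itv `]lambda, +oo[).
  by rewrite setTI; congr measurable; apply/seteqP; split => x /=; rewrite in_itv/= andbT.
apply: (@le_trans _ _ (\sum_(j < m) P (exit j))%E).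
  apply: (@le_trans _ _ (P (\big[setU/set0]_(j < m) exit j))).
    by apply: le_measure; rewrite ?inE.
  by apply: Boole_inequality => j jm; exact: mexit.
have : (lambda%:E * \sum_(j < m) P (exit j) <= (expR (c * T) * (v0 + al))%:E)%E.
  apply: (@le_trans _ _ (U m)).
    rewrite /U leeDr//; apply: integral_ge0 => x _; by rewrite lee_fin.
  apply: le_trans (U_bound (leqnn m)) _.
  rewrite EFinM; apply: lee_pmul => //.
  - by rewrite adde_ge0.
  - by rewrite lee_fin ler_expR ler_wpM2l.
  - by rewrite EFinD; exact: leeD.
by rewrite muleC -lee_pdivlMr// EFinM.
Qed.

End maximal_inequality.

End brownian_increments.

(** * Comparison of schemes with frozen coefficients *)
Section coefficients.
Context {R : realType} {r l : nat}.
Variables (b : 'cV[R]_r -> 'cV[R]_r) (sigma : 'cV[R]_r -> 'M[R]_(r, l)).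

Definition sqnorm (y : 'cV[R]_r) : R := \sum_i y i 0 ^+ 2.

Definition sqdist (y z : 'cV[R]_r) : R := \sum_i (y i 0 - z i 0) ^+ 2.

Definition sq_lipschitz_on (N L : R) := forall y z, sqnorm y <= N -> sqnorm z <= N ->
  \sum_i (b y i 0 - b z i 0) ^+ 2
    + \sum_i \sum_j (sigma y i j - sigma z i j) ^+ 2 <= L * sqdist y z.

Definition coef_bounded_on (N C : R) := forall y, sqnorm y <= N ->
  (forall i, `|b y i 0| <= C) /\ (forall i j, `|sigma y i j| <= C).

End coefficients.

Section comparison.
Context {R : realType} {d : measure_display} {Omega : measurableType d}.
Variables (P : probability Omega R) (T : R) (F : R -> set_system Omega).
Hypothesis hF : is_filtration T F.
Variables (r l : nat) (w : R -> Omega -> 'cV[R]_l).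
Hypothesis hw : is_brownian P T F w.
Variables (b : 'cV[R]_r -> 'cV[R]_r) (sigma : 'cV[R]_r -> 'M[R]_(r, l)).
Hypotheses (hb : borel_fun b) (hsigma : borel_fun sigma).
Variables (eps N L C : R).
Hypotheses (eps01 : 0 < eps <= 1) (L_ge0 : 0 <= L).
Hypotheses (lipN : sq_lipschitz_on b sigma N L) (bndN : coef_bounded_on b sigma N C).
Variables (m : nat) (g : nat -> R).
Hypothesis g_le : forall k, (k < m)%N -> g k <= g k.+1.
Hypothesis g_in : forall k, (k <= m)%N -> 0 <= g k <= T.
Variable G : nat -> set Omega.
Hypothesis FG : forall k, (k < m)%N -> F (g k) (G k).
Hypothesis G_decr : forall k, (k.+1 < m)%N -> G k.+1 `<=` G k.
Variables (v1 v2 : nat -> Omega -> 'cV[R]_r) (U1 U2 : nat -> 'I_r -> Omega -> R).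
Variables (M1 M2 : nat -> 'I_r -> 'I_l -> Omega -> R).

(** The coefficients are evaluated at v instead of at the current state U. The
    recursion is demanded on G only, where v stays in the ball of squared radius
    N, so that truncated coefficients qualify. The stochastic integrals M of the
    single entries of sigma are recorded next to U, since each of them has to
    converge for the limit to satisfy the equation. *)
Definition is_frozen_scheme (v : nat -> Omega -> 'cV[R]_r)
    (U : nat -> 'I_r -> Omega -> R) (M : nat -> 'I_r -> 'I_l -> Omega -> R) :=
  [/\ forall k, (k < m)%N -> measurable_wrt (F (g k)) (v k),
      forall k i, (k <= m)%N -> adapted_at F (g k) (U k i),
      forall k i j, (k <= m)%N -> adapted_at F (g k) (M k i j),
      forall k i omega, (k < m)%N -> G k omega ->
        U k.+1 i omega = U k i omega + b (v k omega) i 0 * (g k.+1 - g k)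
          + eps * \sum_j sigma (v k omega) i j * increment w (g k) (g k.+1) j omega
    & (forall k i j omega, (k < m)%N -> G k omega ->
        M k.+1 i j omega = M k i j omega
          + sigma (v k omega) i j * increment w (g k) (g k.+1) j omega) /\
      (forall k omega, (k < m)%N -> G k omega -> sqnorm (v k omega) <= N)].

Hypotheses (scheme1 : is_frozen_scheme v1 U1 M1).
Hypotheses (scheme2 : is_frozen_scheme v2 U2 M2).
Hypothesis U_init : forall i omega, U1 0%N i omega = U2 0%N i omega.
Hypothesis M_init : forall i j omega, M1 0%N i j omega = M2 0%N i j omega.

Definition freezing_error (v : nat -> Omega -> 'cV[R]_r)
    (U : nat -> 'I_r -> Omega -> R) (k : nat) (omega : Omega) : R :=
  \sum_i (U k i omega - v k omega i 0) ^+ 2.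

Variables (al lambda : R).
Hypothesis lambda_gt0 : 0 < lambda.
Hypothesis al_bnd : (\sum_(k < m) ((g k.+1 - g k)%:E *
   \int[P]_(x in G k) (freezing_error v1 U1 k x + freezing_error v2 U2 k x)%:E)
   <= al%:E)%E.

Definition scheme_dist (k : nat) (omega : Omega) : R :=
  \sum_i (U1 k i omega - U2 k i omega) ^+ 2
   + \sum_i \sum_j (M1 k i j omega - M2 k i j omega) ^+ 2.

(** The factor 3 comes from splitting the difference of the frozen values into
    the difference of the schemes and the two freezing errors, and 5 + T from
    collecting the drift and diffusion terms of the energy. *)
Definition comparison_rate : R := 3 * (5 + T) * L.

Let I : finType := ('I_r + 'I_r * 'I_l)%type.

Let Y (k : nat) (i : I) (omega : Omega) : R :=
  match i with
  | inl i => U1 k i omega - U2 k i omega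
  | inr (i, j) => M1 k i j omega - M2 k i j omega
  end.

Let B (k : nat) (i : I) (omega : Omega) : R :=
  if i is inl i then b (v1 k omega) i 0 - b (v2 k omega) i 0 else 0.

Let S (k : nat) (i : I) (j : 'I_l) (omega : Omega) : R :=
  match i with
  | inl i => eps * (sigma (v1 k omega) i j - sigma (v2 k omega) i j)
  | inr (i, j') => if j == j' then sigma (v1 k omega) i j - sigma (v2 k omega) i j
                   else 0
  end.

Let sumI (f : I -> R) :
  \sum_i f i = \sum_i f (inl i) + \sum_i \sum_j f (inr (i, j)).
Proof.
rewrite big_sumType/=; congr (_ + _); rewrite pair_big/=.
by apply: eq_bigr => -[i j].
Qed.

Let distE k omega : scheme_dist k omega = \sum_i Y k i omega ^+ 2.
Proof. by rewrite sumI. Qed.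

Let T_ge0 : 0 <= T.
Proof. by have /andP[] := g_in (leq0n m) => h1 /(le_trans h1). Qed.

Let rate_ge0 : 0 <= comparison_rate.
Proof. by rewrite mulr_ge0// mulr_ge0// addr_ge0. Qed.

Let ad_coord n (f : Omega -> 'cV[R]_n) k i : (k <= m)%N ->
  measurable_wrt (F (g k)) f -> adapted_at F (g k) (fun x => f x i 0).
Proof. by move=> km; apply: (adapted_at_coord hF); exact: g_in. Qed.

Let ad_b v k i : (k < m)%N -> measurable_wrt (F (g k)) (v k : Omega -> 'cV[R]_r) ->
  adapted_at F (g k) (fun x => b (v k x) i 0).
Proof.
move=> km hv; apply: (@ad_coord _ (fun x => b (v k x))); first exact: ltnW.
by move=> A bA; exact: (hv _ (hb bA)).
Qed.

Let ad_sigma v k i j : (k < m)%N ->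
  measurable_wrt (F (g k)) (v k : Omega -> 'cV[R]_r) ->
  adapted_at F (g k) (fun x => sigma (v k x) i j).
Proof.
move=> km hv.
apply: (@adapted_at_comp _ _ _ _ _ hF (g k) _ (fun x => sigma (v k x))
  (fun A : 'M[R]_(r, l) => A i j)) => //.
- exact: g_in (ltnW km).
- by move=> A bA; exact: (hv _ (hsigma bA)).
- by apply: continuous_borel => A; exact: coord_continuous.
Qed.

(** The maximal inequality applied to the vector of all U1 - U2 and M1 - M2. By
    the Lipschitz condition its coefficients are controlled by the distance of
    the frozen values, hence by |U1 - U2|^2 and the two freezing errors. *)
Lemma comparison :
  (P (\bigcup_(k in `I_m)
      (G k `&` [set omega | (lambda < scheme_dist k.+1 omega)%R])) <=
   (expR ((1 + comparison_rate) * T) * (comparison_rate * al) / lambda)%:E)%E.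
Proof.
have [hv1 hU1 hM1 rU1 [rM1 N1]] := scheme1.
have [hv2 hU2 hM2 rU2 [rM2 N2]] := scheme2.
have mo k : (k < m)%N -> measurable_fun setT (fun x =>
    freezing_error v1 U1 k x + freezing_error v2 U2 k x).
  move=> km; have gk := g_in (ltnW km).
  apply: (adapted_at_measurable hF gk).
  apply: measurable_funD; apply: measurable_sum => i; apply: measurable_funX;
    apply: measurable_funB.
  - exact: hU1 (ltnW km).
  - exact: ad_coord (ltnW km) (hv1 _ km).
  - exact: hU2 (ltnW km).
  - exact: ad_coord (ltnW km) (hv2 _ km).
have o_ge0 k x : 0 <= freezing_error v1 U1 k x + freezing_error v2 U2 k x.
  by rewrite addr_ge0// sumr_ge0// => i _; exact: sqr_ge0.
have -> : \bigcup_(k in `I_m) (G k `&` [set omega | (lambda < scheme_dist k.+1 omega)%R])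
  = \bigcup_(k in `I_m) (G k `&`
      [set omega | (lambda < 0 + \sum_i Y k.+1 i omega ^+ 2)%R]).
  by apply: eq_bigcupr => k _; congr (_ `&` _); apply/seteqP; split => x /=; rewrite add0r distE.
have := (@discrete_maximal_inequality R d Omega P T F hF l w hw I m g g_le g_in G Y B S
  (fun k x => comparison_rate *
     (freezing_error v1 U1 k x + freezing_error v2 U2 k x)) (2 * C) (1 + comparison_rate) 0 0
     (comparison_rate * al) lambda).
rewrite (add0r (comparison_rate * al)); apply => //.
- move=> k [i|[i j]] km; apply: measurable_funB.
  + exact: hU1.
  + exact: hU2.
  + exact: hM1.
  + exact: hM2.
- move=> k [i|[i j]] km; last exact: measurable_cst.
  by apply: measurable_funB; apply: ad_b => //; [exact: hv1|exact: hv2].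
- move=> k [i|[i j']] j km /=.
    apply: measurable_funM => //; apply: measurable_funB; apply: ad_sigma => //;
      [exact: hv1|exact: hv2].
  rewrite /S; case: eqP => _; last exact: measurable_cst.
  by apply: measurable_funB; apply: ad_sigma => //; [exact: hv1|exact: hv2].
- move=> k [i|[i j]] omega km Gk /=.
    rewrite rU1// rU2//.
    have -> : \sum_j eps * (sigma (v1 k omega) i j - sigma (v2 k omega) i j) *
          increment w (g k) (g k.+1) j omega =
        eps * (\sum_j sigma (v1 k omega) i j * increment w (g k) (g k.+1) j omega) -
        eps * (\sum_j sigma (v2 k omega) i j * increment w (g k) (g k.+1) j omega).
      by rewrite -mulrBr -sumrB mulr_sumr; apply: eq_bigr => j _; ring.
    by ring.
  rewrite rM1// rM2// (bigD1 j)//= eqxx big1 ?addr0; first by ring.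
  by move=> j' /negbTE ->; rewrite mul0r.
- move=> k [i|[i j]] omega km Gk /=.
    have [h1 _] := bndN (N1 _ _ km Gk); have [h2 _] := bndN (N2 _ _ km Gk).
    by rewrite (le_trans (ler_normB _ _))// mulrDl mul1r lerD.
  rewrite normr0 mulr_ge0//.
  have [_ h1] := bndN (N1 _ _ km Gk).
  exact: le_trans (h1 i j).
- move=> k i j omega km Gk.
  have [_ h1] := bndN (N1 _ _ km Gk); have [_ h2] := bndN (N2 _ _ km Gk).
  have h3 i' : `|sigma (v1 k omega) i' j - sigma (v2 k omega) i' j| <= 2 * C.
    by rewrite (le_trans (ler_normB _ _))// mulrDl mul1r lerD.
  case/andP: eps01 => e0 e1.
  case: i => [i|[i j']] /=.
    by rewrite normrM (gtr0_norm e0) (le_trans _ (h3 i))// ler_piMl.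
  case: eqP => [_|_]; first exact: h3.
  by rewrite normr0 (le_trans _ (h3 i)).
- by move=> k km; apply: measurable_funM => //; exact: mo.
- by move=> k omega; rewrite mulr_ge0.
- move=> k omega km Gk.
  have lip := lipN (N1 _ _ km Gk) (N2 _ _ km Gk).
  rewrite add0r !sumI /=.
  have -> : \sum_i \sum_j Y k (inr (i, j)) omega * 0 = 0.
    by rewrite big1// => i _; rewrite big1// => j _; rewrite mulr0.
  have -> : \sum_(i < r) \sum_(j < l) (0 : R) ^+ 2 = 0.
    by rewrite big1// => i _; rewrite big1// => j _; rewrite expr0n.
  have -> : \sum_(i < r) \sum_(j < l) (eps * (sigma (v1 k omega) i j - sigma (v2 k omega) i j)) ^+ 2
    = eps ^+ 2 * \sum_(i < r) \sum_(j < l) (sigma (v1 k omega) i j - sigma (v2 k omega) i j) ^+ 2.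
    rewrite mulr_sumr; apply: eq_bigr => i _; rewrite mulr_sumr.
    by apply: eq_bigr => j _; rewrite exprMn.
  have -> : \sum_(i < r) \sum_(j < l) \sum_(j' < l) (if j' == j then
       sigma (v1 k omega) i j' - sigma (v2 k omega) i j' else 0) ^+ 2
    = \sum_(i < r) \sum_(j < l) (sigma (v1 k omega) i j - sigma (v2 k omega) i j) ^+ 2.
    apply: eq_bigr => i _; apply: eq_bigr => j _.
    rewrite (bigD1 j)//= eqxx big1 ?addr0// => j' /negbTE ->.
    by rewrite expr0n.
  pose Sb := \sum_(i < r) (b (v1 k omega) i 0 - b (v2 k omega) i 0) ^+ 2.
  pose Ss := \sum_(i < r) \sum_(j < l)
    (sigma (v1 k omega) i j - sigma (v2 k omega) i j) ^+ 2.
  pose X := \sum_(i < r) (U1 k i omega - U2 k i omega) *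
      (b (v1 k omega) i 0 - b (v2 k omega) i 0).
  rewrite -/Sb -/Ss in lip.
  pose Q := \sum_(i < r) (U1 k i omega - U2 k i omega) ^+ 2.
  pose QM := \sum_(i < r) \sum_(j < l) (M1 k i j omega - M2 k i j omega) ^+ 2.
  have QM0 : 0 <= QM.
    by apply: sumr_ge0 => i _; apply: sumr_ge0 => j _; exact: sqr_ge0.
  have Q0 : 0 <= Q by apply: sumr_ge0 => i _; exact: sqr_ge0.
  have Sb0 : 0 <= Sb by apply: sumr_ge0 => i _; exact: sqr_ge0.
  have Ss0 : 0 <= Ss.
    by apply: sumr_ge0 => i _; apply: sumr_ge0 => j _; exact: sqr_ge0.
  have cross : 2 * X <= Q + Sb.
    rewrite mulr_sumr /Q /Sb -big_split/=; apply: ler_sum => i _.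
    have := sqr_ge0 ((U1 k i omega - U2 k i omega) - (b (v1 k omega) i 0 - b (v2 k omega) i 0)).
    by rewrite sqrrB -mulr_natl; lra.
  pose o := freezing_error v1 U1 k omega + freezing_error v2 U2 k omega.
  have dist : sqdist (v1 k omega) (v2 k omega) <= 3 * (Q + o).
    rewrite /sqdist /Q /o /freezing_error -!big_split/= mulr_sumr; apply: ler_sum => i _.
    have := sqr_ge0 ((U1 k i omega - U2 k i omega) + (U1 k i omega - v1 k omega i 0)).
    have := sqr_ge0 ((U1 k i omega - U2 k i omega) - (U2 k i omega - v2 k omega i 0)).
    have := sqr_ge0 ((U1 k i omega - v1 k omega i 0) + (U2 k i omega - v2 k omega i 0)).
    by rewrite !expr2; nra.
  have o0 : 0 <= o := o_ge0 k omega.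
  have hT : g k.+1 - g k <= T.
    have /andP[_ h1] := g_in km; have /andP[h2 _] := g_in (ltnW km).
    by rewrite lerBlDr (le_trans h1)// lerDl.
  have h0 : 0 <= g k.+1 - g k by rewrite subr_ge0 g_le.
  case/andP: eps01 => e0 e1.
  have e2 : eps ^+ 2 <= 1 by rewrite expr_le1// ltW.
  have e2s : eps ^+ 2 * Ss <= Ss by rewrite ler_piMl.
  have hSb : (g k.+1 - g k) * Sb <= T * Sb by rewrite ler_wpM2r.
  have LD : Sb + Ss <= L * (3 * (Q + o)) by rewrite (le_trans lip)// ler_wpM2l.
  have TLD : (5 + T) * (Sb + Ss) <= comparison_rate * (Q + o).
    have -> : comparison_rate * (Q + o) = (5 + T) * (L * (3 * (Q + o))).
      by rewrite /comparison_rate; ring.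
    by rewrite ler_wpM2l// addr_ge0.
  have TS : 0 <= T * Ss by rewrite mulr_ge0.
  have rQ : 0 <= comparison_rate * QM by rewrite mulr_ge0.
  suff : 2 * (X + 0) + (g k.+1 - g k) * (Sb + 0) + 2 * (eps ^+ 2 * Ss + Ss) <=
      (1 + comparison_rate) * (Q + QM) + comparison_rate * o by [].
  by rewrite !addr0; lra.
- apply: (@le_trans _ _ (comparison_rate%:E * al%:E)%E); last by rewrite -EFinM.
  apply: le_trans (lee_wpmul2l _ al_bnd); last by rewrite lee_fin.
  rewrite ge0_sume_distrr; last first.
    move=> k _; apply: mule_ge0; first by rewrite lee_fin subr_ge0 g_le.
    by apply: integral_ge0 => x _; rewrite lee_fin.
  apply: lee_sum => k _; rewrite muleCA; apply: lee_wpmul2l.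
    by rewrite lee_fin subr_ge0 g_le.
  have mGk : measurable (G k).
    by apply: (filtration_measurable hF (g_in (ltnW (ltn_ord k)))); exact: FG.
  under eq_integral do rewrite EFinM.
  rewrite ge0_integralZl//.
  - by apply/measurable_EFinP; apply: measurable_funTS; exact: mo.
  - by move=> x _; rewrite lee_fin.
- by move=> omega; rewrite add0r sumI big1 ?add0r ?big1// => i _;
    [rewrite big1// => j _; rewrite /= M_init subrr expr0n|rewrite /= U_init subrr expr0n].
- by rewrite addr_ge0.
Qed.

End comparison.

(** * Step processes and dyadic grids *)
Section step_processes.
Context {R : realType} {d : measure_display} {Omega : measurableType d}.
Implicit Types (f : step_process R Omega) (beta : R -> Omega -> R).

Definition step_increasing f := forall k, (k < step_size f)%N ->
  step_time f k < step_time f k.+1.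

Definition no_step_between f (s t : R) :=
  forall k, (k <= step_size f)%N -> s < step_time f k -> t <= step_time f k.

Lemma step_time_le f k k' : step_increasing f ->
  (k <= k')%N -> (k' <= step_size f)%N -> step_time f k <= step_time f k'.
Proof.
move=> inc; elim: k' => [|k' IH]; first by rewrite leqn0 => /eqP ->.
rewrite leq_eqVlt => /predU1P[->//|kk'] h.
by rewrite (le_trans (IH kk' (ltnW h)))// ltW// inc.
Qed.

Lemma step_time_ge0 f k : step_time f 0 = 0 -> step_increasing f ->
  (k <= step_size f)%N -> 0 <= step_time f k.
Proof. by move=> <- inc kf; exact: step_time_le. Qed.

Lemma step_time_leT f T k : step_time f (step_size f) = T -> step_increasing f ->
  (k <= step_size f)%N -> step_time f k <= T.
Proof. by move=> <- inc kf; exact: step_time_le. Qed.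

Lemma step_evalE f t omega : step_eval f t omega =
  \sum_(k < step_size f) step_val f k omega *
     (if step_time f k <= t < step_time f k.+1 then 1 else 0).
Proof.
apply: eq_bigr => k _; rewrite indicE; congr (_ * _).
case: ifPn => h; first by rewrite mem_set.
by rewrite memNset//= in_itv/=; exact/negP.
Qed.

Lemma step_eval_on f k t omega : step_increasing f -> (k < step_size f)%N ->
  step_time f k <= t < step_time f k.+1 -> step_eval f t omega = step_val f k omega.
Proof.
move=> inc kf /andP[kt tk]; rewrite step_evalE (bigD1 (Ordinal kf))//= kt tk mulr1.
rewrite big1 ?addr0// => i; rewrite -val_eqE/= neq_ltn => /orP[ik|ki].
  have h : step_time f i.+1 <= t.
    by apply: le_trans kt; apply: step_time_le => //; exact: ltnW.
  by rewrite [t < _]ltNge h andbF mulr0.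
have h : t < step_time f i.
  by apply: lt_le_trans tk _; apply: step_time_le => //; exact: ltnW.
by rewrite [_ <= t]leNgt h mulr0.
Qed.

Lemma step_integral0 beta f omega : step_time f 0 = 0 -> step_increasing f ->
  step_integral beta f 0 omega = 0.
Proof.
move=> f0 inc; apply: big1 => k _.
by rewrite !min_r ?subrr ?mulr0// step_time_ge0// ltnW.
Qed.

(** This recursion lets integrals of step processes on different grids be
    compared on a common refinement. *)
Lemma step_integral_piece beta f s t omega : step_increasing f -> s <= t ->
  no_step_between f s t ->
  step_integral beta f t omega =
  step_integral beta f s omega + step_eval f s omega * (beta t omega - beta s omega).
Proof.
move=> inc st nost; rewrite step_evalE mulr_suml -big_split/=.
apply: eq_bigr => -[k kf] _ /=; rewrite -mulrA -mulrDr; congr (_ * _).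
have key q : (q <= step_size f)%N ->
    beta (Num.min (step_time f q) t) omega - beta (Num.min (step_time f q) s) omega =
    if s < step_time f q then beta t omega - beta s omega else 0.
  move=> qf; case: ltP => h.
    by rewrite !min_r ?(ltW h)// nost.
  by rewrite !min_l ?subrr// (le_trans h).
have := key _ kf; have := key _ (ltnW kf); have tk := inc _ kf.
case: (ltP s (step_time f k)) => h1; case: (ltP s (step_time f k.+1)) => h2 /=; lra.
Qed.

End step_processes.

Section adapted_steps.
Context {R : realType} {d : measure_display} {Omega : measurableType d}.
Variables (T : R) (F : R -> set_system Omega).
Hypothesis hF : is_filtration T F.
Variable f : step_process R Omega.
Hypotheses (f0 : step_time f 0 = 0) (fT : step_time f (step_size f) = T).
Hypothesis finc : step_increasing f.
Hypothesis fad : forall k, (k < step_size f)%N ->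
  adapted_at F (step_time f k) (step_val f k).

Lemma adapted_step_eval t : 0 <= t <= T -> adapted_at F t (step_eval f t).
Proof.
move=> /andP[t0 tT].
have -> : step_eval f t = (fun x => \sum_(k < step_size f) step_val f k x *
     (if step_time f k <= t < step_time f k.+1 then 1 else 0)).
  by apply/funext => x; rewrite step_evalE.
apply: measurable_sum => -[k kf] /=; case: ifPn => h.
  apply: measurable_funM; last exact: measurable_cst.
  case/andP : h => kt tk.
  apply: (adapted_at_le hF _ kt tT); last exact: fad.
  by apply: step_time_ge0 => //; exact: ltnW.
under eq_fun do rewrite mulr0.
exact: measurable_cst.
Qed.

Lemma adapted_step_integral beta t : 0 <= t <= T ->
  (forall s, 0 <= s <= t -> adapted_at F s (beta s)) ->
  adapted_at F t (step_integral beta f t).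
Proof.
move=> /andP[t0 tT] hbeta; apply: measurable_sum => -[k kf] /=.
have k0 : 0 <= step_time f k by apply: step_time_ge0 => //; exact: ltnW.
have [kt|tk] := ltP (step_time f k) t; last first.
  have tk1 : t <= step_time f k.+1 by rewrite (le_trans tk)// ltW// finc.
  rewrite (_ : (fun _ => _) = cst 0); first exact: measurable_cst.
  by apply/funext => x /=; rewrite !min_r// subrr mulr0.
apply: measurable_funM.
  by apply: (adapted_at_le hF k0 (ltW kt) tT); exact: fad.
have hb s : 0 <= s -> s <= t -> adapted_at F t (beta s).
  by move=> s0 st; apply: (adapted_at_le hF s0 st tT); apply: hbeta; rewrite s0.
apply: measurable_funB; last exact: hb k0 (ltW kt).
apply: hb; last by rewrite ge_min lexx orbT.
by rewrite le_min t0 andbT step_time_ge0.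
Qed.

End adapted_steps.

Section dyadic.
Context {R : realType} {d : measure_display} {Omega : measurableType d}.
Variable T : R.
Hypothesis T_gt0 : 0 < T.

Definition dyadic (n k : nat) : R := T * k%:R / (2 ^ n)%:R.

Definition dyadic_step (n : nat) (v : nat -> Omega -> R) : step_process R Omega :=
  {| step_size := (2 ^ n)%N ; step_time := dyadic n ; step_val := v |}.

Lemma dyadic0 n : dyadic n 0 = 0. Proof. by rewrite /dyadic mulr0 mul0r. Qed.

Lemma pow2_gt0 n : 0 < (2 ^ n)%:R :> R. Proof. by rewrite ltr0n expn_gt0. Qed.

Lemma dyadicT n : dyadic n (2 ^ n) = T.
Proof. by rewrite /dyadic mulfK// gt_eqF// pow2_gt0. Qed.

Lemma dyadic_lt n k k' : (dyadic n k < dyadic n k') = (k < k')%N.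
Proof. by rewrite /dyadic ltr_pM2r ?invr_gt0 ?pow2_gt0// ltr_pM2l// ltr_nat. Qed.

Lemma dyadic_le n k k' : (dyadic n k <= dyadic n k') = (k <= k')%N.
Proof. by rewrite /dyadic ler_pM2r ?invr_gt0 ?pow2_gt0// ler_pM2l// ler_nat. Qed.

Lemma dyadic_in n k : (k <= 2 ^ n)%N -> 0 <= dyadic n k <= T.
Proof.
move=> kn; have := dyadic_le n 0 k; have := dyadic_le n k (2 ^ n).
by rewrite dyadic0 dyadicT kn => -> ->.
Qed.

Lemma dyadic_incr n k : dyadic n k.+1 - dyadic n k = T / (2 ^ n)%:R.
Proof. by rewrite /dyadic -mulrBl -mulrBr -natrB// subSnn mulr1. Qed.

Lemma dyadic_refine n m k : (n <= m)%N ->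
  dyadic n k = dyadic m (k * 2 ^ (m - n))%N.
Proof.
move=> nm; rewrite /dyadic -{2}(subnKC nm) expnD !natrM.
have h1 := pow2_gt0 n; have h2 := pow2_gt0 (m - n).
by field; rewrite !gt_eqF.
Qed.

Lemma dyadic_step_increasing n v : step_increasing (dyadic_step n v).
Proof. by move=> k _; rewrite /= dyadic_lt. Qed.

Definition dyadic_index (n : nat) (t : R) : nat := Num.trunc (t * (2 ^ n)%:R / T).

Lemma dyadic_indexP n t : 0 <= t < T ->
  (dyadic_index n t < 2 ^ n)%N /\
  dyadic n (dyadic_index n t) <= t < dyadic n (dyadic_index n t).+1.
Proof.
move=> /andP[t0 tT]; have p0 := pow2_gt0 n.
have /andP[h1 h2] : (dyadic_index n t)%:R <= t * (2 ^ n)%:R / T < (dyadic_index n t).+1%:R.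
  by rewrite truncnS_gt truncn_le andbT divr_ge0 ?mulr_ge0 ?(ltW T_gt0).
have e1 : dyadic n (dyadic_index n t) <= t < dyadic n (dyadic_index n t).+1.
  rewrite /dyadic ler_pdivrMr// ltr_pdivlMr// mulrC -ler_pdivlMr// h1/=.
  by rewrite [T * _]mulrC -ltr_pdivrMr.
split=> //; rewrite -(dyadic_lt n) dyadicT; apply: le_lt_trans tT.
by case/andP : e1.
Qed.

Lemma dyadic_step_eval n v t omega : 0 <= t < T ->
  step_eval (dyadic_step n v) t omega = v (dyadic_index n t) omega.
Proof.
move=> tT; have [h1 h2] := dyadic_indexP n tT.
by rewrite (@step_eval_on _ _ _ _ (dyadic_index n t))//; exact: dyadic_step_increasing.
Qed.

Lemma dyadic_index_dyadic n k : (k < 2 ^ n)%N -> dyadic_index n (dyadic n k) = k.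
Proof.
move=> kn; have := @dyadic_indexP n (dyadic n k).
have -> : 0 <= dyadic n k < T.
  have /andP[-> _] := dyadic_in (ltnW kn).
  by have := dyadic_lt n k (2 ^ n); rewrite dyadicT kn.
move=> /(_ isT)[_]; rewrite dyadic_le dyadic_lt ltnS => /andP[h1 h2].
by apply/eqP; rewrite eqn_leq h1 h2.
Qed.

Lemma dyadic_dist n k t : dyadic n k <= t < dyadic n k.+1 ->
  0 <= t - dyadic n k < T / (2 ^ n)%:R.
Proof.
by move=> /andP[h1 h2]; rewrite subr_ge0 h1/= -(dyadic_incr n k) ltrD2r.
Qed.

End dyadic.

(** * Convergence in outer probability *)
Section vanishing.
Context {R : realType} {d : measure_display} {Omega : measurableType d}.
Variable P : probability Omega R.
Implicit Types A B : nat -> set Omega.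

(** The outer measure is needed because functionals of paths that are only
    almost surely continuous may fail to be measurable. *)
Definition vanish A := forall e : R, 0 < e ->
  exists N, forall n, (N <= n)%N -> (mu_ext P (A n) <= e%:E)%E.

Lemma mu_extU2 (A B : set Omega) : (mu_ext P (A `|` B) <= mu_ext P A + mu_ext P B)%E.
Proof. exact: outer_measureU2. Qed.

Lemma mu_ext_negligible (A : set Omega) : P.-negligible A -> mu_ext P A = 0%E.
Proof.
move=> [N [mN PN AN]]; apply/eqP; rewrite eq_le; apply/andP; split; last exact: mu_ext_ge0.
rewrite -PN.
by rewrite -(measurable_mu_extE P mN); exact: le_mu_ext.
Qed.

Lemma vanish_sub A B : (forall n, A n `<=` B n) -> vanish B -> vanish A.
Proof.
move=> AB vB e /vB[N hN]; exists N => n /hN; apply: le_trans; exact: le_mu_ext.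
Qed.

Lemma vanishU A B : vanish A -> vanish B -> vanish (fun n => A n `|` B n).
Proof.
move=> vA vB e e0; have e20 : 0 < e / 2 by rewrite divr_gt0.
have [N hN] := vA _ e20; have [M hM] := vB _ e20.
exists (maxn N M) => n; rewrite geq_max => /andP[Nn Mn].
rewrite (le_trans (mu_extU2 _ _))// [in leRHS](splitr e) EFinD.
by apply: leeD; [exact: hN|exact: hM].
Qed.

Lemma vanish_negligible (A : set Omega) : P.-negligible A -> vanish (fun=> A).
Proof.
by move=> /mu_ext_negligible A0 e e0; exists 0%N => n _; rewrite A0 lee_fin ltW.
Qed.

Lemma vanish_bigcup (I : finType) (A : I -> nat -> set Omega) :
  (forall i, vanish (A i)) -> vanish (fun n => \bigcup_i A i n).
Proof.
move=> vA.
suff h (s : seq I) : vanish (fun n => [set omega | exists2 i, i \in s & A i n omega]).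
  by apply: vanish_sub (h (enum I)) => n omega [i _ Ai]; exists i => //; rewrite mem_enum.
elim: s => [|i s IH].
  by apply: vanish_sub (vanish_negligible (negligible_set0 P)) => n omega [].
apply: vanish_sub (vanishU (vA i) IH) => n omega [k].
by rewrite inE => /predU1P[->|ks] Ak; [left|right; exists k].
Qed.

(** The unions of the tails of A decrease to the limit superior of A, which is a
    null set. *)
Lemma vanish_ae A : (forall n, measurable (A n)) ->
  {ae P, forall omega, exists N, forall n, (N <= n)%N -> ~ A n omega} -> vanish A.
Proof.
move=> mA aeA e e0.
have cv := lim_sup_set_cvg P A mA.
have fin : (P (\bigcup_(k >= 0) A k) < +oo)%E.
  by rewrite (le_lt_trans (probability_le1 _ _)) ?ltry//; exact: bigcup_measurable.
have PL : P (lim_sup_set A) = 0%E.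
  apply: measure_negligible.
    by apply: bigcap_measurable => // k _; exact: bigcup_measurable.
  apply: negligibleS aeA => omega /= L [N hN].
  by have [n /= Nn An] := L N I; exact: hN An.
have : P (\bigcup_(k >= n) A k) @[n --> \oo] --> 0%E by rewrite -PL; exact: cv.
move=> /fine_cvgP[_] /cvgrPdist_le /(_ e e0)[N _ hN].
exists N => n Nn; rewrite measurable_mu_extE//.
have mU : measurable (\bigcup_(k >= n) A k) by exact: bigcup_measurable.
apply: (@le_trans _ _ (P (\bigcup_(k >= n) A k))).
  by apply: le_measure; rewrite ?inE// => omega An; exists n => //=.
have := hN n Nn; rewrite /= sub0r normrN ger0_norm ?fine_ge0// => h.
by rewrite -(fineK (fin_num_measure P _ mU)) lee_fin.
Qed.

Lemma cvg_prob0P (Y : nat -> Omega -> \bar R) : cvg_prob0 P Y <->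
  forall delta : R, 0 < delta -> vanish (fun n => [set omega | (delta%:E < Y n omega)%E]).
Proof.
split => [h delta /h{}h e e0|h delta /h{}h].
  move/fine_cvgP : h => [[N1 _ fin1] /cvgrPdist_le /(_ e e0)[N2 _ hN]].
  exists (maxn N1 N2) => n; rewrite geq_max => /andP[n1 n2].
  have := hN n n2; rewrite /= sub0r normrN ger0_norm ?fine_ge0 ?mu_ext_ge0// => h.
  by rewrite -(fineK (fin1 n n1)) lee_fin.
apply/fine_cvgP; split.
  have [N hN] := h 1 ltr01; exists N => // n /= Nn.
  by rewrite ge0_fin_numE ?mu_ext_ge0// (le_lt_trans (hN n Nn)) ?ltry.
apply/cvgrPdist_le => e e0; have [N hN] := h e e0; exists N => // n /= Nn.
rewrite sub0r normrN ger0_norm ?fine_ge0 ?mu_ext_ge0//.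
have fn : mu_ext P [set omega | (delta%:E < Y n omega)%E] \is a fin_num.
  by rewrite ge0_fin_numE ?mu_ext_ge0// (le_lt_trans (hN n Nn)) ?ltry.
by rewrite -lee_fin fineK// hN.
Qed.

End vanishing.

(** * Integrals of simple processes *)
Section common_grid.
Context {R : realType}.
Implicit Type s : seq R.

Lemma sorted_nth_next s (x : R) k : sorted <=%R s -> x \in s -> (k.+1 < size s)%N ->
  nth 0 s k < x -> nth 0 s k.+1 <= x.
Proof.
move=> ss xs ks; rewrite -{1 2}(nth_index 0 xs) => lt.
have ki : (k < index x s)%N.
  rewrite ltnNge; apply/negP => ik; move: lt; rewrite ltNge => /negP; apply.
  by rewrite (sorted_leq_nth le_trans le_refl)// ?inE ?index_mem// ltnW.
by rewrite (sorted_leq_nth le_trans le_refl)// ?inE ?index_mem.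
Qed.

End common_grid.

Section step_lebesgue.
Context {R : realType} {d : measure_display} {Omega : measurableType d}.
Local Notation mu := (@lebesgue_measure R).
Implicit Types (f : step_process R Omega).

Lemma step_eval_const f s t u omega : no_step_between f s u -> s <= t < u ->
  step_eval f t omega = step_eval f s omega.
Proof.
move=> nost /andP[st tu]; rewrite !step_evalE; apply: eq_bigr => -[k kf] _ /=.
congr (_ * _); have key q : (q <= step_size f)%N -> (t < step_time f q) = (s < step_time f q).
  move=> qf; apply/idP/idP => [|h]; first exact: le_lt_trans.
  by rewrite (lt_le_trans tu)// nost.
by rewrite !leNgt !key// ltnW.
Qed.

Lemma measurable_step_eval f omega : measurable_fun setT (fun s => step_eval f s omega).
Proof.
by apply: measurable_sum => k; exact: measurable_funM.
Qed.

Lemma lebesgue_measure_co (a b : R) : a <= b -> mu `[a, b[ = (b - a)%:E.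
Proof.
move=> ab; rewrite lebesgue_measure_itv/= lte_fin; case: ltP => // ba.
by have -> : a = b by [apply/eqP; rewrite eq_le ab ba]; rewrite subrr.
Qed.

(** On the cells h is the step function with the values h (g k), whose integral
    is the sum; the integral outside the cells is discarded. *)
Lemma grid_sum_le_integral (T : R) (m : nat) (g : nat -> R) (h : R -> R) :
  (forall k, (k < m)%N -> g k <= g k.+1) ->
  (forall k, (k <= m)%N -> 0 <= g k <= T) ->
  measurable_fun setT h -> (forall s, 0 <= h s) ->
  (forall k s, (k < m)%N -> g k <= s < g k.+1 -> h s = h (g k)) ->
  ((\sum_(k < m) h (g k) * (g k.+1 - g k))%:E <=
   \int[mu]_(s in `[0%R, T]) (h s)%:E)%E.
Proof.
move=> g_le g_in mh h0 hc.
have gle2 i j : (i <= j)%N -> (j <= m)%N -> g i <= g j.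
  elim: j => [|j IH]; first by rewrite leqn0 => /eqP ->.
  rewrite leq_eqVlt => /predU1P[->//|ij] jm.
  by rewrite (le_trans (IH ij (ltnW jm)))// g_le.
have -> : (\sum_(k < m) h (g k) * (g k.+1 - g k))%:E =
    (\int[mu]_(s in `[0%R, T]) (\sum_(k < m) (h (g k))%:E * (\1_(`[g k, g k.+1[%classic) s)%:E))%E.
  rewrite ge0_integral_sum//; last 2 first.
  - move=> k; apply: emeasurable_funM => //; apply/measurable_EFinP.
    exact: measurable_indic.
  - by move=> k s _; rewrite -EFinM lee_fin mulr_ge0// indicE ler0n.
  rewrite -sumEFin; apply: eq_bigr => -[k km] _ /=.
  rewrite ge0_integralZl//; last 2 first.
  - by apply/measurable_EFinP; exact: measurable_indic.
  - by rewrite lee_fin.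
  rewrite integral_indic//= EFinM; congr (_ * _)%E.
  rewrite -(lebesgue_measure_co (g_le _ km)); congr (mu _); apply/seteqP; split => s /=.
    rewrite !in_itv/= => /andP[h1 h2]; split; first by rewrite h1.
    have /andP[h3 _] := g_in k (ltnW km); have /andP[_ h4] := g_in _ km.
    by rewrite (le_trans h3 h1) (le_trans (ltW h2) h4).
  by move=> [].
apply: ge0_le_integral => //.
- move=> s _; apply: sume_ge0 => k _.
  by rewrite -EFinM lee_fin mulr_ge0// indicE ler0n.
- apply: emeasurable_sum => k; apply: emeasurable_funM => //.
  by apply/measurable_EFinP; exact: measurable_indic.
- by apply/measurable_EFinP; exact: measurable_funTS.
move=> s _.
have [[k [km ks]]|nok] := pselect (exists k, (k < m)%N /\ g k <= s < g k.+1); last first.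
  rewrite big1 ?lee_fin// => -[k km] _ /=.
  rewrite indicE memNset ?mule0//= in_itv/= => ks; apply: nok.
  by exists k.
rewrite (bigD1 (Ordinal km))//= big1 ?adde0.
  by rewrite -EFinM lee_fin indicE mem_set/= ?in_itv//= mulr1 (hc _ _ km ks).
move=> [j jm]; rewrite -val_eqE/= => jk.
rewrite indicE memNset ?mule0//= in_itv/= => /andP[h1 h2].
case/andP: ks => h3 h4; move: jk; rewrite neq_ltn => /orP[jk|kj].
  by have := lt_le_trans h2 (le_trans (gle2 _ _ jk (ltnW km)) h3); rewrite ltxx.
by have := lt_le_trans h4 (le_trans (gle2 _ _ kj (ltnW jm)) h1); rewrite ltxx.
Qed.

End step_lebesgue.

Section lenglart.
Context {R : realType} {d : measure_display} {Omega : measurableType d}.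
Variables (P : probability Omega R) (T : R) (F : R -> set_system Omega).
Hypothesis hF : is_filtration T F.
Variables (l : nat) (w : R -> Omega -> 'cV[R]_l).
Hypothesis hw : is_brownian P T F w.
Local Notation mu := (@lebesgue_measure R).

Lemma adapted_le_set t f c : 0 <= t <= T -> adapted_at F t f ->
  F t [set omega | f omega <= c].
Proof.
move=> t0T /(adapted_atP hF _ t0T) hf.
have := hf _ (measurable_borel (measurable_itv `]-oo, c])).
by congr (F t _); apply/seteqP; split => x /=; rewrite in_itv.
Qed.

Lemma measurable_lt_set (f : Omega -> R) c : measurable_fun setT f ->
  measurable [set omega | c < f omega].
Proof.
move=> mf; rewrite (_ : [set _ | _] = f @^-1` `]c, +oo[).
  by rewrite -[X in measurable X]setTI; exact: mf.
by apply/seteqP; split => x /=; rewrite in_itv/= andbT.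
Qed.

Lemma simple_props f : is_simple T F f ->
  [/\ step_time f 0 = 0, step_time f (step_size f) = T, step_increasing f,
   forall k, (k <= step_size f)%N -> 0 <= step_time f k <= T
   & forall k, (k < step_size f)%N -> adapted_at F (step_time f k) (step_val f k)].
Proof.
move=> [f0 fT finc fad].
have fin k : (k <= step_size f)%N -> 0 <= step_time f k <= T.
  by move=> kf; rewrite step_time_ge0//=; apply: step_time_leT.
split => // k kf; apply/(adapted_atP hF _ (fin k (ltnW kf))).
by have [] := fad k kf.
Qed.

Lemma simple_bounded f : is_simple T F f ->
  exists C, forall t omega, `|step_eval f t omega| <= C.
Proof.
move=> [_ _ _ fad].
have : forall k, exists C, (k < step_size f)%N -> forall omega, `|step_val f k omega| <= C.
  move=> k; have [kf|] := boolP (k < step_size f)%N; last by exists 0.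
  by have [_ [C hC]] := fad k kf; exists C.
move=> /choice[C hC].
exists (\sum_(k < step_size f) `|C k|) => t omega.
rewrite /step_eval (le_trans (ler_norm_sum _ _ _))//; apply: ler_sum => -[k kf] _ /=.
rewrite normrM (le_trans _ (ler_norm _))//.
apply: le_trans (hC k kf omega); rewrite ler_piMr//.
by rewrite indicE; case: (_ \in _); rewrite ?normr1 ?normr0.
Qed.

Definition coord_process n (X : R -> Omega -> 'cV[R]_n) j (t : R) (omega : Omega) : R :=
  X t omega j 0.

Lemma brownian_coord_adapted t j : 0 <= t <= T ->
  adapted_at F t (coord_process w j t).
Proof. by move=> t0T; apply: (adapted_at_coord hF) => //; exact: (brownian_adapted hw). Qed.

(** On a common refinement of the two grids the difference of the integrals is a
    sum of terms D k times an increment. It is stopped before the energy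
    sum (D k)^2 (g k.+1 - g k) exceeds eta, and then the maximal inequality
    applies with c = 0; the stop is active only if the integral of the squared
    difference over [0, T] exceeds eta. *)
Lemma simple_lenglart f f' j (eta lambda : R) :
  is_simple T F f -> is_simple T F f' -> 0 < eta -> 0 < lambda ->
  (P (\bigcup_(q in `I_(step_size f').+1) [set omega |
      (lambda < (step_integral (coord_process w j) f (step_time f' q) omega -
       step_integral (coord_process w j) f' (step_time f' q) omega) ^+ 2)%R]) <=
   (2 * eta / lambda)%:E + mu_ext P [set omega |
     (eta%:E < \int[mu]_(s in `[0%R, T])
        ((step_eval f s omega - step_eval f' s omega) ^+ 2)%:E)%E])%E.
Proof.
move=> sf sf' eta0 lam0; set beta := coord_process w j.
have [f0 fT finc fin fad] := simple_props sf.
have [f'0 f'T f'inc f'in f'ad] := simple_props sf'.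
have T0 : 0 <= T by have /andP[h1 h2] := fin 0%N isT; exact: le_trans h1 h2.
pose times (h : step_process R Omega) := [seq step_time h k | k <- iota 0 (step_size h).+1].
pose s := sort <=%R (times f ++ times f').
have ss : sorted <=%R s by apply: sort_sorted; exact: le_total.
have memf q : (q <= step_size f)%N -> step_time f q \in s.
  by move=> qf; rewrite mem_sort mem_cat; apply/orP; left; apply: map_f; rewrite mem_iota.
have memf' q : (q <= step_size f')%N -> step_time f' q \in s.
  by move=> qf; rewrite mem_sort mem_cat; apply/orP; right; apply: map_f; rewrite mem_iota.
have s_in x : x \in s -> 0 <= x <= T.
  rewrite mem_sort mem_cat => /orP[] /mapP[q]; rewrite mem_iota add0n ltnS => /andP[_ qs] ->;
    [exact: fin|exact: f'in].
have sz : (0 < size s)%N by have := memf 0%N isT; case: (s).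
pose m := (size s).-1; pose g k := nth 0 s k.
have szm : size s = m.+1 by rewrite prednK.
have g_le k : (k < m)%N -> g k <= g k.+1.
  by move=> km; apply: (sortedP 0 _) => //; rewrite szm ltnS.
have g_in k : (k <= m)%N -> 0 <= g k <= T.
  by move=> km; apply: s_in; apply: mem_nth; rewrite szm ltnS.
have nof k : (k < m)%N -> no_step_between f (g k) (g k.+1).
  by move=> km q qf; apply: sorted_nth_next => //; [exact: memf|rewrite szm ltnS].
have nof' k : (k < m)%N -> no_step_between f' (g k) (g k.+1).
  by move=> km q qf; apply: sorted_nth_next => //; [exact: memf'|rewrite szm ltnS].
have g0 : g 0%N = 0.
  apply/eqP; rewrite eq_le; have /andP[-> _] := g_in 0%N isT; rewrite andbT.
  have h0 := memf 0%N isT; rewrite f0 in h0.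
  rewrite -[leRHS](nth_index 0 h0) /g.
  by rewrite (sorted_leq_nth le_trans le_refl)// ?inE ?index_mem.
pose D k omega := step_eval f (g k) omega - step_eval f' (g k) omega.
pose Y k omega := step_integral beta f (g k) omega - step_integral beta f' (g k) omega.
pose Q p omega := \sum_(k < p) D k omega ^+ 2 * (g k.+1 - g k).
(* Q k.+1 is already known at time g k, hence the stop precedes the excess. *)
pose G k := [set omega | Q k.+1 omega <= eta].
have adD k : (k <= m)%N -> adapted_at F (g k) (D k).
  by move=> km; apply: measurable_funB; apply: (adapted_step_eval hF) => //; exact: g_in.
have adY k : (k <= m)%N -> adapted_at F (g k) (Y k).
  move=> km; have /andP[gk0 gkT] := g_in k km.
  by apply: measurable_funB; apply: (adapted_step_integral hF) => //;
    try exact: g_in; move=> u /andP[u0 uk]; apply: brownian_coord_adapted;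
    rewrite u0 (le_trans uk).
have gle2 i k : (i <= k)%N -> (k <= m)%N -> g i <= g k.
  move=> ik km; rewrite /g (sorted_leq_nth le_trans le_refl)// ?inE ?szm ltnS//.
  exact: leq_trans km.
have adQ p k : (p <= k.+1)%N -> (k < m)%N -> adapted_at F (g k) (Q p).
  move=> pk km; apply: measurable_sum => -[i ip] /=.
  have ik : (i <= k)%N by rewrite -ltnS (leq_trans ip).
  apply: measurable_funM => //; apply: measurable_funX.
  have /andP[gi0 _] := g_in i (leq_trans ik (ltnW km)).
  have /andP[_ gkT] := g_in k (ltnW km).
  apply: (adapted_at_le hF gi0 _ gkT); first by apply: gle2 => //; exact: ltnW.
  exact: adD (leq_trans ik (ltnW km)).
have Q_term k omega : (k < m)%N -> 0 <= D k omega ^+ 2 * (g k.+1 - g k).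
  by move=> km; rewrite mulr_ge0 ?sqr_ge0// subr_ge0 g_le.
have Q_mono p p' omega : (p <= p')%N -> (p' <= m)%N -> Q p omega <= Q p' omega.
  elim: p' => [|p' IH]; first by rewrite leqn0 => /eqP ->.
  rewrite leq_eqVlt => /predU1P[->//|pp'] p'm.
  rewrite (le_trans (IH pp' (ltnW p'm)))// /Q big_ord_recr/= lerDl.
  exact: Q_term.
have [Cf hCf] := simple_bounded sf; have [Cf' hCf'] := simple_bounded sf'.
have D_bnd k omega : `|D k omega| <= Cf + Cf'.
  by rewrite (le_trans (ler_normB _ _))// lerD.
have FG k : (k < m)%N -> F (g k) (G k).
  by move=> km; apply: adapted_le_set; [exact: g_in (ltnW km)|exact: adQ].
have mD k : (k < m)%N -> measurable_fun setT (D k).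
  by move=> km; apply: (adapted_at_measurable hF (g_in k (ltnW km))); exact: adD (ltnW km).
have mG k : (k < m)%N -> measurable (G k).
  by move=> km; apply: (filtration_measurable hF (g_in k (ltnW km))); exact: FG.
have main : (P (\bigcup_(k in `I_m) (G k `&` [set omega |
     (lambda < 0 + \sum_(i : 'I_1) Y k.+1 omega ^+ 2)%R])) <=
    (expR (0 * T) * (0 + 2 * eta) / lambda)%:E)%E.
  apply: (@discrete_maximal_inequality R d Omega P T F hF l w hw 'I_1 m g g_le g_in G
    (fun k _ => Y k) (fun _ _ _ => 0)
    (fun k _ j' omega => if j' == j then D k omega else 0)
    (fun k omega => 2 * D k omega ^+ 2) (Cf + Cf') 0 0 0 (2 * eta) lambda) => //.
  - by move=> k km omega; apply: le_trans; apply: Q_mono.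
  - by move=> k i km; exact: adY.
  - by move=> k i km; exact: measurable_cst.
  - move=> k i j' km; case: (j' == j); last exact: measurable_cst.
    exact: adD (ltnW km).
  - move=> k i omega km _; rewrite mul0r addr0 (bigD1 j)//= eqxx big1 ?addr0; last first.
      by move=> j' /negbTE ->; rewrite mul0r.
    rewrite /Y (step_integral_piece _ _ finc (g_le k km) (nof k km)).
    rewrite (step_integral_piece _ _ f'inc (g_le k km) (nof' k km)).
    have -> : increment w (g k) (g k.+1) j omega = beta (g k.+1) omega - beta (g k) omega by [].
    by rewrite /D; ring.
  - move=> k i omega km _; rewrite normr0.
    exact: le_trans (D_bnd k omega).
  - move=> k i j' omega km _; case: (j' == j) => //.
    by rewrite normr0; exact: le_trans (D_bnd k omega).
  - move=> k km; apply: measurable_funM => //; apply: measurable_funX; exact: mD.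
  - by move=> k omega; rewrite mulr_ge0// sqr_ge0.
  - move=> k omega km _; rewrite mul0r add0r.
    rewrite !big_ord1 (bigD1 j)//= eqxx big1 ?addr0; last first.
      by move=> j' /negbTE ->; rewrite expr0n.
    by rewrite mulr0 expr0n/= !mulr0 !add0r.
  - have mterm k : (k < m)%N -> measurable_fun setT (fun x =>
        (g k.+1 - g k)%:E * ((\1_(G k) x)%:E * (2 * D k x ^+ 2)%:E))%E.
      move=> km; apply: emeasurable_funM => //; apply: emeasurable_funM.
        by apply/measurable_EFinP; apply: measurable_indic; exact: mG.
      apply/measurable_EFinP; apply: measurable_funM => //.
      by apply: measurable_funX; exact: mD.
    have -> : (\sum_(k < m) ((g k.+1 - g k)%:E * \int[P]_(x in G k) (2 * D k x ^+ 2)%:E) =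
        \int[P]_x \sum_(k < m) ((g k.+1 - g k)%:E * ((\1_(G k) x)%:E * (2 * D k x ^+ 2)%:E)))%E.
      rewrite (eq_bigr (fun k : 'I_m => \int[P]_x ((g k.+1 - g k)%:E *
          ((\1_(G k) x)%:E * (2 * D k x ^+ 2)%:E)))%E); last first.
        move=> [k km] _ /=; rewrite ge0_integralZl//; last 3 first.
        - apply: emeasurable_funM.
            by apply/measurable_EFinP; apply: measurable_indic; exact: mG.
          apply/measurable_EFinP; apply: measurable_funM => //.
          by apply: measurable_funX; exact: mD.
        - by move=> x _; rewrite -EFinM lee_fin mulr_ge0// mulr_ge0// sqr_ge0.
        - by rewrite lee_fin subr_ge0 g_le.
        congr (_ * _)%E; rewrite [LHS]integral_mkcond; apply: eq_integral => x _.
        by rewrite patchE indicE; case: ifP; rewrite ?mul1e ?mul0e.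
      apply/esym/ge0_integral_sum => //; first by move=> k; exact: mterm.
      by move=> k x _; rewrite -!EFinM lee_fin
        mulr_ge0 ?subr_ge0 ?g_le// mulr_ge0// mulr_ge0// sqr_ge0.
    apply: (@le_trans _ _ (\int[P]_x (2 * eta)%:E)%E); last first.
      by rewrite integral_cst// [X in (_ * X)%E]probability_setT mule1.
    apply: ge0_le_integral => //.
    - move=> x _; apply: sume_ge0 => k _; rewrite -!EFinM lee_fin.
      by rewrite mulr_ge0 ?subr_ge0 ?g_le// mulr_ge0// mulr_ge0// sqr_ge0.
    - by apply: emeasurable_sum => k; exact: mterm.
    move=> x _.
    have -> : (\sum_(k < m) ((g k.+1 - g k)%:E * ((\1_(G k) x)%:E * (2 * D k x ^+ 2)%:E)) =
        (2 * \sum_(k < m) \1_(G k) x * (D k x ^+ 2 * (g k.+1 - g k)))%:E)%E.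
      rewrite mulr_sumr -sumEFin; apply: eq_bigr => k _.
      by rewrite -!EFinM; congr (_%:E); ring.
    rewrite lee_fin ler_wpM2l//.
    suff cap p : (p <= m)%N ->
        \sum_(k < p) \1_(G k) x * (D k x ^+ 2 * (g k.+1 - g k)) <= eta by exact: cap.
    elim: p => [_|p IH pm]; first by rewrite big_ord0 ltW.
    have [Gp|nGp] := pselect (G p x); last first.
      by rewrite big_ord_recr/= [\1_(G p) x]indicE memNset// mul0r addr0 IH// ltnW.
    apply: le_trans Gp; apply: ler_sum => -[k kp] _ /=.
    apply: ler_piMl; first by apply: Q_term; exact: leq_trans kp pm.
    by rewrite indicE; case: (_ \in _).
  - by move=> omega; rewrite big_ord1 /Y g0 !step_integral0// subrr expr0n addr0.
have mQm : measurable_fun setT (Q m).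
  apply: measurable_sum => -[k km] /=; apply: measurable_funM => //.
  by apply: measurable_funX; exact: mD.
have mQ : measurable [set omega | eta < Q m omega].
  exact: measurable_lt_set.
have mYset k : (k <= m)%N -> measurable [set omega | lambda < Y k omega ^+ 2].
  move=> km; have mY := adapted_at_measurable hF (g_in k km) (adY k km).
  by apply: measurable_lt_set; exact: measurable_funX.
have Ysum k omega : 0 + \sum_(i : 'I_1) Y k omega ^+ 2 = Y k omega ^+ 2.
  by rewrite big_ord1 add0r.
set E1 := (X in (P X <= _)%E) in main.
have mE1 : measurable E1.
  apply: bigcup_measurable => k /= km; apply: measurableI; first exact: mG.
  by under eq_set do rewrite Ysum; exact: mYset.
set E := (X in (P X <= _)%E).
have sub : E `<=` E1 `|` [set omega | eta < Q m omega].
  move=> omega [q /= qs /= lam].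
  have qs' : (q <= step_size f')%N by rewrite -ltnS.
  have [p pm gp] : exists2 p, (p <= m)%N & g p = step_time f' q.
    have h := memf' q qs'; exists (index (step_time f' q) s); last exact: nth_index.
    by rewrite -ltnS -szm index_mem.
  rewrite -gp -/(Y p omega) in lam.
  case: p pm gp lam => [_ _|k km _ lam].
    by rewrite /Y g0 !step_integral0// subrr expr0n/= ltNge (ltW lam0).
  have [h|h] := leP (Q m omega) eta; last by right.
  left; exists k => //; split; last by rewrite /= Ysum.
  by rewrite /G/= (le_trans _ h)// Q_mono.
have mE : measurable E.
  apply: bigcup_measurable => q /= qs.
  have qs' : (q <= step_size f')%N by rewrite -ltnS.
  have h := memf' q qs'.
  have im : (index (step_time f' q) s <= m)%N by rewrite -ltnS -szm index_mem.
  by have := mYset _ im; rewrite /Y /g nth_index.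
rewrite -(measurable_mu_extE P mE); apply: le_trans (le_mu_ext P sub) _.
apply: le_trans (mu_extU2 P _ _) _; apply: leeD.
  rewrite (measurable_mu_extE P mE1).
  by move: main; rewrite mul0r expR0 mul1r add0r.
apply: le_mu_ext => omega /= etaQ.
apply: (@lt_le_trans _ _ (Q m omega)%:E); first by rewrite lte_fin.
pose h u := (step_eval f u omega - step_eval f' u omega) ^+ 2.
have -> : Q m omega = \sum_(k < m) h (g k) * (g k.+1 - g k) by [].
apply: grid_sum_le_integral => //.
- by apply: measurable_funX; apply: measurable_funB; exact: measurable_step_eval.
- by move=> u; exact: sqr_ge0.
- move=> k u km ku; rewrite /h (step_eval_const _ (nof k km) ku).
  by rewrite (step_eval_const _ (nof' k km) ku).
Qed.

End lenglart.

(** * Uniformly continuous paths *)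
Section paths.
Context {R : realType}.
Variable T : R.
Hypothesis T_gt0 : 0 < T.

Definition unif_cont (f : R -> R) := forall e, 0 < e -> exists2 delta, 0 < delta &
  forall s t, 0 <= s <= T -> 0 <= t <= T -> `|s - t| < delta -> `|f s - f t| < e.

(** The Heine-Cantor theorem. *)
Lemma within_unif_cont (f : R -> R) :
  {within `[0, T], continuous f} -> unif_cont f.
Proof.
move=> cf e e0; have e20 : 0 < e / 2 by rewrite divr_gt0.
have /compact_near_coveringP cK : compact `[0, T] by exact: segment_compact.
have := cK R (0 : R)^'+ (fun delta s => 0 <= s <= T -> forall t, 0 <= t <= T ->
   `|s - t| < delta -> `|f s - f t| < e) _.
case.
  move=> x xT; rewrite /= in_itv/= in xT.
  move/subspace_continuousP : (cf) => /(_ x); rewrite /= in_itv/= => /(_ xT).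
  move=> /cvgrPdist_lt /(_ _ e20) /nbhs_ballP[eta /= eta0 h].
  have eta20 : 0 < eta / 2 by rewrite divr_gt0.
  exists (ball x (eta / 2), [set delta | delta < eta / 2]) => /=.
    by split; [exact: nbhsx_ballx|exact: nbhs_right_lt].
  move=> [s delta] /= [xs dlt] sT t tT st.
  have hs : `|f x - f s| < e / 2.
    apply: h; last by rewrite in_itv.
    by rewrite /ball/= (lt_trans xs)// ltr_pdivrMr// ltr_pMr// ltr1n.
  have ht : `|f x - f t| < e / 2.
    apply: h; last by rewrite in_itv.
    rewrite /ball/=; have -> : x - t = (x - s) + (s - t) by ring.
    rewrite (le_lt_trans (ler_normD _ _))// (splitr eta) ltrD//.
    exact: lt_trans dlt.
  have -> : f s - f t = (f x - f t) - (f x - f s) by ring.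
  by rewrite (le_lt_trans (ler_normB _ _))// (splitr e) ltrD.
move=> delta /= delta0 hd; exists (delta / 2); first by rewrite divr_gt0.
move=> s t sT tT st; have d20 : 0 < delta / 2 by rewrite divr_gt0.
apply: (hd (delta / 2)) => //.
by rewrite /= sub0r normrN gtr0_norm// ltr_pdivrMr// ltr_pMr// ltr1n.
Qed.

Lemma unif_cont_within (f : R -> R) :
  unif_cont f -> {within `[0, T], continuous f}.
Proof.
move=> uf; apply/subspace_continuousP => x; rewrite /= in_itv/= => xT.
apply/cvgrPdist_lt => e e0; have [delta d0 hd] := uf e e0.
apply/nbhs_ballP; exists delta => //= y xy.
by rewrite /= in_itv/= => yT; exact: hd.
Qed.

Lemma unif_cont_bounded (f : R -> R) : unif_cont f ->
  exists M, forall t, 0 <= t <= T -> `|f t| <= M.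
Proof.
move=> uf.
have uaf : unif_cont (fun t => `|f t|).
  move=> e e0; have [delta d0 hd] := uf e e0; exists delta => // s t sT tT st.
  exact: le_lt_trans (ler_dist_dist _ _) (hd s t sT tT st).
have [c _ hc] := EVT_max (ltW T_gt0) (unif_cont_within uaf).
by exists `|f c| => t tT; apply: hc; rewrite in_itv.
Qed.

Lemma unif_contD (f g : R -> R) : unif_cont f -> unif_cont g ->
  unif_cont (fun t => f t + g t).
Proof.
move=> uf ug e e0; have e20 : 0 < e / 2 by rewrite divr_gt0.
have [d1 d10 h1] := uf _ e20; have [d2 d20 h2] := ug _ e20.
exists (Num.min d1 d2) => [|s t sT tT]; first by rewrite lt_min d10.
rewrite lt_min => /andP[st1 st2].
have -> : f s + g s - (f t + g t) = (f s - f t) + (g s - g t) by ring.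
rewrite (le_lt_trans (ler_normD _ _))// (splitr e).
by rewrite ltrD ?h1 ?h2.
Qed.

Lemma unif_cont_cst c : unif_cont (fun=> c).
Proof. by move=> e e0; exists 1 => // s t _ _ _; rewrite subrr normr0. Qed.

Lemma unif_contZ c (f : R -> R) : unif_cont f -> unif_cont (fun t => c * f t).
Proof.
move=> uf e e0; have e20 : 0 < e / (`|c| + 1) by rewrite divr_gt0// ltr_wpDl.
have [delta d0 hd] := uf _ e20; exists delta => // s t sT tT st.
rewrite -mulrBr normrM; have := hd s t sT tT st.
rewrite ltr_pdivlMr ?ltr_wpDl//; apply: le_lt_trans.
by rewrite mulrC ler_wpM2l// lerDl.
Qed.

Lemma unif_cont_sum (I : Type) (s : seq I) (f : I -> R -> R) :
  (forall i, unif_cont (f i)) -> unif_cont (fun t => \sum_(i <- s) f i t).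
Proof.
move=> uf; elim: s => [|i s IH].
  by under eq_fun do rewrite big_nil; exact: unif_cont_cst.
by under eq_fun do rewrite big_cons; exact: unif_contD.
Qed.

Lemma unif_cont_min a (f : R -> R) : 0 <= a <= T -> unif_cont f ->
  unif_cont (fun t => f (Num.min a t)).
Proof.
move=> aT uf e e0; have [delta d0 hd] := uf _ e0; exists delta => // s t sT tT st.
have mT u : 0 <= u <= T -> 0 <= Num.min a u <= T.
  by move=> uT; rewrite /Num.min; case: ifP.
apply: hd; [exact: mT|exact: mT|]; apply: le_lt_trans st.
have h1 := ler_norm (s - t); have h2 := ler_norm (t - s).
rewrite (distrC t) in h2; move: `|s - t| h1 h2 => N h1 h2.
rewrite ler_norml; apply/andP; split.
  by case: (leP a s) => h3; case: (leP a t) => h4; lra.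
by case: (leP a s) => h3; case: (leP a t) => h4; lra.
Qed.

Lemma unif_cont_id : unif_cont id.
Proof. by move=> e e0; exists e. Qed.

Lemma unif_cont_lim (f : nat -> R -> R) (g : R -> R) :
  (forall n, unif_cont (f n)) ->
  (forall e, 0 < e -> exists n, forall t, 0 <= t <= T -> `|f n t - g t| <= e) ->
  unif_cont g.
Proof.
move=> uf fg e e0; have e40 : 0 < e / 4 by rewrite divr_gt0.
have [n hn] := fg _ e40; have [delta d0 hd] := uf n _ e40.
exists delta => // s t sT tT st.
have := hd s t sT tT st; have := hn s sT; have := hn t tT.
rewrite !ler_norml !ltr_norml => /andP[a1 a2] /andP[a3 a4] /andP[a5 a6].
by apply/andP; split; lra.
Qed.

Lemma unif_cont_lip (n : nat) (f : 'I_n -> R -> R) (g : R -> R) (L : R) :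
  (forall i, unif_cont (f i)) -> 0 <= L ->
  (forall s t, 0 <= s <= T -> 0 <= t <= T ->
     `|g s - g t| <= L * \sum_i `|f i s - f i t|) -> unif_cont g.
Proof.
move=> uf L0 hg e e0.
have e1 : 0 < e / (L * n%:R + 1) by rewrite divr_gt0// ltr_wpDl// mulr_ge0.
have : forall i, exists delta, 0 < delta /\
  forall s t, 0 <= s <= T -> 0 <= t <= T -> `|s - t| < delta ->
     `|f i s - f i t| < e / (L * n%:R + 1).
  by move=> i; have [delta] := uf i _ e1; exists delta.
move=> /choice[dl hdl].
exists (\big[Num.min/1]_i dl i).
  by elim/big_ind : _ => // [u v u0 v0|i _]; [rewrite lt_min u0|have [] := hdl i].
move=> s t sT tT st.
apply: le_lt_trans (hg s t sT tT) _.
apply: (@le_lt_trans _ _ (L * \sum_(i < n) (e / (L * n%:R + 1)))).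
  apply: ler_wpM2l => //; apply: ler_sum => i _.
  have [_ h] := hdl i; apply: ltW; apply: h => //.
  by apply: lt_le_trans st _; exact: bigmin_le_cond.
have q0 : 0 < L * n%:R + 1 by rewrite ltr_wpDl// mulr_ge0.
rewrite sumr_const card_ord -[_ *+ n]mulr_natl !mulrA ltr_pdivrMr//.
by rewrite mulrDr mulr1 [X in _ < X + _]mulrC ltrDl.
Qed.

Lemma mesh_small (delta : R) : 0 < delta ->
  exists q, forall n, (q <= n)%N -> T / (2 ^ n)%:R <= delta.
Proof.
move=> d0; exists (Num.trunc (T / delta)).+1 => n qn.
rewrite ler_pdivrMr ?pow2_gt0// mulrC -ler_pdivrMr//.
apply: ltW; apply: lt_le_trans (truncnS_gt _) _.
by rewrite ler_nat (leq_trans qn)// ltnW// ltn_expl.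
Qed.

(** Dyadic times are dense. *)
Lemma dyadic_le_all (f : R -> R) (n0 : nat) (c : R) : unif_cont f ->
  (forall n k, (n0 <= n)%N -> (k <= 2 ^ n)%N -> f (dyadic T n k) <= c) ->
  forall t, 0 <= t <= T -> f t <= c.
Proof.
move=> uf hf t /andP[t0 tT].
move: tT; rewrite le_eqVlt => /predU1P[->|tT].
  by rewrite -(dyadicT T n0); exact: hf.
apply/ler_addgt0Pr => e e0; have [delta d0 hd] := uf e e0.
have d20 : 0 < delta / 2 by rewrite divr_gt0.
have [q hq] := mesh_small d20; pose n := maxn n0 q.
have tT' : 0 <= t < T by rewrite t0.
have [h1 h2] := dyadic_indexP T_gt0 n tT'.
have h3 := hf n _ (leq_maxl _ _) (ltnW h1).
have := hd t (dyadic T n (dyadic_index T n t)).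
rewrite t0 (ltW tT) dyadic_in ?(ltnW h1)// => /(_ isT isT) h4.
have : `|f t - f (dyadic T n (dyadic_index T n t))| < e.
  apply: h4; have /andP[h5 h6] := dyadic_dist h2.
  rewrite ger0_norm//; apply: lt_le_trans h6 _; apply: le_trans (hq n _) _.
    exact: leq_maxr.
  by rewrite ler_pdivrMr// ler_pMr// ler1n.
by rewrite ltr_norml => /andP[_ h5]; lra.
Qed.

Lemma geometric_cauchy (u : nat -> R) (n0 : nat) :
  (forall n, (n0 <= n)%N -> `|u n.+1 - u n| <= (2 ^- n)%R) ->
  exists a, u @ \oo --> a /\ forall n, (n0 <= n)%N -> `|u n - a| <= 2 * 2 ^- n.
Proof.
move=> hu.
have p0 n : 0 < 2 ^- n :> R by rewrite invr_gt0 exprn_gt0.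
have step n m : (n0 <= n)%N -> (n <= m)%N -> `|u m - u n| <= 2 * 2 ^- n - 2 * 2 ^- m.
  move=> n0n; elim: m => [|m IH].
    by rewrite leqn0 => /eqP ->; rewrite !subrr normr0.
  rewrite leq_eqVlt => /predU1P[->|nm]; first by rewrite !subrr normr0.
  have h1 := IH nm; have h2 := hu m (leq_trans n0n nm).
  have -> : u m.+1 - u n = (u m.+1 - u m) + (u m - u n) by ring.
  rewrite (le_trans (ler_normD _ _))// (le_trans (lerD h2 h1))//.
  have -> : 2 ^- m.+1 = 2 ^- m / 2 :> R by rewrite exprS invfM mulrC.
  lra.
have step' n m : (n0 <= n)%N -> (n <= m)%N -> `|u n - u m| <= 2 * 2 ^- n.
  move=> n0n nm; by rewrite distrC (le_trans (step n m n0n nm))// gerBl mulr_ge0// ltW.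
have small (e : R) : 0 < e -> exists N, (n0 <= N)%N /\ 2 * 2 ^- N < e.
  move=> e0; have e20 : 0 < e / 2 by rewrite divr_gt0.
  pose N := maxn n0 (Num.trunc (e / 2)^-1).
  exists N; split; first exact: leq_maxl.
  rewrite mulrC -ltr_pdivlMr// invf_plt ?posrE// ?exprn_gt0//.
  apply: lt_le_trans (truncnS_gt _) _; rewrite -natrX ler_nat.
  by apply: (@leq_ltn_trans N); [exact: leq_maxr|exact: ltn_expl].
have : cvgn u.
  apply: cauchy_cvg; apply/cauchy_exP => e e0.
  have [N [Nn0 Ne]] := small e e0; exists (u N); exists N => // m /= Nm.
  exact: le_lt_trans (step' _ _ Nn0 Nm) Ne.
move=> cu; exists (limn u); split => // n n0n.
apply/ler_addgt0Pr => e e0.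
move/cvgrPdist_le : cu => /(_ e e0)[M _ hM].
have h1 := hM (maxn M n) (leq_maxl _ _).
have h2 := step' n (maxn M n) n0n (leq_maxr _ _).
have -> : u n - limn u = (u n - u (maxn M n)) + (u (maxn M n) - limn u) by ring.
rewrite (le_trans (ler_normD _ _))// lerD//.
by rewrite distrC.
Qed.

End paths.

Section adapted_limit.
Context {R : realType}.

(** A limit that is defined for every sequence. A random limit built from it is
    measurable without any exceptional set, which matters for adaptedness since
    F t need not contain the null sets. *)
Definition limsup_fine (u : nat -> R) : R := fine (limn_esup (fun n => (u n)%:E)).

Lemma limsup_fineE (u : nat -> R) a : u @ \oo --> a -> limsup_fine u = a.
Proof.
move=> ua; have h : (fun n => (u n)%:E) @ \oo --> a%:E.
  by apply/fine_cvgP; split => //; exact: nearW.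
rewrite /limsup_fine is_cvg_limn_esupE; last by apply/cvg_ex; exists a%:E.
by rewrite (cvg_lim _ h).
Qed.

Context {d : measure_display} {Omega : measurableType d}.

Lemma measurable_limsup_fine (u : nat -> Omega -> R) :
  (forall n, measurable_fun setT (u n)) ->
  measurable_fun setT (fun x => limsup_fine (u ^~ x)).
Proof.
move=> mu_; apply: (@measurableT_comp _ _ _ _ _ _ fine).
  exact: fine_measurable.
apply: measurable_fun_limn_esup => n; exact/measurable_EFinP.
Qed.

End adapted_limit.

(** * Euler schemes *)
Section coefficient_bounds.
Context {R : realType} {r l : nat}.
Variables (b : 'cV[R]_r -> 'cV[R]_r) (sigma : 'cV[R]_r -> 'M[R]_(r, l)).

Lemma edot_sqnorm (y : 'cV[R]_r) : edot y y = sqnorm y.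
Proof. by apply: eq_bigr => i _; rewrite expr2. Qed.

Lemma sqnorm_ge0 (y : 'cV[R]_r) : 0 <= sqnorm y.
Proof. by apply: sumr_ge0 => i _; exact: sqr_ge0. Qed.

Lemma sqr_sum_le (I : finType) (a : I -> R) : \sum_i a i ^+ 2 <= (\sum_i `|a i|) ^+ 2.
Proof.
rewrite expr2 mulr_suml; apply: ler_sum => i _.
rewrite -real_normK ?num_real// expr2 ler_wpM2l// (bigD1 i)//= lerDl.
by apply: sumr_ge0.
Qed.

Hypothesis lipschitz : forall N : R, exists L : R, forall y z : 'cV[R]_r,
  enorm y <= N -> enorm z <= N ->
  \sum_(i < r) `|b y i 0 - b z i 0|
    + \sum_(i < r) \sum_(j < l) `|sigma y i j - sigma z i j|
    <= L * enorm (y - z).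

Lemma lipschitz_on_balls N : exists2 L, 0 <= L & sq_lipschitz_on b sigma N L.
Proof.
have [L hL] := lipschitz (Num.sqrt N).
exists (L ^+ 2); first exact: sqr_ge0.
move=> y z yN zN.
have := hL y z; rewrite /enorm !edot_sqnorm !ler_wsqrtr// => /(_ isT isT) {}hL.
set A := \sum_(i < r) `|_| in hL.
set B := \sum_(i < r) \sum_(j < l) _ in hL.
have A0 : 0 <= A by apply: sumr_ge0.
have B0 : 0 <= B by apply: sumr_ge0 => i _; apply: sumr_ge0.
have h1 : \sum_i (b y i 0 - b z i 0) ^+ 2 <= A ^+ 2 by exact: sqr_sum_le.
have h2 : \sum_i \sum_j (sigma y i j - sigma z i j) ^+ 2 <= B ^+ 2.
  rewrite /B !pair_big/=; exact: (sqr_sum_le (fun p : 'I_r * 'I_l => sigma y p.1 p.2 - sigma z p.1 p.2)).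
have : (A + B) ^+ 2 <= (L * Num.sqrt (sqnorm (y - z))) ^+ 2.
  by rewrite ler_pXn2r// ?nnegrE ?addr_ge0// (le_trans _ hL)// addr_ge0.
rewrite exprMn sqr_sqrtr ?sqnorm_ge0//.
have -> : sqnorm (y - z) = sqdist y z.
  by apply: eq_bigr => i _; rewrite !mxE.
apply: le_trans; apply: le_trans (lerD h1 h2) _.
by rewrite sqrrD -mulr_natl; nra.
Qed.

(** By comparison with the values at 0. *)
Lemma bounded_on_balls N : 0 <= N -> exists C, coef_bounded_on b sigma N C.
Proof.
move=> N0; have [L L0 hL] := lipschitz_on_balls N.
exists (\sum_i `|b 0 i 0| + \sum_i \sum_j `|sigma 0 i j| + (1 + L * N)) => y yN.
have z0 : sqnorm (0 : 'cV[R]_r) <= N.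
  by rewrite /sqnorm big1// => i _; rewrite mxE expr0n.
have := hL y 0 yN z0.
have -> : sqdist y 0 = sqnorm y.
  by apply: eq_bigr => i _; rewrite mxE subr0.
move=> h; have {}h := le_trans h (ler_wpM2l L0 yN).
set A := \sum_i (b y i 0 - _) ^+ 2 in h; set B := \sum_i \sum_j _ in h.
have A0 : 0 <= A by apply: sumr_ge0 => i _; exact: sqr_ge0.
have B0 : 0 <= B by apply: sumr_ge0 => i _; apply: sumr_ge0 => j _; exact: sqr_ge0.
have sqbnd (u v : R) : (u - v) ^+ 2 <= L * N -> `|u| <= `|v| + (1 + L * N).
  move=> uv; have := ler_normD (u - v) v; rewrite subrK.
  have : `|u - v| <= 1 + L * N; last by lra.
  rewrite -(real_normK (num_real _)) in uv.
  by have := sqr_ge0 (`|u - v| - 1); rewrite sqrrB1; nra.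
have SA : 0 <= \sum_i `|b 0 i 0| by apply: sumr_ge0.
have SB : 0 <= \sum_i \sum_j `|sigma 0 i j| by apply: sumr_ge0 => i _; apply: sumr_ge0.
split=> [i|i j].
  have : (b y i 0 - b 0 i 0) ^+ 2 <= L * N.
    apply: le_trans h; rewrite /A (bigD1 i)//= -addrA lerDl addr_ge0//.
    by apply: sumr_ge0 => j _; exact: sqr_ge0.
  move=> /sqbnd; have : `|b 0 i 0| <= \sum_i `|b 0 i 0|.
    by rewrite (bigD1 i)//= lerDl sumr_ge0.
  lra.
have : (sigma y i j - sigma 0 i j) ^+ 2 <= L * N.
  have sB : (sigma y i j - sigma 0 i j) ^+ 2 <= B.
    rewrite /B (bigD1 i)//= (bigD1 j)//= -!addrA lerDl.
    apply: addr_ge0; first by apply: sumr_ge0 => k _; exact: sqr_ge0.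
    by apply: sumr_ge0 => k _; apply: sumr_ge0 => k' _; exact: sqr_ge0.
  by apply: le_trans sB (le_trans _ h); rewrite lerDr.
move=> /sqbnd; have : `|sigma 0 i j| <= \sum_i \sum_j `|sigma 0 i j|.
  rewrite (bigD1 i)//= (bigD1 j)//= -addrA lerDl addr_ge0 ?sumr_ge0// => k _.
  exact: sumr_ge0.
lra.
Qed.

End coefficient_bounds.

Section scheme.
Context {R : realType} {d : measure_display} {Omega : measurableType d}.
Variables (P : probability Omega R) (T : R) (F : R -> set_system Omega).
Hypotheses (T_gt0 : 0 < T) (hF : is_filtration T F).
Variables (r l : nat) (w : R -> Omega -> 'cV[R]_l).
Hypothesis hw : is_brownian P T F w.
Variables (b : 'cV[R]_r -> 'cV[R]_r) (sigma : 'cV[R]_r -> 'M[R]_(r, l)).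
Hypotheses (hb : borel_fun b) (hsigma : borel_fun sigma).
Variables (x : 'cV[R]_r) (eps : R).
Hypothesis eps01 : 0 < eps <= 1.

(** The cut-off N applies to the squared norm, as everywhere below. *)
Definition trunc_drift (N : R) (y : 'cV[R]_r) i : R :=
  if sqnorm y <= N then b y i 0 else 0.

Definition trunc_diffusion (N : R) (y : 'cV[R]_r) i j : R :=
  if sqnorm y <= N then sigma y i j else 0.

Lemma ball_adapted t (xi : Omega -> 'cV[R]_r) N : 0 <= t <= T ->
  measurable_wrt (F t) xi -> F t [set omega | sqnorm (xi omega) <= N].
Proof.
move=> t0T hxi; apply: (adapted_le_set hF (f := fun omega => sqnorm (xi omega)) N t0T).
apply: measurable_sum => i; apply: measurable_funX.
exact: (adapted_at_coord hF _ t0T hxi).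
Qed.

Let adapted_trunc t (xi : Omega -> 'cV[R]_r) N (f : Omega -> R) : 0 <= t <= T ->
  measurable_wrt (F t) xi -> adapted_at F t f ->
  adapted_at F t (fun omega => if sqnorm (xi omega) <= N then f omega else 0).
Proof.
move=> t0T hxi hf.
rewrite (_ : (fun _ => _) =
  (fun omega => \1_[set omega | sqnorm (xi omega) <= N] omega * f omega)); last first.
  apply/funext => omega; rewrite indicE; case: ifPn => h.
    by rewrite mem_set ?mul1r.
  by rewrite memNset ?mul0r//=; exact/negP.
apply: measurable_funM => //; apply/measurable_indicP.
by rewrite (filtration_gE hF)//; exact: ball_adapted.
Qed.

Lemma trunc_drift_adapted t (xi : Omega -> 'cV[R]_r) N i : 0 <= t <= T ->
  measurable_wrt (F t) xi -> adapted_at F t (fun omega => trunc_drift N (xi omega) i).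
Proof.
move=> t0T hxi; apply: adapted_trunc => //.
apply: (adapted_at_coord hF (X := fun omega => b (xi omega))) => // A bA.
exact: (hxi _ (hb bA)).
Qed.

Lemma trunc_diffusion_adapted t (xi : Omega -> 'cV[R]_r) N i j : 0 <= t <= T ->
  measurable_wrt (F t) xi ->
  adapted_at F t (fun omega => trunc_diffusion N (xi omega) i j).
Proof.
move=> t0T hxi; apply: adapted_trunc => //.
apply: (@adapted_at_comp _ _ _ _ _ hF t _ (fun omega => sigma (xi omega))
  (fun A : 'M[R]_(r, l) => A i j)) => //.
- by move=> A bA; exact: (hxi _ (hsigma bA)).
- by apply: continuous_borel => A; exact: coord_continuous.
Qed.

Variables (N : R) (mesh : nat).
Local Notation dy := (dyadic T mesh).

(** The values v at which the coefficients are frozen are left open: they are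
    those of the scheme itself for the Euler scheme, and those of a given
    solution in the proof of uniqueness. *)
Section frozen.
Variable v : nat -> Omega -> 'cV[R]_r.
Hypothesis hv : forall k, (k < 2 ^ mesh)%N -> measurable_wrt (F (dy k)) (v k).

Definition drift_step i : step_process R Omega :=
  dyadic_step T mesh (fun k omega => trunc_drift N (v k omega) i).

Definition diffusion_step i j : step_process R Omega :=
  dyadic_step T mesh (fun k omega => trunc_diffusion N (v k omega) i j).

Definition scheme_mart i j (t : R) (omega : Omega) : R :=
  step_integral (coord_process w j) (diffusion_step i j) t omega.

(** The scheme is defined at all times, so that it can be compared with schemes
    on finer grids and has continuous paths. *)
Definition scheme i (t : R) (omega : Omega) : R :=
  x i 0 + step_integral (fun u _ => u) (drift_step i) t omega
    + eps * \sum_j scheme_mart i j t omega.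

Let dy_in k : (k < 2 ^ mesh)%N -> 0 <= dy k <= T.
Proof. by move=> km; apply: dyadic_in => //; exact: ltnW. Qed.

Lemma diffusion_step_simple C i j : 0 <= N -> coef_bounded_on b sigma N C ->
  is_simple T F (diffusion_step i j).
Proof.
move=> N0 hC; split.
- exact: dyadic0.
- exact: dyadicT.
- exact: dyadic_step_increasing.
- move=> k /= km; split.
    apply/(adapted_atP hF _ (dy_in km)); apply: trunc_diffusion_adapted; first exact: dy_in.
    exact: hv.
  exists `|C| => omega; rewrite /trunc_diffusion; case: ifPn => [h|_]; last by rewrite normr0.
  by have [_ h2] := hC _ h; rewrite (le_trans (h2 i j))// ler_norm.
Qed.

Let inc f : step_increasing (dyadic_step T mesh f : step_process R Omega).
Proof. exact: dyadic_step_increasing. Qed.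

Lemma scheme_mart_adapted i j t : 0 <= t <= T -> adapted_at F t (scheme_mart i j t).
Proof.
move=> t0T; apply: (adapted_step_integral hF) => //.
- exact: dyadic0.
- exact: inc.
- by move=> k /= km; apply: trunc_diffusion_adapted; [exact: dy_in|exact: hv].
- move=> s /andP[s0 st]; apply: (brownian_coord_adapted hF hw).
  by rewrite s0 (le_trans st)//; case/andP : t0T.
Qed.

Lemma scheme_adapted i t : 0 <= t <= T -> adapted_at F t (scheme i t).
Proof.
move=> t0T; apply: measurable_funD.
  apply: measurable_funD; first exact: measurable_cst.
  apply: (adapted_step_integral hF) => //.
  - exact: dyadic0.
  - exact: inc.
  - by move=> k /= km; apply: trunc_drift_adapted; [exact: dy_in|exact: hv].
  - by move=> s _; exact: measurable_cst.
apply: measurable_funM; first exact: measurable_cst.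
by apply: measurable_sum => j; exact: scheme_mart_adapted.
Qed.

Lemma scheme_mart0 i j omega : scheme_mart i j 0 omega = 0.
Proof. by apply: step_integral0; [exact: dyadic0|exact: inc]. Qed.

Lemma scheme0 i omega : scheme i 0 omega = x i 0.
Proof.
rewrite /scheme step_integral0; [|exact: dyadic0|exact: inc].
by rewrite big1 ?mulr0 ?addr0// => j _; exact: scheme_mart0.
Qed.

Definition no_dyadic_between (s t : R) :=
  forall k, (k <= 2 ^ mesh)%N -> s < dy k -> t <= dy k.

Lemma scheme_mart_piece i j s t omega : 0 <= s < T -> s <= t -> no_dyadic_between s t ->
  scheme_mart i j t omega = scheme_mart i j s omega
    + trunc_diffusion N (v (dyadic_index T mesh s) omega) i j * increment w s t j omega.
Proof.
move=> sT st nd; rewrite /scheme_mart (step_integral_piece _ _ (@inc _) st)//.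
by rewrite dyadic_step_eval.
Qed.

Lemma scheme_piece i s t omega : 0 <= s < T -> s <= t -> no_dyadic_between s t ->
  scheme i t omega = scheme i s omega
    + trunc_drift N (v (dyadic_index T mesh s) omega) i * (t - s)
    + eps * \sum_j trunc_diffusion N (v (dyadic_index T mesh s) omega) i j
          * increment w s t j omega.
Proof.
move=> sT st nd; rewrite /scheme (step_integral_piece _ _ (@inc _) st)//.
rewrite dyadic_step_eval//.
rewrite (eq_bigr (fun j => scheme_mart i j s omega + trunc_diffusion N
    (v (dyadic_index T mesh s) omega) i j * increment w s t j omega)); last first.
  by move=> j _; exact: scheme_mart_piece.
by rewrite big_split/= mulrDr; ring.
Qed.

Lemma scheme_unif_cont i omega :
  (forall j, unif_cont T (fun t => w t omega j 0)) ->
  unif_cont T (fun t => scheme i t omega) /\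
  (forall j, unif_cont T (fun t => scheme_mart i j t omega)).
Proof.
move=> uw.
have si f (beta : R -> Omega -> R) : unif_cont T (fun t => beta t omega) ->
    unif_cont T (fun t => step_integral beta (dyadic_step T mesh f) t omega).
  move=> ub; apply: unif_cont_sum => -[k km] /=; apply: unif_contZ.
  apply: unif_contD; last under eq_fun do rewrite -mulN1r.
    by apply: (@unif_cont_min _ T _ (fun u => beta u omega)) => //; exact: dyadic_in.
  apply: unif_contZ; apply: (@unif_cont_min _ T _ (fun u => beta u omega)) => //.
  exact: dy_in.
have um j : unif_cont T (fun t => scheme_mart i j t omega) by apply: si; exact: uw.
split=> //; apply: unif_contD.
  apply: unif_contD; first exact: unif_cont_cst.
  by apply: si; exact: unif_cont_id.
by apply: unif_contZ; apply: unif_cont_sum.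
Qed.

End frozen.

Fixpoint euler (k : nat) : Omega -> 'cV[R]_r :=
  if k is k'.+1 then fun omega => \col_i (euler k' omega i 0
      + trunc_drift N (euler k' omega) i * (dy k - dy k')
      + eps * \sum_j trunc_diffusion N (euler k' omega) i j
          * increment w (dy k') (dy k) j omega)
  else fun=> x.

Lemma euler_adapted k : (k <= 2 ^ mesh)%N -> measurable_wrt (F (dy k)) (euler k).
Proof.
elim: k => [|k IH] km.
  apply: (coord_adapted_at hF); first exact: dyadic_in.
  by move=> i; exact: measurable_cst.
have k1 := dyadic_in T_gt0 (ltnW km); have k2 := dyadic_in T_gt0 km.
have kk : dy k <= dy k.+1 by rewrite dyadic_le.
have := k1 => /andP[k10 _]; have := k2 => /andP[_ k2T].
have hk := IH (ltnW km).
have lift f : adapted_at F (dy k) f -> adapted_at F (dy k.+1) f.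
  exact: (adapted_at_le hF).
apply: (coord_adapted_at hF) => // i /=; under eq_fun do rewrite mxE.
apply: measurable_funD; first apply: measurable_funD.
- by apply: lift; exact: (adapted_at_coord hF).
- by apply: measurable_funM => //; apply: lift; exact: trunc_drift_adapted.
apply: measurable_funM => //; apply: measurable_sum => j; apply: measurable_funM.
  by apply: lift; exact: trunc_diffusion_adapted.
apply: measurable_funB; first exact: (brownian_coord_adapted hF hw).
by apply: lift; exact: (brownian_coord_adapted hF hw).
Qed.

Lemma euler_scheme k i omega : (k <= 2 ^ mesh)%N ->
  scheme euler i (dy k) omega = euler k omega i 0.
Proof.
elim: k i => [|k IH] i km; first by rewrite dyadic0 scheme0.
have /andP[k0 _] := dyadic_in T_gt0 (ltnW km).
have kT : dy k < T.
  by have := dyadic_lt T_gt0 mesh k (2 ^ mesh); rewrite dyadicT km => ->.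
rewrite (@scheme_piece euler i (dy k) (dy k.+1)).
- by rewrite IH ?(ltnW km)// dyadic_index_dyadic// /= mxE.
- by rewrite k0.
- by rewrite dyadic_le.
- by move=> q _; rewrite dyadic_lt// dyadic_le.
Qed.

(** With kappa = 1: the growth condition bounds the terms of the energy of order
    one by 2 K^2 (1 + |y|^2), and the remaining term, the mesh times |b(y)|^2, is
    at most 1 because the mesh is small compared with the truncated drift. *)
Lemma euler_nonexplosion (K C lambda : R) :
  (forall y : 'cV[R]_r, edot y (b y) + \sum_(i < r) \sum_(j < l) (sigma y i j) ^+ 2
       <= K ^+ 2 * (1 + sqnorm y)) ->
  coef_bounded_on b sigma N C -> T / (2 ^ mesh)%:R * (r%:R * C ^+ 2) <= 1 -> 0 < lambda ->
  (P (\bigcup_(k in `I_(2 ^ mesh).+1) [set omega | (lambda < sqnorm (euler k omega))%R]) <=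
    (expR ((2 * K ^+ 2 + 1) * T) * (1 + sqnorm x) / lambda)%:E)%E.
Proof.
move=> growth hC hmesh lam0.
have e0 : 0 <= (2 * K ^+ 2 + 1) * T.
  by rewrite mulr_ge0 ?(ltW T_gt0)// addr_ge0// mulr_ge0// sqr_ge0.
have E1 : 1 <= expR ((2 * K ^+ 2 + 1) * T) by rewrite -[leLHS]expR0 ler_expR.
have x0 := sqnorm_ge0 x.
have meas k : (k <= 2 ^ mesh)%N ->
    measurable [set omega | (lambda < sqnorm (euler k omega))%R].
  move=> km; apply: measurable_lt_set; apply: measurable_sum => i; apply: measurable_funX.
  apply: (adapted_at_measurable hF (dyadic_in T_gt0 km)).
  by apply: (adapted_at_coord hF _ (dyadic_in T_gt0 km)); exact: euler_adapted.
have mU : measurable (\bigcup_(k in `I_(2 ^ mesh).+1) [set omega | (lambda < sqnorm (euler k omega))%R]).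
  by apply: bigcup_measurable => k /= km; apply: meas; rewrite -ltnS.
have [lamx|xlam] := ltP lambda (sqnorm x).
  apply: le_trans (probability_le1 _ mU) _; rewrite lee_fin ler_pdivlMr// mul1r.
  have h1 : 1 + sqnorm x <= expR ((2 * K ^+ 2 + 1) * T) * (1 + sqnorm x).
    by rewrite ler_peMl// addr_ge0.
  by lra.
have g_le k : (k < 2 ^ mesh)%N -> dy k <= dy k.+1 by rewrite dyadic_le.
have g_in k : (k <= 2 ^ mesh)%N -> 0 <= dy k <= T by exact: dyadic_in.
have [e1 e2] := andP eps01.
have main : (P (\bigcup_(k in `I_(2 ^ mesh)) (setT `&`
    [set omega | (lambda < 1 + \sum_(i < r) euler k.+1 omega i 0 ^+ 2)%R])) <=
    (expR ((2 * K ^+ 2 + 1) * T) * (1 + sqnorm x + 0) / lambda)%:E)%E.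
  apply: (@discrete_maximal_inequality R d Omega P T F hF l w hw 'I_r (2 ^ mesh)%N dy
    g_le g_in (fun=> setT) (fun k i omega => euler k omega i 0)
    (fun k i omega => trunc_drift N (euler k omega) i)
    (fun k i j omega => eps * trunc_diffusion N (euler k omega) i j)
    (fun _ _ => 0) `|C| (2 * K ^+ 2 + 1) 1 (1 + sqnorm x) 0 lambda) => //.
  - move=> k km; rewrite -(filtration_gE hF); last exact: g_in (ltnW km).
    exact: measurableT.
  - by move=> k i km; apply: (adapted_at_coord hF _ (g_in k km)); exact: euler_adapted.
  - move=> k i km; apply: trunc_drift_adapted; first exact: g_in (ltnW km).
    exact: euler_adapted (ltnW km).
  - move=> k i j km; apply: measurable_funM => //.
    apply: trunc_diffusion_adapted; first exact: g_in (ltnW km).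
    exact: euler_adapted (ltnW km).
  - move=> k i omega km _ /=; rewrite mxE mulr_sumr; congr (_ + _).
    by apply: eq_bigr => j _; rewrite mulrA.
  - move=> k i omega km _; rewrite /trunc_drift; case: ifPn => [h|_]; last by rewrite normr0.
    by have [h1 _] := hC _ h; rewrite (le_trans (h1 i))// ler_norm.
  - move=> k i j omega km _; rewrite /trunc_diffusion; case: ifPn => [h|_]; last first.
      by rewrite mulr0 normr0.
    have [_ h1] := hC _ h; rewrite normrM (gtr0_norm e1).
    by rewrite (le_trans _ (ler_norm C))// (le_trans _ (h1 i j))// ler_piMl.
  - move=> k omega km _; rewrite addr0 dyadic_incr.
    rewrite -/(sqnorm (euler k omega)); set y := euler k omega.
    have [h|h] := boolP (sqnorm y <= N); rewrite /trunc_drift /trunc_diffusion ?h ?(negbTE h); last first.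
      rewrite big1 ?mulr0; last by move=> i _; rewrite mulr0.
      rewrite big1 ?mulr0; last by move=> i _; rewrite expr0n.
      rewrite big1 ?mulr0 ?addr0; last first.
        by move=> i _; rewrite big1// => j _; rewrite expr0n.
      by rewrite mulr_ge0// addr_ge0 ?sqnorm_ge0// mulr_ge0// sqr_ge0.
    have [hb1 _] := hC _ h.
    have h1 : \sum_(i < r) b y i 0 ^+ 2 <= r%:R * C ^+ 2.
      rewrite -[X in X%:R * _]card_ord mulr_natl -sumr_const; apply: ler_sum => i _.
      rewrite -(real_normK (num_real (b y i 0))) ler_pXn2r// nnegrE//.
      exact: le_trans (hb1 i).
    have h2 : T / (2 ^ mesh)%:R * \sum_(i < r) b y i 0 ^+ 2 <= 1.
      apply: le_trans hmesh; apply: ler_wpM2l => //.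
      by rewrite divr_ge0// ltW.
    have -> : \sum_(i < r) \sum_(j < l) (eps * sigma y i j) ^+ 2 =
        eps ^+ 2 * \sum_(i < r) \sum_(j < l) sigma y i j ^+ 2.
      rewrite mulr_sumr; apply: eq_bigr => i _; rewrite mulr_sumr.
      by apply: eq_bigr => j _; rewrite exprMn.
    have h3 := growth y; rewrite /edot in h3.
    have h4 : eps ^+ 2 * (\sum_(i < r) \sum_(j < l) sigma y i j ^+ 2) <=
        \sum_(i < r) \sum_(j < l) sigma y i j ^+ 2.
      rewrite ler_piMl//; last by rewrite expr_le1// ltW.
      by apply: sumr_ge0 => i _; apply: sumr_ge0 => j _; exact: sqr_ge0.
    have y0 := sqnorm_ge0 y.
    by lra.
  - rewrite big1// => k _.
    by rewrite integral0_eq ?mule0.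
  - by rewrite addr_ge0// mulr_ge0// sqr_ge0.
rewrite addr0 in main; apply: le_trans main; apply: le_measure; rewrite ?inE//.
  apply: bigcup_measurable => k /= km; apply: measurableI => //.
  apply: measurable_lt_set; apply: measurable_funD => //.
  apply: measurable_sum => i; apply: measurable_funX.
  apply: (adapted_at_measurable hF (g_in k.+1 km)).
  by apply: (adapted_at_coord hF _ (g_in k.+1 km)); exact: euler_adapted.
move=> omega [[|k] /= km lam]; first by move: lam; rewrite /= ltNge xlam.
exists k => //; split => //=; apply: lt_le_trans lam _.
by rewrite lerDr.
Qed.

End scheme.

(** * Coefficients along continuous paths *)
Section local_lipschitz.
Context {R : realType} {r : nat}.
Implicit Types (phi : 'cV[R]_r -> R) (y z : 'cV[R]_r).

Definition locally_lipschitz phi := forall N, exists2 K, 0 <= K &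
  forall y z, sqnorm y <= N -> sqnorm z <= N ->
    `|phi y - phi z| <= K * \sum_i `|y i 0 - z i 0|.

Lemma enorm_le_sum y : enorm y <= \sum_i `|y i 0|.
Proof.
have s0 : 0 <= \sum_i `|y i 0| by apply: sumr_ge0.
rewrite /enorm edot_sqnorm -[leRHS](ger0_norm s0) -sqrtr_sqr ler_wsqrtr//.
exact: sqr_sum_le.
Qed.

Lemma coef_locally_lipschitz l (b : 'cV[R]_r -> 'cV[R]_r)
    (sigma : 'cV[R]_r -> 'M[R]_(r, l)) :
  (forall N : R, exists L : R, forall y z : 'cV[R]_r,
     enorm y <= N -> enorm z <= N ->
     \sum_(i < r) `|b y i 0 - b z i 0|
       + \sum_(i < r) \sum_(j < l) `|sigma y i j - sigma z i j|
       <= L * enorm (y - z)) ->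
  (forall i, locally_lipschitz (fun y => b y i 0)) /\
  (forall i j, locally_lipschitz (fun y => sigma y i j)).
Proof.
move=> lip.
have key (phi : 'cV[R]_r -> R) : (forall y z, `|phi y - phi z| <=
    \sum_(i < r) `|b y i 0 - b z i 0|
      + \sum_(i < r) \sum_(j < l) `|sigma y i j - sigma z i j|) ->
    locally_lipschitz phi.
  move=> hphi N; have [L hL] := lip (Num.sqrt N); exists `|L| => // y z yN zN.
  apply: le_trans (hphi y z) _.
  have := hL y z; rewrite /enorm !edot_sqnorm !ler_wsqrtr// => /(_ isT isT) h.
  apply: le_trans h _; rewrite -edot_sqnorm -/(enorm _).
  apply: (@le_trans _ _ (`|L| * enorm (y - z))).
    by apply: ler_wpM2r; [exact: sqrtr_ge0|exact: ler_norm].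
  rewrite ler_wpM2l// (le_trans (enorm_le_sum _))//.
  by apply: ler_sum => i _; rewrite !mxE.
have A0 y z : 0 <= \sum_(i < r) `|b y i 0 - b z i 0| by apply: sumr_ge0.
have B0 y z : 0 <= \sum_(i < r) \sum_(j < l) `|sigma y i j - sigma z i j|.
  by apply: sumr_ge0 => i _; apply: sumr_ge0.
split=> [i|i j]; apply: key => y z.
  apply: le_trans (_ : _ <= \sum_(i < r) `|b y i 0 - b z i 0|) _; last by rewrite lerDl.
  by rewrite (bigD1 i)//= lerDl sumr_ge0.
apply: (@le_trans _ _ (\sum_(i < r) \sum_(j < l) `|sigma y i j - sigma z i j|)); last by rewrite lerDr.
rewrite (bigD1 i)//= (bigD1 j)//= -addrA lerDl addr_ge0 ?sumr_ge0// => k _.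
exact: sumr_ge0.
Qed.

Variable T : R.
Hypothesis T_gt0 : 0 < T.
Variable phi : 'cV[R]_r -> R.
Hypothesis phi_lip : locally_lipschitz phi.
Variable X : R -> 'cV[R]_r.
Hypothesis uX : forall i, unif_cont T (fun t => X t i 0).

Lemma path_bounded : exists B, 0 <= B /\ forall t i, 0 <= t <= T -> `|X t i 0| <= B.
Proof.
have /choice[M hM] : forall i, exists M, forall t, 0 <= t <= T -> `|X t i 0| <= M.
  by move=> i; exact: (unif_cont_bounded T_gt0).
exists (\sum_i `|M i|); split=> [|t i tT]; first exact: sumr_ge0.
rewrite (le_trans (hM i t tT))// (le_trans (ler_norm _))//.
by rewrite (bigD1 i)//= lerDl sumr_ge0.
Qed.

Lemma sqnorm_le_coord y B : 0 <= B -> (forall i, `|y i 0| <= B) -> sqnorm y <= r%:R * B ^+ 2.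
Proof.
move=> B0 hy; rewrite -[X in X%:R * _]card_ord mulr_natl -sumr_const; apply: ler_sum => i _.
by rewrite -(real_normK (num_real _)) ler_pXn2r// nnegrE.
Qed.

Lemma coef_unif_cont : unif_cont T (fun t => phi (X t)).
Proof.
have [B [B0 hB]] := path_bounded; have [K K0 hK] := phi_lip (r%:R * B ^+ 2).
apply: (@unif_cont_lip _ T _ (fun i t => X t i 0) _ K) => // s t sT tT.
by apply: hK; apply: sqnorm_le_coord => // i; exact: hB.
Qed.

(** The path is bounded, so the cut-off is eventually inactive and one Lipschitz
    constant applies. The frozen value is close to the path at the last grid
    time, and the path moves little from there on. *)
Lemma frozen_coef_cvg (v : nat -> nat -> 'cV[R]_r) (mesh : nat -> nat) (N : nat -> R) :
  (forall n, (n <= mesh n)%N) ->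
  (forall B, exists n0, forall n, (n0 <= n)%N -> B <= N n) ->
  (forall e, 0 < e -> exists n0, forall n k i, (n0 <= n)%N -> (k < 2 ^ mesh n)%N ->
     `|v n k i 0 - X (dyadic T (mesh n) k) i 0| <= e) ->
  forall e, 0 < e -> exists n0, forall n s, (n0 <= n)%N -> 0 <= s < T ->
    `|(if sqnorm (v n (dyadic_index T (mesh n) s)) <= N n then
         phi (v n (dyadic_index T (mesh n) s)) else 0) - phi (X s)| <= e.
Proof.
move=> hmesh hN hv e e0.
have [B [B0 hB]] := path_bounded.
have [K K0 hK] := phi_lip (r%:R * (B + 1) ^+ 2).
have e20 : 0 < e / 2 by rewrite divr_gt0.
have [delta d0 hd] := coef_unif_cont e20.
have d20 : 0 < delta / 2 by rewrite divr_gt0.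
have [q hq] := mesh_small T d20.
have [n1 hn1] := hN (r%:R * (B + 1) ^+ 2).
have q0 : 0 < K * r%:R + 1 by rewrite ltr_wpDl// mulr_ge0.
pose e' := Num.min 1 (e / 2 / (K * r%:R + 1)).
have e'0 : 0 < e' by rewrite lt_min ltr01/= divr_gt0.
have [n2 hn2] := hv e' e'0.
exists (maxn q (maxn n1 n2)) => n s; rewrite !geq_max => /and3P[qn n1n n2n] sT.
have [km ks] := dyadic_indexP T_gt0 (mesh n) sT.
set k := dyadic_index T (mesh n) s in km ks *; set t := dyadic T (mesh n) k in ks *.
have tT : 0 <= t <= T by apply: dyadic_in => //; exact: ltnW.
have vk i : `|v n k i 0 - X t i 0| <= e' by exact: hn2.
have e'1 : e' <= 1 by rewrite ge_min lexx.
have vB : sqnorm (v n k) <= r%:R * (B + 1) ^+ 2.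
  apply: sqnorm_le_coord => [|i]; first by rewrite addr_ge0.
  have -> : v n k i 0 = X t i 0 + (v n k i 0 - X t i 0) by ring.
  rewrite (le_trans (ler_normD _ _))// lerD//; first exact: hB.
  exact: le_trans (vk i) _.
have XB : sqnorm (X t) <= r%:R * (B + 1) ^+ 2.
  apply: sqnorm_le_coord => [|i]; first by rewrite addr_ge0.
  by rewrite (le_trans (hB t i tT))// lerDl.
rewrite (le_trans vB (hn1 n n1n)).
have -> : phi (v n k) - phi (X s) = (phi (v n k) - phi (X t)) + (phi (X t) - phi (X s)).
  by ring.
rewrite (le_trans (ler_normD _ _))// (splitr e) lerD//.
  apply: le_trans (hK _ _ vB XB) _.
  apply: (@le_trans _ _ (K * (r%:R * e'))).
    rewrite ler_wpM2l// -[X in X%:R * _]card_ord mulr_natl -sumr_const.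
    by apply: ler_sum.
  have h1 : e' * (K * r%:R + 1) <= e / 2 by rewrite -ler_pdivlMr// ge_min lexx orbT.
  by rewrite mulrA (le_trans _ h1)// [leRHS]mulrC ler_wpM2r ?(ltW e'0)// lerDl.
apply/ltW/hd => //; first by case/andP : sT => -> /ltW.
have /andP[h5 h6] := dyadic_dist ks.
rewrite distrC ger0_norm// (lt_le_trans h6)// (le_trans (hq _ (leq_trans qn (hmesh n))))//.
by rewrite ler_pdivrMr// ler_pMr// ler1n.
Qed.

End local_lipschitz.

Section time_integral.
Context {R : realType} {d : measure_display} {Omega : measurableType d}.
Variable T : R.
Hypothesis T_gt0 : 0 < T.
Local Notation mu := (@lebesgue_measure R).

Lemma unif_cont_integrable (h : R -> R) t : unif_cont T h -> 0 <= t <= T ->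
  mu.-integrable `[0, t] (EFin \o h).
Proof.
move=> uh /andP[t0 tT].
have ci : mu.-integrable `[0, T] (EFin \o h).
  apply: continuous_compact_integrable; first exact: segment_compact.
  exact: unif_cont_within.
apply: integrableS ci => //.
by move=> s /=; rewrite !in_itv/= => /andP[-> /le_trans]; apply.
Qed.

Lemma unif_cont_measurable (h : R -> R) : unif_cont T h -> measurable_fun `[0, T] h.
Proof.
move=> uh; apply/measurable_EFinP.
have : mu.-integrable `[0, T] (EFin \o h).
  by apply: unif_cont_integrable => //; rewrite lexx ltW.
by case/integrableP.
Qed.

Lemma integral_cell a c t : 0 <= a -> a <= c -> 0 <= t ->
  (\int[mu]_(s in `[0%R, t]) (\1_(`[a, c[%classic) s)%:E = (Num.min c t - Num.min a t)%:E)%E.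
Proof.
move=> a0 ac t0; rewrite integral_indic//=.
have [ct|tc] := ltP c t.
  have -> : `[a, c[%classic `&` `[0, t]%classic = `[a, c[%classic.
    apply/seteqP; split => s /=; rewrite !in_itv/=; first by case.
    by move=> /andP[h1 h2]; rewrite h1 h2 (le_trans a0 h1)/= (le_trans (ltW h2) (ltW ct)).
  by rewrite min_l ?(le_trans ac (ltW ct))// -lebesgue_measure_co.
have [at_|ta] := leP a t.
  have -> : `[a, c[%classic `&` `[0, t]%classic = `[a, c[ `&` `[a, t].
    apply/seteqP; split => s /=; rewrite !in_itv/= => -[/andP[h1 h2] /andP[h3 h4]].
      by rewrite h1 h2 h4.
    by rewrite h1 h2 h4 (le_trans a0 h1).
  apply/eqP; rewrite eq_le; apply/andP; split.
    apply: (@le_trans _ _ (mu `[a, t])).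
      by apply: le_measure; rewrite ?inE//; exact: measurableI.
    by rewrite lebesgue_measure_itv/= lte_fin; case: ltP => // h;
       rewrite lee_fin subr_ge0.
  rewrite -(lebesgue_measure_co at_); apply: le_measure; rewrite ?inE//.
    exact: measurableI.
  move=> s /=; rewrite !in_itv/= => /andP[h1 h2]; rewrite h1 (ltW h2).
  by rewrite (lt_le_trans h2 tc).
have -> : `[a, c[%classic `&` `[0, t]%classic = set0.
  apply/seteqP; split => s //=; rewrite !in_itv/= => -[/andP[h1 h2] /andP[h3 h4]].
  by have := le_lt_trans (le_trans h1 h4) ta; rewrite ltxx.
by rewrite measure0 subrr.
Qed.

Implicit Type f : step_process R Omega.

Lemma integrable_cell a c t : mu.-integrable `[0, t] (EFin \o (\1_(`[a, c[%classic) : R -> R)).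
Proof.
have m : measurable_fun `[0, t] (\1_(`[a, c[%classic) : R -> R) by exact: measurable_indic.
apply: measurable_bounded_integrable => //.
  have := lebesgue_measure_itv `[0, t]; rewrite /= => ->.
  by case: ifP => _; rewrite -?EFinB ltry.
exists 1; split => // M M1 s _ /=; rewrite indicE.
by rewrite (le_trans _ (ltW M1))//; case: (_ \in _); rewrite ?normr1 ?normr0.
Qed.

Lemma step_eval_integrable f omega t :
  mu.-integrable `[0, t] (EFin \o (fun s => step_eval f s omega)).
Proof.
rewrite (_ : _ \o _ = (fun s => \sum_(k < step_size f)
   ((step_val f k omega)%:E * (EFin \o (\1_(`[step_time f k, step_time f k.+1[%classic) : R -> R)) s))%E).
  apply: integrable_sum => // k _; apply: integrableZl => //.
  exact: integrable_cell.
by apply/funext => s; rewrite /= /step_eval -sumEFin.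
Qed.

Lemma step_integral_time f t omega : step_time f 0 = 0 -> step_increasing f -> 0 <= t ->
  step_integral (fun u _ => u) f t omega = \int[mu]_(s in `[0, t]) step_eval f s omega.
Proof.
move=> f0 finc t0; apply: EFin_inj; rewrite /Rintegral fineK; last first.
  by apply: integrable_fin_num => //; exact: step_eval_integrable.
rewrite /step_integral -sumEFin.
rewrite [RHS](_ : _ = (\int[mu]_(s in `[0%R, t]) \sum_(k < step_size f)
   ((step_val f k omega)%:E * (EFin \o (\1_(`[step_time f k, step_time f k.+1[%classic) : R -> R)) s))%E); last first.
  by apply: eq_integral => s _; rewrite /= /step_eval -sumEFin.
rewrite integral_sum//; last first.
  by move=> k; apply: integrableZl => //; exact: integrable_cell.
apply: eq_bigr => -[k kf] _ /=; rewrite integralZl//; last exact: integrable_cell.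
rewrite integral_cell//; last exact: ltW (finc k kf).
by apply: step_time_ge0 => //; exact: ltnW.
Qed.

Lemma step_integral_time_close f (h : R -> R) delta t omega :
  step_time f 0 = 0 -> step_increasing f -> 0 <= t <= T -> unif_cont T h ->
  (forall s, 0 <= s < T -> `|step_eval f s omega - h s| <= delta) ->
  `|step_integral (fun u _ => u) f t omega - \int[mu]_(s in `[0, t]) h s| <= T * delta.
Proof.
move=> f0 finc tT uh hf; have /andP[t0 tT'] := tT.
have d0 : 0 <= delta by apply: le_trans (hf 0 _); rewrite ?lexx.
rewrite step_integral_time//.
have ih := unif_cont_integrable uh tT; have is_ := step_eval_integrable f omega t.
rewrite -RintegralB//.
have iB : mu.-integrable `[0, t] (EFin \o (fun s => step_eval f s omega - h s)).
  rewrite (_ : _ \o _ = (fun s => (EFin \o (step_eval f)^~ omega) s - (EFin \o h) s)%E).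
    exact: integrableB.
  by apply/funext => s /=; rewrite EFinB.
have iBo : mu.-integrable `[0, t[ (EFin \o (fun s => step_eval f s omega - h s)).
  apply: integrableS iB => // s /=; rewrite !in_itv/= => /andP[-> /ltW].
  by [].
rewrite -Rintegral_itv_bndo_bndc//.
apply: le_trans (le_normr_Rintegral _ iBo) _ => //.
have [mt fin] : mu `[0, t[ = t%:E /\ (mu `[0%R, t[ < +oo)%E.
  by rewrite lebesgue_measure_co// subr0 ltry.
apply: (@le_trans _ _ (\int[mu]_(s in `[0, t[) cst delta s)).
  apply: le_Rintegral => //.
  - exact: (integrable_norm iBo).
  - apply/integrableP; split; first exact/measurable_EFinP.
    by rewrite /= integral_cst//= mt ltry.
  move=> s /=; rewrite in_itv/= => /andP[s0 st]; apply: hf.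
  by rewrite s0 (lt_le_trans st).
by rewrite Rintegral_cst//= mt mulrC ler_wpM2r.
Qed.

End time_integral.

(** * Comparison of Euler schemes of different levels *)
Section frozen_schemes.
Context {R : realType} {d : measure_display} {Omega : measurableType d}.
Variables (P : probability Omega R) (T : R) (F : R -> set_system Omega).
Hypotheses (T_gt0 : 0 < T) (hF : is_filtration T F).
Variables (r l : nat) (w : R -> Omega -> 'cV[R]_l).
Hypothesis hw : is_brownian P T F w.
Variables (b : 'cV[R]_r -> 'cV[R]_r) (sigma : 'cV[R]_r -> 'M[R]_(r, l)).
Hypotheses (hb : borel_fun b) (hsigma : borel_fun sigma).
Variables (x : 'cV[R]_r) (eps : R).
Hypothesis eps01 : 0 < eps <= 1.

Lemma dyadic_in_lt m k : (k < 2 ^ m)%N -> 0 <= dyadic T m k < T.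
Proof.
move=> km; have /andP[-> _] := dyadic_in T_gt0 (ltnW km).
by have := dyadic_lt T_gt0 m k (2 ^ m); rewrite dyadicT km => ->.
Qed.

Lemma bigcap_adapted m (A : nat -> set Omega) k :
  (forall q, (q < 2 ^ m)%N -> F (dyadic T m q) (A q)) -> (k < 2 ^ m)%N ->
  F (dyadic T m k) (\bigcap_(q in `I_k.+1) A q).
Proof.
move=> hA km; have kT := dyadic_in T_gt0 (ltnW km).
rewrite -(filtration_gE hF)//; apply: bigcap_measurable => [|q /= qk].
  by exists 0%N.
rewrite (filtration_gE hF)//; have qm : (q < 2 ^ m)%N := @leq_ltn_trans k q (2 ^ m) qk km.
have /andP[q0 _] := dyadic_in T_gt0 (ltnW qm); have /andP[_ kT'] := kT.
by apply: (filtration_le hF q0 _ kT' (hA q qm)); rewrite dyadic_le.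
Qed.

Lemma refined_adapted n m (v : nat -> Omega -> 'cV[R]_r) k : (n <= m)%N ->
  (forall q, (q < 2 ^ n)%N -> measurable_wrt (F (dyadic T n q)) (v q)) ->
  (k < 2 ^ m)%N -> measurable_wrt (F (dyadic T m k)) (v (dyadic_index T n (dyadic T m k))).
Proof.
move=> nm hv km; have kT := dyadic_in_lt km.
have [qn /andP[qk _]] := dyadic_indexP T_gt0 n kT.
move=> B bB; have /andP[q0 _] := dyadic_in T_gt0 (ltnW qn).
have /andP[_ kT'] := dyadic_in T_gt0 (ltnW km).
exact: (filtration_le hF q0 qk kT' (hv _ qn B bB)).
Qed.

(** On a finer grid the coefficients remain those frozen at the last point of the
    original grid, which is found by [dyadic_index]. *)
Lemma scheme_is_frozen N0 N n m v (G : nat -> set Omega) : (n <= m)%N -> N <= N0 ->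
  (forall q, (q < 2 ^ n)%N -> measurable_wrt (F (dyadic T n q)) (v q)) ->
  (forall k omega, (k < 2 ^ m)%N -> G k omega ->
     sqnorm (v (dyadic_index T n (dyadic T m k)) omega) <= N) ->
  is_frozen_scheme F w b sigma eps N (2 ^ m) (dyadic T m) G
    (fun k => v (dyadic_index T n (dyadic T m k)))
    (fun k i => scheme T w b sigma x eps N0 n v i (dyadic T m k))
    (fun k i j => scheme_mart T w sigma N0 n v i j (dyadic T m k)).
Proof.
move=> nm NN hv vN.
have nd k : no_dyadic_between T n (dyadic T m k) (dyadic T m k.+1).
  by move=> q _; rewrite (dyadic_refine _ _ nm) dyadic_lt// dyadic_le.
have le k : dyadic T m k <= dyadic T m k.+1 by rewrite dyadic_le.
split.
- by move=> k km; exact: refined_adapted.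
- by move=> k i km; apply: (scheme_adapted T_gt0 hF hw hb hsigma) => //; exact: dyadic_in.
- by move=> k i j km; apply: (scheme_mart_adapted T_gt0 hF hw hsigma) => //; exact: dyadic_in.
- move=> k i omega km Gk; rewrite (scheme_piece T_gt0 _ _ _ _ _ _ _ _ _ (dyadic_in_lt km) (le k) (nd k)).
  have vle := le_trans (vN k omega km Gk) NN.
  by rewrite /trunc_drift /trunc_diffusion vle.
- split=> [k i j omega km Gk|]; last exact: vN.
  rewrite (scheme_mart_piece T_gt0 _ _ _ _ _ _ _ (dyadic_in_lt km) (le k) (nd k)).
  have vle := le_trans (vN k omega km Gk) NN.
  by rewrite /trunc_diffusion vle.
Qed.

Local Notation EU := (euler T w b sigma x eps).
Local Notation XX N n := (scheme T w b sigma x eps N n (EU N n)).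
Local Notation MM N n := (scheme_mart T w sigma N n (EU N n)).

(** The mean squared displacement of a scheme within a cell of length h, when its
    coefficients are bounded by C: each coordinate contributes C^2 h^2 through
    the drift and 2 h l C^2 through the noise. *)
Definition freezing_rate (C h : R) : R := r%:R * C ^+ 2 * (h ^+ 2 + 2 * h * l%:R).

Lemma euler_freezing N n C s : coef_bounded_on b sigma N C -> 0 <= s < T ->
  (\int[P]_omega (\sum_i (XX N n i s omega
      - EU N n (dyadic_index T n s) omega i 0) ^+ 2)%:E
    <= (freezing_rate C (T / (2 ^ n)%:R))%:E)%E.
Proof.
move=> hC sT; have [qn qs] := dyadic_indexP T_gt0 n sT.
set q := dyadic_index T n s in qn qs *; set t := dyadic T n q in qs.
have tT : 0 <= t <= T by apply: dyadic_in => //; exact: ltnW.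
have /andP[ts _] := qs; have /andP[s0 s1] := sT.
have /andP[h0 hh] := dyadic_dist qs; set h := T / _ in hh *.
have tT' : 0 <= t < T by case/andP: tT => -> _; exact: le_lt_trans s1.
have h_ge0 : 0 <= h by rewrite (le_trans h0)// ltW.
have [e0 e1] := andP eps01.
have hEU : measurable_wrt (F t) (EU N n q).
  by apply: (euler_adapted T_gt0 hF hw hb hsigma); exact: ltnW.
have E omega i : XX N n i s omega - EU N n q omega i 0 =
   trunc_drift b N (EU N n q omega) i * (s - t) +
   \sum_j (eps * trunc_diffusion sigma N (EU N n q omega) i j) * increment w t s j omega.
  rewrite (scheme_piece T_gt0 _ _ _ _ _ _ _ _ _ tT' ts); last first.
    move=> k _; rewrite dyadic_lt// => qk; have /andP[_ h2] := qs.
    by apply: le_trans (ltW h2) _; rewrite dyadic_le.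
  rewrite (euler_scheme T_gt0) ?(ltnW qn)// dyadic_index_dyadic// mulr_sumr.
  rewrite (eq_bigr (fun j => eps * trunc_diffusion sigma N (EU N n q omega) i j *
     increment w t s j omega)); last by move=> j _; rewrite mulrA.
  by ring.
under eq_integral do under eq_bigr do rewrite E.
have bd omega i : `|trunc_drift b N (EU N n q omega) i| <= `|C|.
  rewrite /trunc_drift; case: ifPn => [hn|_]; last by rewrite normr0.
  by have [h1 _] := hC _ hn; rewrite (le_trans (h1 i))// ler_norm.
have bs omega i j : `|eps * trunc_diffusion sigma N (EU N n q omega) i j| <= `|C|.
  rewrite /trunc_diffusion; case: ifPn => [hn|_]; last by rewrite mulr0 normr0.
  have [_ h1] := hC _ hn; rewrite normrM (gtr0_norm e0) (le_trans _ (ler_norm C))//.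
  by rewrite (le_trans _ (h1 i j))// ler_piMl.
apply: le_trans (@one_step _ _ _ P T F hF l w hw 'I_r t s setT
  (fun i omega => trunc_drift b N (EU N n q omega) i * (s - t))
  (fun i j omega => eps * trunc_diffusion sigma N (EU N n q omega) i j)
  (`|C| * (1 + h)) _ _ _ _ _ _ _ _) _.
- by case/andP: tT.
- by [].
- exact: ltW.
- by rewrite -(filtration_gE hF)//; exact: measurableT.
- by move=> i; apply: measurable_funM => //; exact: (trunc_drift_adapted hF hb).
- by move=> i j; apply: measurable_funM => //; exact: (trunc_diffusion_adapted hF hsigma).
- move=> i omega _; rewrite normrM ler_pM// (ger0_norm h0).
  by rewrite (le_trans (ltW hh))// lerDr.
- by move=> i j omega _; rewrite (le_trans (bs omega i j))// ler_peMr// lerDl.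
apply: (@le_trans _ _ (\int[P]_omega (freezing_rate C h)%:E)%E); last first.
  by rewrite integral_cst//= [P setT]probability_setT mule1.
have sqb (u : R) : `|u| <= `|C| -> u ^+ 2 <= C ^+ 2.
  by move=> uC; rewrite -[leLHS](real_normK (num_real u)) -[leRHS](real_normK (num_real C)) ler_pXn2r// nnegrE.
have ts0 : 0 <= 2 * (s - t) by rewrite mulr_ge0.
apply: ge0_le_integral => //.
- move=> omega _; rewrite lee_fin sumr_ge0// => i _; rewrite addr_ge0 ?sqr_ge0// mulr_ge0//.
  by apply: sumr_ge0 => j _; exact: sqr_ge0.
- apply/measurable_EFinP; apply: (adapted_at_measurable hF tT).
  apply: measurable_sum => i; apply: measurable_funD.
    by apply: measurable_funX; apply: measurable_funM => //; exact: (trunc_drift_adapted hF hb).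
  apply: measurable_funM => //; apply: measurable_sum => j; apply: measurable_funX.
  by apply: measurable_funM => //; exact: (trunc_diffusion_adapted hF hsigma).
move=> omega _; rewrite lee_fin.
have -> : freezing_rate C h = \sum_(i < r) (C ^+ 2 * h ^+ 2 + C ^+ 2 * (2 * h * l%:R)).
  by rewrite sumr_const card_ord -[RHS]mulr_natl -mulrDr /freezing_rate mulrA.
apply: ler_sum => i _; rewrite lerD//.
  rewrite exprMn ler_pM ?sqr_ge0//; first exact: sqb.
  by rewrite ler_pXn2r ?nnegrE// ltW.
rewrite -(mulrA 2 h) mulrCA -(mulrA 2) ler_wpM2l//.
apply: (@le_trans _ _ ((s - t) * \sum_(j < l) C ^+ 2)).
  by apply: ler_wpM2l => //; apply: ler_sum => j _; exact: sqb.
rewrite sumr_const card_ord -[C ^+ 2 *+ l]mulr_natl [X in _ <= X](_ : _ = h * (l%:R * C ^+ 2)); last by ring.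
have lC : 0 <= l%:R * C ^+ 2 by rewrite mulr_ge0// sqr_ge0.
exact: ler_wpM2r lC _ _ (ltW hh).
Qed.

Definition pair_dist N1 n1 N2 n2 (t : R) (omega : Omega) : R :=
  \sum_i (XX N1 n1 i t omega - XX N2 n2 i t omega) ^+ 2
   + \sum_i \sum_j (MM N1 n1 i j t omega - MM N2 n2 i j t omega) ^+ 2.

Lemma pair_dist_measurable N1 n1 N2 n2 t lambda : 0 <= t <= T ->
  measurable [set omega | lambda < pair_dist N1 n1 N2 n2 t omega].
Proof.
move=> tT; apply: measurable_lt_set; apply: (adapted_at_measurable hF tT).
have hX N n i : adapted_at F t (XX N n i t).
  apply: (scheme_adapted T_gt0 hF hw hb hsigma) => // k kn.
  by apply: (euler_adapted T_gt0 hF hw hb hsigma); exact: ltnW.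
have hM N n i j : adapted_at F t (MM N n i j t).
  apply: (scheme_mart_adapted T_gt0 hF hw hsigma) => // k kn.
  by apply: (euler_adapted T_gt0 hF hw hb hsigma); exact: ltnW.
apply: measurable_funD; apply: measurable_sum => i.
  by apply: measurable_funX; apply: measurable_funB; exact: hX.
by apply: measurable_sum => j; apply: measurable_funX; apply: measurable_funB; exact: hM.
Qed.

Variable K : R.
Hypothesis growth : forall y : 'cV[R]_r,
  edot y (b y) + \sum_(i < r) \sum_(j < l) (sigma y i j) ^+ 2 <= K ^+ 2 * (1 + sqnorm y).

Definition growth_bound : R := expR ((2 * K ^+ 2 + 1) * T) * (1 + sqnorm x).

(** Let G k be the event that both frozen values have stayed in the ball of
    squared radius N up to index k. While G holds the comparison applies; if it
    fails then one of the schemes has left the ball, which is unlikely. *)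
Lemma euler_pair N1 n1 C1 N2 n2 C2 N L m lambda : N <= N1 -> N <= N2 -> 0 < N ->
  coef_bounded_on b sigma N1 C1 -> coef_bounded_on b sigma N2 C2 ->
  sq_lipschitz_on b sigma N L -> 0 <= L -> (n1 <= m)%N -> (n2 <= m)%N ->
  T / (2 ^ n1)%:R * (r%:R * C1 ^+ 2) <= 1 -> T / (2 ^ n2)%:R * (r%:R * C2 ^+ 2) <= 1 ->
  0 < lambda ->
  (P (\bigcup_(k in `I_(2 ^ m)) [set omega |
        (lambda < pair_dist N1 n1 N2 n2 (dyadic T m k.+1) omega)%R]) <=
   (expR ((1 + comparison_rate T L) * T) * (comparison_rate T L *
      (T * (freezing_rate C1 (T / (2 ^ n1)%:R) + freezing_rate C2 (T / (2 ^ n2)%:R)))) / lambda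
    + (growth_bound / N + growth_bound / N))%:E)%E.
Proof.
move=> NN1 NN2 N0 hC1 hC2 hL L0 n1m n2m h1 h2 lam0.
have ad N' n : forall q, (q < 2 ^ n)%N -> measurable_wrt (F (dyadic T n q)) (EU N' n q).
  by move=> q qn; apply: (euler_adapted T_gt0 hF hw hb hsigma); exact: ltnW.
pose v1 k := EU N1 n1 (dyadic_index T n1 (dyadic T m k)).
pose v2 k := EU N2 n2 (dyadic_index T n2 (dyadic T m k)).
pose A k := [set omega | sqnorm (v1 k omega) <= N] `&` [set omega | sqnorm (v2 k omega) <= N].
pose G k := \bigcap_(q in `I_k.+1) A q.
have FA q : (q < 2 ^ m)%N -> F (dyadic T m q) (A q).
  move=> qm; have qT := dyadic_in T_gt0 (ltnW qm).
  rewrite -(filtration_gE hF)//; apply: measurableI; rewrite (filtration_gE hF)//;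
    apply: (ball_adapted hF) => //.
    by apply: (@refined_adapted n1 m (EU N1 n1)) => //; exact: ad.
  by apply: (@refined_adapted n2 m (EU N2 n2)) => //; exact: ad.
have FG k : (k < 2 ^ m)%N -> F (dyadic T m k) (G k) by exact: bigcap_adapted.
have GA k omega : G k omega -> A k omega by move=> /(_ k); apply; rewrite /= ltnSn.
have Gd k : (k.+1 < 2 ^ m)%N -> G k.+1 `<=` G k.
  by move=> _ omega Gk q /= qk; apply: Gk => /=; exact: ltnW.
have le k : (k < 2 ^ m)%N -> dyadic T m k <= dyadic T m k.+1 by rewrite dyadic_le.
have gin k : (k <= 2 ^ m)%N -> 0 <= dyadic T m k <= T by exact: dyadic_in.
have hCN : coef_bounded_on b sigma N C1 by move=> y yN; apply: hC1; exact: le_trans yN NN1.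
have S1 : is_frozen_scheme F w b sigma eps N (2 ^ m) (dyadic T m) G v1
    (fun k i => XX N1 n1 i (dyadic T m k)) (fun k i j => MM N1 n1 i j (dyadic T m k)).
  apply: scheme_is_frozen => //; first exact: ad.
  by move=> k omega km /GA[].
have S2 : is_frozen_scheme F w b sigma eps N (2 ^ m) (dyadic T m) G v2
    (fun k i => XX N2 n2 i (dyadic T m k)) (fun k i j => MM N2 n2 i j (dyadic T m k)).
  apply: scheme_is_frozen => //; first exact: ad.
  by move=> k omega km /GA[].
set fr1 := freezing_rate C1 _; set fr2 := freezing_rate C2 _.
have mfe N' n k : (n <= m)%N -> (k < 2 ^ m)%N -> measurable_fun setT (freezing_error
    (fun k => EU N' n (dyadic_index T n (dyadic T m k))) (fun k i => XX N' n i (dyadic T m k)) k).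
  move=> nm km; have kT := gin k (ltnW km); apply: (adapted_at_measurable hF kT).
  apply: measurable_sum => i; apply: measurable_funX; apply: measurable_funB.
    by apply: (scheme_adapted T_gt0 hF hw hb hsigma) => //; exact: ad.
  apply: (adapted_at_coord hF _ kT).
  by apply: (@refined_adapted n m (EU N' n)) => //; exact: ad.
have mG k : (k < 2 ^ m)%N -> measurable (G k).
  by move=> km; apply: (filtration_measurable hF (gin k (ltnW km))); exact: FG.
have fe_ge0 v U k omega : 0 <= @freezing_error R d Omega r v U k omega.
  by apply: sumr_ge0 => i _; exact: sqr_ge0.
have al_bnd : (\sum_(k < 2 ^ m) ((dyadic T m k.+1 - dyadic T m k)%:E *
   \int[P]_(omega in G k) (freezing_error v1 (fun k i => XX N1 n1 i (dyadic T m k)) k omega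
      + freezing_error v2 (fun k i => XX N2 n2 i (dyadic T m k)) k omega)%:E)
   <= (T * (fr1 + fr2))%:E)%E.
  apply: (@le_trans _ _ (\sum_(k < 2 ^ m) (T / (2 ^ m)%:R * (fr1 + fr2))%:E)%E); last first.
    rewrite sumEFin sumr_const card_ord lee_fin -[_ *+ _]mulr_natl.
    rewrite -mulrA [(_^-1) * _]mulrC mulrCA [_ * (_ / _)]mulrCA divff ?mulr1//.
  apply: lee_sum => -[k km] _ /=; rewrite dyadic_incr [leRHS]EFinM.
  apply: lee_wpmul2l; first by rewrite lee_fin divr_ge0// ltW// pow2_gt0.
  have kT := dyadic_in_lt km.
  have m1 := mfe N1 n1 k n1m km; have m2 := mfe N2 n2 k n2m km.
  apply: (@le_trans _ _ (\int[P]_omega (freezing_error v1 (fun k i => XX N1 n1 i (dyadic T m k)) k omega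
      + freezing_error v2 (fun k i => XX N2 n2 i (dyadic T m k)) k omega)%:E)%E).
    apply: ge0_subset_integral => //; first exact: mG.
      by apply/measurable_EFinP; exact: measurable_funD.
    by move=> omega _; rewrite lee_fin addr_ge0.
  under eq_integral do rewrite EFinD.
  rewrite ge0_integralD//; last 4 first.
  - by move=> omega _; rewrite lee_fin.
  - exact/measurable_EFinP.
  - by move=> omega _; rewrite lee_fin.
  - exact/measurable_EFinP.
  rewrite EFinD; apply: leeD; exact: euler_freezing.
have cmp := comparison hF hw hb hsigma eps01 L0 hL hCN le gin FG Gd S1 S2.
have {}cmp : (P (\bigcup_(k in `I_(2 ^ m)) (G k `&` [set omega |
      (lambda < pair_dist N1 n1 N2 n2 (dyadic T m k.+1) omega)%R])) <=
   (expR ((1 + comparison_rate T L) * T) * (comparison_rate T L * (T * (fr1 + fr2))) / lambda)%:E)%E.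
  apply: cmp => //.
  - by move=> i omega; rewrite dyadic0 !(scheme0 T_gt0).
  - by move=> i j omega; rewrite dyadic0 !(scheme_mart0 T_gt0).
have mp k : (k < 2 ^ m)%N -> measurable [set omega |
      (lambda < pair_dist N1 n1 N2 n2 (dyadic T m k.+1) omega)%R].
  by move=> km; apply: pair_dist_measurable; exact: gin.
have mE N' n : measurable (\bigcup_(k in `I_(2 ^ n).+1) [set omega | (N < sqnorm (EU N' n k omega))%R]).
  apply: bigcup_measurable => k /= km; apply: measurable_lt_set; apply: measurable_sum => i.
  apply: measurable_funX; have kT := dyadic_in T_gt0 (km : (k <= 2 ^ n)%N).
  apply: (adapted_at_measurable hF kT); apply: (adapted_at_coord hF _ kT).
  exact: (euler_adapted T_gt0 hF hw hb hsigma).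
have q1 := euler_nonexplosion T_gt0 hF hw hb hsigma x eps01 growth hC1 h1 N0.
have q2 := euler_nonexplosion T_gt0 hF hw hb hsigma x eps01 growth hC2 h2 N0.
rewrite !EFinD; apply: le_trans (leeD cmp (leeD q1 q2)).
have mBad : measurable (\bigcup_(k in `I_(2 ^ m)) (G k `&` [set omega |
      (lambda < pair_dist N1 n1 N2 n2 (dyadic T m k.+1) omega)%R])).
  by apply: bigcup_measurable => k km; apply: measurableI; [exact: mG|exact: mp].
set A0 := \bigcup_(k in _) (G k `&` _) in mBad *.
have mD1 := mE N1 n1; have mD2 := mE N2 n2.
set D1 := \bigcup_(k in `I_(2 ^ n1).+1) _ in mD1 *.
set D2 := \bigcup_(k in `I_(2 ^ n2).+1) _ in mD2 *.
have mU := measurableU _ _ mD1 mD2.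
apply: (@le_trans _ _ (P A0 + P (D1 `|` D2))%E); last first.
  by apply: leeD => //; exact: measureU2.
apply: (@le_trans _ _ (P (A0 `|` (D1 `|` D2)))); last exact: measureU2.
apply: le_measure; rewrite ?inE//; last 1 first.
- move=> omega [k /= km hk].
  have [Gk|nG] := pselect (G k omega); first by left; exists k.
  right; have [q [qk nA]] : exists q, (q <= k)%N /\ ~ A q omega.
    apply/not_existsP => h; apply: nG => q /= qk; apply: contrapT => nA.
    by apply: (h q).
  have qm : (q < 2 ^ m)%N := leq_ltn_trans qk km.
  move/not_andP : nA => [/negP|/negP]; rewrite -ltNge => nA; [left|right].
    exists (dyadic_index T n1 (dyadic T m q)) => //=.
    by have [] := dyadic_indexP T_gt0 n1 (dyadic_in_lt qm) => /ltnW.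
  exists (dyadic_index T n2 (dyadic T m q)) => //=.
  by have [] := dyadic_indexP T_gt0 n2 (dyadic_in_lt qm) => /ltnW.
- by apply: bigcup_measurable => k km; exact: mp.
- exact: measurableU.
Qed.

End frozen_schemes.

(** * Step processes converging along paths *)
Section step_convergence.
Context {R : realType} {d : measure_display} {Omega : measurableType d}.
Variables (P : probability Omega R) (T : R) (F : R -> set_system Omega).
Hypotheses (T_gt0 : 0 < T) (hF : is_filtration T F).
Local Notation mu := (@lebesgue_measure R).

(** The last point before s of a finer dyadic grid lies in the same cell of level
    n as s, and there the step process is constant. *)
Lemma dyadic_step_le n (u : nat -> Omega -> R) (h : R -> R) omega c : unif_cont T h ->
  (forall m k, (n <= m)%N -> (k < 2 ^ m)%N ->
     `|step_eval (dyadic_step T n u) (dyadic T m k) omega - h (dyadic T m k)| <= c) ->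
  forall s, 0 <= s < T -> `|step_eval (dyadic_step T n u) s omega - h s| <= c.
Proof.
move=> uh hc s sT; have [qn /andP[qs sq]] := dyadic_indexP T_gt0 n sT.
apply/ler_addgt0Pr => e e0; have [delta d0 hd] := uh e e0.
have d20 : 0 < delta / 2 by rewrite divr_gt0.
have [q hq] := mesh_small T d20; pose m := maxn n q.
have [km ks] := dyadic_indexP T_gt0 m sT.
set k := dyadic_index T m s in km ks; have nm : (n <= m)%N := leq_maxl _ _.
have kT := dyadic_in_lt T_gt0 km.
have idx : dyadic_index T n (dyadic T m k) = dyadic_index T n s.
  have [h1 /andP[h2 h3]] := dyadic_indexP T_gt0 n kT.
  have h4 : dyadic T n (dyadic_index T n s) <= dyadic T m k.
    case/andP: ks => ks1 ks2; move: qs ks2.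
    rewrite (dyadic_refine _ _ nm) => qs' /(le_lt_trans qs').
    by rewrite dyadic_lt// ltnS dyadic_le.
  have h5 : dyadic T m k < dyadic T n (dyadic_index T n s).+1.
    by apply: le_lt_trans sq; case/andP: ks.
  have := le_lt_trans h2 h5; have := le_lt_trans h4 h3.
  rewrite !dyadic_lt// !ltnS => h6 h7.
  by apply/eqP; rewrite eqn_leq h6 h7.
have := hc m k nm km; rewrite !dyadic_step_eval// idx => hk.
have hs : `|h (dyadic T m k) - h s| < e.
  apply: hd; first by case/andP: kT => -> /ltW.
    by case/andP: sT => -> /ltW.
  have /andP[h5 h6] := dyadic_dist ks.
  rewrite distrC ger0_norm//; apply: lt_le_trans h6 _; apply: le_trans (hq m _) _.
    exact: leq_maxr.
  by rewrite ler_pdivrMr// ler_pMr// ler1n.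
set v := u _ omega in hk *.
have -> : v - h s = (v - h (dyadic T m k)) + (h (dyadic T m k) - h s) by ring.
by rewrite (le_trans (ler_normD _ _))// lerD// ltW.
Qed.

Section step_vanish.
Variables (mesh : nat -> nat) (u : nat -> nat -> Omega -> R) (h : R -> Omega -> R).
Hypothesis hu : forall n k, (k < 2 ^ mesh n)%N -> adapted_at F (dyadic T (mesh n) k) (u n k).
Hypothesis hh : forall t, 0 <= t <= T -> adapted_at F t (h t).
Hypothesis good : {ae P, forall omega, unif_cont T (h ^~ omega) /\
   forall e, 0 < e -> exists n0, forall n s, (n0 <= n)%N -> 0 <= s < T ->
     `|step_eval (dyadic_step T (mesh n) (u n)) s omega - h s omega| <= e}.

Definition step_close c n (omega : Omega) := forall s, 0 <= s < T ->
  `|step_eval (dyadic_step T (mesh n) (u n)) s omega - h s omega| <= c.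

(** The exceptional events are dominated by events that look only at dyadic times
    and are therefore measurable, so that [vanish_ae] applies to them. *)
Lemma step_close_vanish c : 0 < c ->
  vanish P (fun n => ~` [set omega | unif_cont T (h ^~ omega) /\ step_close c n omega]).
Proof.
move=> c0.
pose D n := \bigcup_m \bigcup_(k in `I_(2 ^ m)) [set omega |
  c < `|step_eval (dyadic_step T (mesh n) (u n)) (dyadic T m k) omega - h (dyadic T m k) omega|].
have mD n : measurable (D n).
  apply: bigcupT_measurable => m; apply: bigcup_measurable => k /= km.
  have kT := dyadic_in T_gt0 (ltnW km).
  apply: measurable_lt_set; apply: measurableT_comp => //.
  apply: (adapted_at_measurable hF kT); apply: measurable_funB; last exact: hh.
  apply: (adapted_step_eval hF) => //=.
  - exact: dyadic0.
  - exact: dyadic_step_increasing.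
  - exact: hu.
have vD : vanish P D.
  apply: vanish_ae => //; apply: filterS good => omega [_ hom].
  have [n0 hn0] := hom c c0; exists n0 => n nn0 [m _ [k /= km]].
  by rewrite ltNge hn0//; exact: dyadic_in_lt.
have nQ : P.-negligible (~` [set omega | unif_cont T (h ^~ omega)]).
  by have : {ae P, forall omega, unif_cont T (h ^~ omega)} by apply: filterS good => omega [].
apply: vanish_sub (vanishU (vanish_negligible nQ) vD) => n omega nclose.
have [uh|] := pselect (unif_cont T (h ^~ omega)); last by left.
right; apply: contrapT => nD; apply: nclose; split => //.
apply: (dyadic_step_le uh) => m k _ km.
by rewrite leNgt; apply/negP => h1; apply: nD; exists m => //; exists k.
Qed.

Lemma step_cvg_prob0 :
  cvg_prob0 P (fun n omega => \int[mu]_(s in `[0%R, T])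
     ((step_eval (dyadic_step T (mesh n) (u n)) s omega - h s omega) ^+ 2)%:E)%E.
Proof.
apply/cvg_prob0P => delta d0.
pose c := Num.sqrt (delta / T).
have c0 : 0 < c by rewrite sqrtr_gt0 divr_gt0.
have Tc : T * c ^+ 2 = delta by rewrite sqr_sqrtr ?divr_ge0// 1?ltW// mulrC divfK// gt_eqF.
apply: vanish_sub (step_close_vanish c0) => n omega /= lt [uh close]; move: lt.
apply/negP; rewrite -leNgt.
have mf : measurable_fun `[0, T[ (fun s =>
    ((step_eval (dyadic_step T (mesh n) (u n)) s omega - h s omega) ^+ 2)%:E).
  apply/measurable_EFinP; apply: measurable_funX; apply: measurable_funB.
    by apply: measurable_funTS; exact: measurable_step_eval.
  apply: measurable_funS (unif_cont_measurable T_gt0 uh) => //.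
  by move=> s /=; rewrite !in_itv/= => /andP[-> /ltW].
rewrite -integral_itv_bndo_bndc//.
apply: (@le_trans _ _ (\int[mu]_(s in `[0%R, T[) (c ^+ 2)%:E)%E).
  apply: ge0_le_integral => //.
  - by move=> s _; rewrite lee_fin sqr_ge0.
  - move=> s /=; rewrite in_itv/= => sT; rewrite lee_fin.
    by rewrite -[leLHS](real_normK (num_real _)) ler_pXn2r ?nnegrE// ?close// ltW.
have mT : mu `[0, T[ = T%:E by rewrite lebesgue_measure_co ?(ltW T_gt0)// subr0.
by rewrite integral_cst//= mT -EFinM lee_fin mulrC Tc.
Qed.

End step_vanish.

Lemma ae_cvg_prob0 (Y : nat -> Omega -> R) (Z : Omega -> R) :
  (forall n, measurable_fun setT (Y n)) -> measurable_fun setT Z ->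
  {ae P, forall omega, forall e, 0 < e -> exists n0, forall n, (n0 <= n)%N ->
     `|Y n omega - Z omega| <= e} ->
  cvg_prob0 P (fun n omega => `|Y n omega - Z omega|%:E).
Proof.
move=> mY mZ good; apply/cvg_prob0P => delta d0; apply: vanish_ae => [n|].
  rewrite (_ : [set _ | _] = [set omega | delta < `|Y n omega - Z omega|]).
    apply: measurable_lt_set; apply: measurableT_comp => //.
    exact: measurable_funB.
  by apply/seteqP; split => omega /=; rewrite lte_fin.
apply: filterS good => omega /(_ delta d0)[n0 hn0]; exists n0 => n /hn0 h.
by rewrite /= lte_fin ltNge h.
Qed.

End step_convergence.

Section vector_paths.
Context {R : realType} {T : R}.

Lemma within_coord n (X : R -> 'cV[R]_n) : {within `[0, T], continuous X} ->
  forall i, {within `[0, T], continuous (fun t => X t i 0)}.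
Proof.
move=> /subspace_continuousP cX i; apply/subspace_continuousP => s sT.
apply: (continuous_cvg _ _ (cX s sT) : (fun v : 'cV[R]_n => v i 0) \o X @ _ --> _).
exact: coord_continuous.
Qed.

Lemma coord_within n (X : R -> 'cV[R]_n) : (forall i, unif_cont T (fun t => X t i 0)) ->
  {within `[0, T], continuous X}.
Proof.
move=> uX; apply/subspace_continuousP => s; rewrite /= in_itv/= => sT.
apply/cvgrPdist_lt => e e0.
have : forall i, exists delta, 0 < delta /\
  forall s t, 0 <= s <= T -> 0 <= t <= T -> `|s - t| < delta -> `|X s i 0 - X t i 0| < e.
  by move=> i; have [delta] := uX i e e0; exists delta.
move=> /choice[dl hdl].
apply/nbhs_ballP; exists (\big[Num.min/1]_i dl i) => /=.
  by elim/big_ind : _ => // [u v u0 v0|i _]; [rewrite lt_min u0|have [] := hdl i].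
move=> t st; rewrite /= in_itv/= => tT.
rewrite /Num.Def.normr/= mx_normrE; apply: bigmax_lt => // -[i j] _ /=.
rewrite !mxE (ord1 j); have [_ h] := hdl i; apply: h => //.
by apply: lt_le_trans st _; exact: bigmin_le_cond.
Qed.

End vector_paths.

Section path_integrals.
Context {R : realType} {T : R}.
Hypothesis T_gt0 : 0 < T.
Local Notation mu := (@lebesgue_measure R).

Lemma unif_cont_norm (f : R -> R) : unif_cont T f -> unif_cont T (fun t => `|f t|).
Proof.
move=> uf e e0; have [delta d0 hd] := uf e e0; exists delta => // s t sT tT st.
exact: le_lt_trans (ler_dist_dist _ _) (hd s t sT tT st).
Qed.

Lemma unif_cont_sqr_integral (h : R -> R) : unif_cont T h ->
  (\int[mu]_(s in `[0%R, T]) ((h s) ^+ 2)%:E < +oo)%E.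
Proof.
move=> uh; have [M hM] := unif_cont_bounded T_gt0 uh.
have M0 : 0 <= M by apply: le_trans (hM 0 _); rewrite ?lexx ?(ltW T_gt0).
apply: (@le_lt_trans _ _ (\int[mu]_(s in `[0%R, T]) (M ^+ 2)%:E)%E).
  apply: ge0_le_integral => //.
  - by move=> s _; rewrite lee_fin sqr_ge0.
  - apply/measurable_EFinP; apply: measurable_funX; exact: unif_cont_measurable.
  - move=> s /=; rewrite in_itv/= => sT; rewrite lee_fin.
    by rewrite -[leLHS](real_normK (num_real _)) ler_pXn2r ?nnegrE// hM.
have mT : mu `[0, T] = T%:E by rewrite lebesgue_measure_itv/= lte_fin T_gt0 -EFinB subr0.
by rewrite integral_cst//= mT -EFinM ltry.
Qed.

End path_integrals.

(** * Existence *)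
Section existence.
Context {R : realType} {d : measure_display} {Omega : measurableType d}.
Variables (P : probability Omega R) (T : R) (F : R -> set_system Omega).
Hypotheses (T_gt0 : 0 < T) (hF : is_filtration T F).
Variables (r l : nat) (w : R -> Omega -> 'cV[R]_l).
Hypothesis hw : is_brownian P T F w.
Variables (b : 'cV[R]_r -> 'cV[R]_r) (sigma : 'cV[R]_r -> 'M[R]_(r, l)).
Hypotheses (hb : borel_fun b) (hsigma : borel_fun sigma).
Variables (x : 'cV[R]_r) (eps : R).
Hypothesis eps01 : 0 < eps <= 1.
Variable K : R.
Hypothesis growth : forall y : 'cV[R]_r,
  edot y (b y) + \sum_(i < r) \sum_(j < l) (sigma y i j) ^+ 2 <= K ^+ 2 * (1 + sqnorm y).
Hypothesis lipschitz : forall N : R, exists L : R, forall y z : 'cV[R]_r,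
  enorm y <= N -> enorm z <= N ->
  \sum_(i < r) `|b y i 0 - b z i 0|
    + \sum_(i < r) \sum_(j < l) `|sigma y i j - sigma z i j|
    <= L * enorm (y - z).

Local Notation EU := (euler T w b sigma x eps).
Local Notation XX N n := (scheme T w b sigma x eps N n (EU N n)).
Local Notation MM N n := (scheme_mart T w sigma N n (EU N n)).
Local Notation pair_dist := (pair_dist T w b sigma x eps).

Lemma freezing_rate_small C c : 0 < c ->
  exists q, forall n, (q <= n)%N -> @freezing_rate R r l C (T / (2 ^ n)%:R) <= c.
Proof.
move=> c0; pose D := r%:R * C ^+ 2 * (1 + 2 * l%:R) + 1.
have A0 : 0 <= r%:R * C ^+ 2 by rewrite mulr_ge0// sqr_ge0.
have D0 : 0 < D by rewrite ltr_wpDl// mulr_ge0// addr_ge0// mulr_ge0.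
have h0 : 0 < Num.min 1 (c / D) by rewrite lt_min ltr01 divr_gt0.
have [q hq] := mesh_small T h0; exists q => n /hq.
set h := T / _ => hle.
have hpos : 0 <= h by rewrite divr_ge0// ltW.
have h1 : h <= 1 by rewrite (le_trans hle)// ge_min lexx.
have h2 : h * D <= c by rewrite -ler_pdivlMr// (le_trans hle)// ge_min lexx orbT.
apply: le_trans h2; rewrite /freezing_rate.
apply: (@le_trans _ _ (r%:R * C ^+ 2 * (h * (1 + 2 * l%:R)))).
  rewrite ler_wpM2l// mulrDr mulr1 lerD//.
    by rewrite expr2 ler_piMl.
  by rewrite (mulrC 2) mulrA.
by rewrite /D mulrCA ler_wpM2l// lerDl.
Qed.

(** The bounds and Lipschitz constants of the coefficients on the balls may grow
    arbitrarily fast with n. The meshes are chosen after these constants, fine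
    enough to make up for them. *)
Lemma euler_levels : exists mesh : nat -> nat, forall n, (n <= mesh n)%N /\
  forall m, (mesh n <= m)%N -> (mesh n.+1 <= m)%N ->
  (P (\bigcup_(k in `I_(2 ^ m)) [set omega |
     (4 ^- n < pair_dist (4 ^+ n) (mesh n) (4 ^+ n.+1) (mesh n.+1) (dyadic T m k.+1) omega)%R])
   <= ((1 + 2 * growth_bound T x K) * 4 ^- n)%:E)%E.
Proof.
have four n : 0 < 4 ^+ n :> R by rewrite exprn_gt0.
have /choice[C hC] : forall n, exists C, coef_bounded_on b sigma (4 ^+ n) C.
  by move=> n; apply: (bounded_on_balls lipschitz); exact: ltW.
have /choice[L hL] : forall n, exists L, 0 <= L /\ sq_lipschitz_on b sigma (4 ^+ n) L.
  by move=> n; have [L] := lipschitz_on_balls lipschitz (4 ^+ n); exists L.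
pose D n := expR ((1 + comparison_rate T (L n)) * T) * (comparison_rate T (L n) * T)
   * 2 * 4 ^+ n * 4 ^+ n + 1.
have rate0 n : 0 <= comparison_rate T (L n).
  by have [L0 _] := hL n; rewrite mulr_ge0// mulr_ge0// addr_ge0// ltW.
have D0 n : 0 < D n.
  have f0 := ltW (four n); have e0 := expR_ge0 ((1 + comparison_rate T (L n)) * T).
  rewrite /D ltr_wpDl//; do 5![rewrite mulr_ge0//]; exact: ltW.
(* Mesh n enters two comparisons, with the levels n - 1 and n + 1. *)
have /choice[mesh hmesh] : forall n, exists q, (n <= q)%N /\
    T / (2 ^ q)%:R * (r%:R * C n ^+ 2) <= 1 /\
    @freezing_rate R r l (C n) (T / (2 ^ q)%:R) <= (D n + D n.-1)^-1.
  move=> n; have c0 : 0 < (D n + D n.-1)^-1 by rewrite invr_gt0 addr_gt0.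
  have [q1 hq1] := freezing_rate_small (C n) c0.
  have a0 : 0 <= r%:R * C n ^+ 2 by rewrite mulr_ge0// sqr_ge0.
  have b0 : 0 < (r%:R * C n ^+ 2 + 1)^-1 by rewrite invr_gt0 ltr_wpDl.
  have [q2 hq2] := mesh_small T b0.
  exists (maxn n (maxn q1 q2)); rewrite leq_max leqnn; split => //; split; last first.
    by apply: hq1; rewrite leq_max leq_maxl orbT.
  apply: (@le_trans _ _ ((r%:R * C n ^+ 2 + 1)^-1 * (r%:R * C n ^+ 2))).
    by rewrite ler_wpM2r// hq2// leq_max leq_maxr orbT.
  by rewrite mulrC ler_pdivrMr ?ltr_wpDl// mul1r lerDl.
exists mesh => n; split; first by have [] := hmesh n.
move=> m m1 m2; have [_ [h1 f1]] := hmesh n; have [_ [h2 f2]] := hmesh n.+1.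
have [L0 hLn] := hL n; have l0 : 0 < 4 ^- n :> R by rewrite invr_gt0.
have le4 : 4 ^+ n <= 4 ^+ n.+1 :> R by rewrite ler_eXn2l// ltr1n.
apply: le_trans (euler_pair T_gt0 hF hw hb hsigma x eps01 growth (lexx _) le4 (four n)
  (hC n) (hC n.+1) hLn L0 m1 m2 h1 h2 l0) _.
rewrite lee_fin [leRHS]mulrDl mul1r lerD//; last by lra.
rewrite ler_pdivrMr//.
set fr1 := freezing_rate r l (C n) _ in f1 *; set fr2 := freezing_rate r l (C n.+1) _ in f2 *.
have inv_le (a c : R) : 0 < a -> 0 < c -> (a + c)^-1 <= a^-1.
  by move=> a0 c0; rewrite lef_pV2 ?posrE ?addr_gt0// lerDl ltW.
have f1' : fr1 <= (D n)^-1 by apply: le_trans f1 _; exact: inv_le.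
have f2' : fr2 <= (D n)^-1.
  by apply: le_trans f2 _; rewrite addrC; exact: (inv_le (D n) (D n.+1)).
set E := expR _; set Q := comparison_rate _ _.
have EQ : 0 <= E * (Q * T) by exact: mulr_ge0 (expR_ge0 _) (mulr_ge0 (rate0 n) (ltW T_gt0)).
apply: (@le_trans _ _ (E * (Q * T) * (2 * (D n)^-1))).
  rewrite (_ : E * (Q * (T * (fr1 + fr2))) = E * (Q * T) * (fr1 + fr2)); last by ring.
  by apply: ler_wpM2l => //; lra.
rewrite (mulrA (E * (Q * T)) 2) ler_pdivrMr// -invfM [leRHS]mulrC ler_pdivlMr ?mulr_gt0//.
have -> : D n = E * (Q * T) * 2 * (4 ^+ n * 4 ^+ n) + 1 by rewrite mulrA.
by rewrite lerDl.
Qed.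

Lemma geometric_sum_le n : \sum_(0 <= k < n) 4 ^- k <= 2 :> R.
Proof.
suff : \sum_(0 <= k < n) 4 ^- k <= 2 - 2 * 4 ^- n :> R.
  by move/le_trans; apply; rewrite gerBl mulr_ge0// invr_ge0 exprn_ge0.
elim: n => [|n IH]; first by rewrite big_nil expr0 invr1; lra.
rewrite big_nat_recr//= exprS invfM.
have : 0 < 4 ^- n :> R by rewrite invr_gt0 exprn_gt0.
move: (4 ^- n) IH => q; move: (\sum_(0 <= k < n) _) => S; lra.
Qed.

Section limit.
Variable mesh : nat -> nat.
Hypothesis mesh_ge : forall n, (n <= mesh n)%N.
Hypothesis mesh_pair : forall n m, (mesh n <= m)%N -> (mesh n.+1 <= m)%N ->
  (P (\bigcup_(k in `I_(2 ^ m)) [set omega |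
     (4 ^- n < pair_dist (4 ^+ n) (mesh n) (4 ^+ n.+1) (mesh n.+1) (dyadic T m k.+1) omega)%R])
   <= ((1 + 2 * growth_bound T x K) * 4 ^- n)%:E)%E.

Definition close_levels (omega : Omega) := exists n0, forall n m k,
  (n0 <= n)%N -> (mesh n <= m)%N -> (mesh n.+1 <= m)%N -> (k < 2 ^ m)%N ->
  pair_dist (4 ^+ n) (mesh n) (4 ^+ n.+1) (mesh n.+1) (dyadic T m k.+1) omega <= 4 ^- n.

(** The bound on the probability does not depend on the grid, hence it extends to
    the union over all dyadic grids, and the Borel-Cantelli lemma applies. *)
Lemma ae_close_levels : {ae P, forall omega, close_levels omega}.
Proof.
pose m0 n := maxn (mesh n) (mesh n.+1).
pose A n q := \bigcup_(k in `I_(2 ^ (m0 n + q))) [set omega |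
  4 ^- n < pair_dist (4 ^+ n) (mesh n) (4 ^+ n.+1) (mesh n.+1) (dyadic T (m0 n + q) k.+1) omega].
have mA n q : measurable (A n q).
  apply: bigcup_measurable => k /= km.
  apply: (pair_dist_measurable T_gt0 hF hw hb hsigma) => //; exact: dyadic_in.
pose B n := \bigcup_q A n q.
have mB n : measurable (B n) by exact: bigcupT_measurable.
have G0 : 0 <= 1 + 2 * growth_bound T x K.
  by rewrite addr_ge0// mulr_ge0// mulr_ge0 ?expR_ge0// addr_ge0// sqnorm_ge0.
have PB n : (P (B n) <= ((1 + 2 * growth_bound T x K) * 4 ^- n)%:E)%E.
  have cv : (P \o A n) q @[q --> \oo] --> P (B n).
    apply: nondecreasing_cvg_mu; [exact: mA|exact: mB|move=> q q' qq'].
    apply/subsetPset => omega [k /= km].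
    have lq : (m0 n + q <= m0 n + q')%N by rewrite leq_add2l.
    rewrite (dyadic_refine T k.+1 lq) => hk.
    exists (k.+1 * 2 ^ (m0 n + q' - (m0 n + q))).-1%N => /=.
      rewrite prednK ?muln_gt0 ?expn_gt0//.
      by rewrite -[X in (_ <= 2 ^ X)%N](subnKC lq) expnD leq_mul2r km orbT.
    by rewrite prednK ?muln_gt0 ?expn_gt0.
  rewrite -(cvg_lim _ cv)//; apply: lime_le; first by apply/cvg_ex; exists (P (B n)).
  apply: nearW => q /=; apply: mesh_pair; rewrite (leq_trans _ (leq_addr _ _))//.
    exact: leq_maxl.
  exact: leq_maxr.
have BC : P (lim_sup_set B) = 0%E.
  apply: lim_sup_set_cvg0 => //.
  apply: (@le_lt_trans _ _ ((1 + 2 * growth_bound T x K) * 2)%:E); last by rewrite ltry.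
  apply: lime_le; first exact: is_cvg_nneseries.
  apply: nearW => n; apply: (@le_trans _ _ (\sum_(0 <= k < n) ((1 + 2 * growth_bound T x K) * 4 ^- k)%:E)%E).
    by apply: lee_sum => k _; exact: PB.
  by rewrite sumEFin lee_fin -mulr_sumr ler_wpM2l// geometric_sum_le.
have : P.-negligible (lim_sup_set B).
  apply/negligibleP => //; apply: bigcap_measurable => // k _; exact: bigcup_measurable.
apply: negligibleS => omega /= nclose n _; apply: contrapT => nB; apply: nclose.
exists n => n' m k nn' m1 m2 km; rewrite leNgt; apply/negP => lt; apply: nB.
exists n' => //; exists (m - m0 n')%N => //; exists k => /=.
  by rewrite subnKC// geq_max m1 m2.
by rewrite subnKC// geq_max m1 m2.
Qed.


Definition regular_noise (omega : Omega) := forall j, unif_cont T (fun t => w t omega j 0).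

Lemma ae_regular_noise : {ae P, forall omega, regular_noise omega}.
Proof.
apply: filterS (brownian_continuous hw) => omega cw j.
by apply: within_unif_cont => //; exact: within_coord.
Qed.

Let good omega := regular_noise omega /\ close_levels omega.

Let ae_good : {ae P, forall omega, good omega}.
Proof. by apply: filterS2 ae_regular_noise ae_close_levels => omega. Qed.

Local Notation Xn n := (XX (4 ^+ n) (mesh n)).
Local Notation Mn n := (MM (4 ^+ n) (mesh n)).

Lemma level_unif_cont n omega : regular_noise omega ->
  (forall i, unif_cont T (fun t => Xn n i t omega)) /\
  (forall i j, unif_cont T (fun t => Mn n i j t omega)).
Proof.
move=> rw; split=> [i|i j].
  by have [] := scheme_unif_cont T_gt0 b sigma x eps (4 ^+ n) (mesh n) (EU (4 ^+ n) (mesh n)) i rw.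
by have [_] := scheme_unif_cont T_gt0 b sigma x eps (4 ^+ n) (mesh n) (EU (4 ^+ n) (mesh n)) i rw.
Qed.

(** Both schemes start at x and have continuous paths, so the bound at positive
    dyadic times is enough. *)
Lemma level_step omega : good omega -> exists n0, forall n t, (n0 <= n)%N -> 0 <= t <= T ->
  (forall i, `|Xn n.+1 i t omega - Xn n i t omega| <= 2 ^- n) /\
  (forall i j, `|Mn n.+1 i j t omega - Mn n i j t omega| <= 2 ^- n).
Proof.
move=> [rw [n0 hn0]]; exists n0 => n t nn0 tT.
have [uX uM] := level_unif_cont n rw; have [uX' uM'] := level_unif_cont n.+1 rw.
have p0 : 0 <= 2 ^- n :> R by rewrite invr_ge0 exprn_ge0.
have sq (a : R) : a ^+ 2 <= 4 ^- n -> `|a| <= 2 ^- n.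
  move=> h; rewrite -(ler_pXn2r (ltn0Sn 1)) ?nnegrE// real_normK ?num_real//.
  by rewrite exprVn -exprM mulnC exprM -natrX.
pose A k := \sum_i (Xn n i k omega - Xn n.+1 i k omega) ^+ 2.
pose B k := \sum_i \sum_j (Mn n i j k omega - Mn n.+1 i j k omega) ^+ 2.
have A0 k : 0 <= A k by apply: sumr_ge0 => i _; exact: sqr_ge0.
have B0 k : 0 <= B k.
  by apply: sumr_ge0 => i _; apply: sumr_ge0 => j _; exact: sqr_ge0.
have pd m k : (maxn (mesh n) (mesh n.+1) <= m)%N -> (k < 2 ^ m)%N ->
    A (dyadic T m k.+1) + B (dyadic T m k.+1) <= 4 ^- n.
  by rewrite geq_max => /andP[m1 m2] km; exact: hn0.
have uabs (f g : R -> R) : unif_cont T f -> unif_cont T g ->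
    unif_cont T (fun t => `|f t - g t|).
  move=> uf ug; apply: unif_cont_norm.
  under eq_fun do rewrite -[- g _]mulN1r.
  by apply: unif_contD => //; exact: unif_contZ.
split=> [i|i j].
  apply: (dyadic_le_all T_gt0 (n0 := maxn (mesh n) (mesh n.+1)) (uabs _ _ (uX' i) (uX i))) => //.
  move=> m [|k] mm km; first by rewrite dyadic0 !(scheme0 T_gt0) subrr normr0.
  apply: sq; apply: le_trans (pd m k mm km); apply: ler_wpDr => //.
  rewrite -sqrrN opprB /A (bigD1 i)//= lerDl.
  by apply: sumr_ge0 => i' _; exact: sqr_ge0.
apply: (dyadic_le_all T_gt0 (n0 := maxn (mesh n) (mesh n.+1)) (uabs _ _ (uM' i j) (uM i j))) => //.
move=> m [|k] mm km; first by rewrite dyadic0 !(scheme_mart0 T_gt0) subrr normr0.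
apply: sq; apply: le_trans (pd m k mm km); apply: ler_wpDl => //.
rewrite -sqrrN opprB /B (bigD1 i)//= (bigD1 j)//= -addrA lerDl.
rewrite addr_ge0//; first by apply: sumr_ge0 => i' _; exact: sqr_ge0.
by apply: sumr_ge0 => i' _; apply: sumr_ge0 => j' _; exact: sqr_ge0.
Qed.

Definition limit_path (t : R) (omega : Omega) : 'cV[R]_r :=
  \col_i limsup_fine (fun n => Xn n i t omega).

Definition limit_mart i j (t : R) (omega : Omega) : R :=
  limsup_fine (fun n => Mn n i j t omega).

Lemma level_cvg omega : good omega -> forall e, 0 < e -> exists n0, forall n t,
  (n0 <= n)%N -> 0 <= t <= T ->
  (forall i, `|Xn n i t omega - limit_path t omega i 0| <= e) /\
  (forall i j, `|Mn n i j t omega - limit_mart i j t omega| <= e).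
Proof.
move=> /level_step[n0 hn0] e e0; have [q hq] := mesh_small 2 e0.
exists (maxn n0 q) => n t; rewrite geq_max => /andP[nn0 nq] tT.
have small : 2 * 2 ^- n <= e by have := hq n nq; rewrite natrX.
split=> [i|i j].
  have [a [ua ha]] := @geometric_cauchy _ (fun n => Xn n i t omega) n0
    (fun n nn => (hn0 n t nn tT).1 i).
  by rewrite /limit_path mxE (limsup_fineE ua) (le_trans (ha n nn0)).
have [a [ua ha]] := @geometric_cauchy _ (fun n => Mn n i j t omega) n0
    (fun n nn => (hn0 n t nn tT).2 i j).
by rewrite /limit_mart (limsup_fineE ua) (le_trans (ha n nn0)).
Qed.

Lemma limit_unif_cont omega : good omega -> forall i, unif_cont T (fun t => limit_path t omega i 0).
Proof.
move=> g i; apply: (@unif_cont_lim _ T (fun n t => Xn n i t omega)) => [n|e e0].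
  by have [] := level_unif_cont n g.1.
by have [n0 hn0] := level_cvg g e0; exists n0 => t tT; have [] := hn0 n0 t (leqnn _) tT.
Qed.

Let eu_adapted n k : (k < 2 ^ mesh n)%N ->
  measurable_wrt (F (dyadic T (mesh n) k)) (EU (4 ^+ n) (mesh n) k).
Proof. by move=> km; apply: (euler_adapted T_gt0 hF hw hb hsigma); exact: ltnW. Qed.

Lemma limit_adapted : is_adapted T F limit_path.
Proof.
move=> t tT; apply: (coord_adapted_at hF) => // i.
rewrite (_ : (fun _ => _) = (fun omega => limsup_fine (fun n => Xn n i t omega))).
  apply: measurable_limsup_fine => n.
  by apply: (scheme_adapted T_gt0 hF hw hb hsigma) => //; exact: eu_adapted.
by apply/funext => omega; rewrite mxE.
Qed.

Lemma limit_mart_adapted i j t : 0 <= t <= T -> adapted_at F t (limit_mart i j t).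
Proof.
move=> tT; apply: measurable_limsup_fine => n.
by apply: (scheme_mart_adapted T_gt0 hF hw hsigma) => //; exact: eu_adapted.
Qed.

(** The Euler values are those of the scheme at grid times, and the scheme
    converges to the limit path uniformly. *)
Lemma limit_coef_cvg phi omega : locally_lipschitz phi -> good omega ->
  forall e, 0 < e -> exists n0, forall n s, (n0 <= n)%N -> 0 <= s < T ->
  `|(if sqnorm (EU (4 ^+ n) (mesh n) (dyadic_index T (mesh n) s) omega) <= 4 ^+ n then
       phi (EU (4 ^+ n) (mesh n) (dyadic_index T (mesh n) s) omega) else 0)
    - phi (limit_path s omega)| <= e.
Proof.
move=> lphi g; apply: (frozen_coef_cvg T_gt0 lphi (limit_unif_cont g)
  (v := fun n k => EU (4 ^+ n) (mesh n) k omega) (N := fun n => 4 ^+ n)) => //.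
  move=> B; exists (Num.trunc `|B|) => n nB; rewrite (le_trans (ler_norm _))//.
  apply: le_trans (ltW (truncnS_gt _)) _; rewrite -natrX ler_nat.
  exact: leq_ltn_trans nB (ltn_expl _ _).
move=> e e0; have [n0 hn0] := level_cvg g e0; exists n0 => n k i nn0 km.
rewrite -(euler_scheme T_gt0) ?(ltnW km)//.
by have [] := hn0 n _ nn0 (dyadic_in T_gt0 (ltnW km)).
Qed.

(** The frozen diffusion coefficients are simple processes themselves and serve
    as the approximating sequence. *)
Lemma limit_ito_integral i j : is_ito_integral P T F (fun t omega => w t omega j 0)
  (fun t omega => sigma (limit_path t omega) i j) (limit_mart i j).
Proof.
have [_ /(_ i j)lphi] := coef_locally_lipschitz lipschitz.
have sad t : 0 <= t <= T -> adapted_at F t (fun omega => sigma (limit_path t omega) i j).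
  move=> tT; apply: (@adapted_at_comp _ _ _ _ _ hF t _ (fun omega => sigma (limit_path t omega))
    (fun A : 'M[R]_(r, l) => A i j)) => //.
  - by move=> A bA; exact: (limit_adapted tT (hsigma bA)).
  - by apply: continuous_borel => A; exact: coord_continuous.
split.
  split; first by move=> t tT; apply/(adapted_atP hF _ tT); exact: sad.
  apply: filterS ae_good => omega g; have uh := coef_unif_cont T_gt0 lphi (limit_unif_cont g).
  split; first exact: unif_cont_measurable.
  exact: unif_cont_sqr_integral.
exists (fun n => diffusion_step T sigma (4 ^+ n) (mesh n) (EU (4 ^+ n) (mesh n)) i j); split.
- move=> n; have four : 0 <= 4 ^+ n :> R by rewrite exprn_ge0.
  have [C hC] := bounded_on_balls lipschitz four.
  by apply: (diffusion_step_simple T_gt0 hF hsigma _ _ _ four hC); exact: eu_adapted.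
- apply: (step_cvg_prob0 T_gt0 hF (h := fun t omega => sigma (limit_path t omega) i j)
    (u := fun n k omega => trunc_diffusion sigma (4 ^+ n) (EU (4 ^+ n) (mesh n) k omega) i j)) => //.
    move=> n k km; apply: (trunc_diffusion_adapted hF hsigma); first exact: dyadic_in (ltnW km).
    exact: eu_adapted.
  apply: filterS ae_good => omega g; split; first exact: (coef_unif_cont T_gt0 lphi (limit_unif_cont g)).
  move=> e e0; have [n0 hn0] := limit_coef_cvg lphi g e0.
  by exists n0 => n s nn0 sT; rewrite dyadic_step_eval//; exact: hn0.
move=> t tT; apply: ae_cvg_prob0.
- move=> n; apply: (adapted_at_measurable hF tT).
  by apply: (scheme_mart_adapted T_gt0 hF hw hsigma) => //; exact: eu_adapted.
- exact: (adapted_at_measurable hF tT (limit_mart_adapted i j tT)).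
apply: filterS ae_good => omega g e e0; have [n0 hn0] := level_cvg g e0.
by exists n0 => n nn0; have [_] := hn0 n t nn0 tT; exact.
Qed.

Lemma limit_equation omega t i : good omega -> 0 <= t <= T ->
  limit_path t omega i 0 = x i 0
    + \int[lebesgue_measure]_(s in `[0, t]) b (limit_path s omega) i 0
    + eps * \sum_(j < l) limit_mart i j t omega.
Proof.
move=> g tT; have [/(_ i)lphi _] := coef_locally_lipschitz lipschitz.
set I := \int[_]_(s in _) _; set Y := limit_path t omega i 0.
apply/eqP; rewrite -subr_eq0 -normr_le0; apply/ler_addgt0Pr => c c0; rewrite add0r.
have D0 : 0 < 1 + T + l%:R by rewrite ltr_wpDr// addr_gt0.
have e0 : 0 < c / (1 + T + l%:R) by rewrite divr_gt0.
set e := c / _ in e0.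
have -> : c = e + T * e + l%:R * e.
  have -> : e + T * e + l%:R * e = e * (1 + T + l%:R) by ring.
  by rewrite divfK// gt_eqF.
have [n1 hn1] := level_cvg g e0; have [n2 hn2] := limit_coef_cvg lphi g e0.
pose n := maxn n1 n2.
have [h1 h2] := hn1 n t (leq_maxl _ _) tT.
have h3 : `|step_integral (fun u _ => u) (drift_step T b (4 ^+ n) (mesh n)
     (EU (4 ^+ n) (mesh n)) i) t omega - I| <= T * e.
  apply: (step_integral_time_close T_gt0 _ _ tT (h := fun s => b (limit_path s omega) i 0)).
  - exact: dyadic0.
  - exact: dyadic_step_increasing.
  - exact: (coef_unif_cont T_gt0 lphi (limit_unif_cont g)).
  by move=> s sT; rewrite dyadic_step_eval//; apply: hn2 => //; exact: leq_maxr.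
have h4 : `|\sum_j Mn n i j t omega - \sum_j limit_mart i j t omega| <= l%:R * e.
  rewrite -sumrB (le_trans (ler_norm_sum _ _ _))//.
  rewrite -[X in X%:R * _]card_ord mulr_natl -sumr_const.
  by apply: ler_sum => j _; exact: h2.
have h5 := h1 i; rewrite /scheme in h5.
move: h3 h4 h5; set SI := step_integral _ _ _ _; set S := \sum_j _; set S' := \sum_(j < l) _.
move=> h3 h4 h5; case/andP: eps01 => ep0 ep1.
have h4' : `|eps * (S - S')| <= l%:R * e.
  by rewrite normrM (gtr0_norm ep0) (le_trans _ h4)// ler_piMl.
rewrite -/Y in h5.
have -> : Y - (x i 0 + I + eps * S') = - (x i 0 + SI + eps * S - Y) + (SI - I) + eps * (S - S').
  by ring.
rewrite (le_trans (ler_normD _ _))// lerD// (le_trans (ler_normD _ _))// lerD//.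
by rewrite normrN.
Qed.

Lemma limit_solution : is_solution P T F w b sigma eps x limit_path.
Proof.
have [lb _] := coef_locally_lipschitz lipschitz.
split.
- exact: limit_adapted.
- by apply: filterS ae_good => omega g; apply: coord_within; exact: limit_unif_cont.
- apply: filterS ae_good => omega g i.
  have TT : 0 <= T <= T by rewrite lexx ltW.
  exact: (unif_cont_integrable (coef_unif_cont T_gt0 (lb i) (limit_unif_cont g)) TT).
exists limit_mart; split; first exact: limit_ito_integral.
by move=> t tT; apply: filterS ae_good => omega g i; exact: limit_equation.
Qed.

End limit.

Lemma solution_exists : exists X, is_solution P T F w b sigma eps x X.
Proof.
have [mesh hmesh] := euler_levels.
have h1 n : (n <= mesh n)%N by have [] := hmesh n.
exists (limit_path mesh); apply: limit_solution => // n m m1 m2.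
by have [_] := hmesh n; exact.
Qed.

End existence.

(** * Uniqueness *)
Section step_triangle.
Context {R : realType} {d : measure_display} {Omega : measurableType d}.
Variable T : R.
Local Notation mu := (@lebesgue_measure R).

Lemma step_dist_triangle (f g : step_process R Omega) (h : R -> R) omega eta : 0 <= eta ->
  measurable_fun `[0, T] h ->
  (\int[mu]_(s in `[0%R, T]) ((step_eval f s omega - h s) ^+ 2)%:E <= (eta / 4)%:E)%E ->
  (\int[mu]_(s in `[0%R, T]) ((step_eval g s omega - h s) ^+ 2)%:E <= (eta / 4)%:E)%E ->
  (\int[mu]_(s in `[0%R, T]) ((step_eval f s omega - step_eval g s omega) ^+ 2)%:E
     <= eta%:E)%E.
Proof.
move=> eta0 mh hf hg.
have me k : measurable_fun `[0, T] (fun s => step_eval k s omega).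
  by apply: measurable_funTS; exact: measurable_step_eval.
have md k : measurable_fun `[0, T] (fun s => ((step_eval k s omega - h s) ^+ 2)%:E).
  by apply/measurable_EFinP; apply: measurable_funX; exact: measurable_funB.
have m2 k : measurable_fun `[0, T] (fun s => 2%:E * ((step_eval k s omega - h s) ^+ 2)%:E)%E.
  exact: measurable_funeM.
apply: (@le_trans _ _ (\int[mu]_(s in `[0%R, T]) (2%:E * ((step_eval f s omega - h s) ^+ 2)%:E
   + 2%:E * ((step_eval g s omega - h s) ^+ 2)%:E))%E).
  apply: ge0_le_integral => //.
  - by move=> s _; rewrite lee_fin sqr_ge0.
  - apply/measurable_EFinP; apply: measurable_funX.
    by apply: measurable_funB; exact: me.
  - by apply: emeasurable_funD; exact: m2.
  move=> s _; rewrite -!EFinM -EFinD lee_fin.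
  have := sqr_ge0 (step_eval f s omega - h s + (step_eval g s omega - h s)).
  by rewrite !expr2; nra.
have p k s : (0 <= 2%:E * ((step_eval k s omega - h s) ^+ 2)%:E)%E.
  by rewrite -EFinM lee_fin mulr_ge0// sqr_ge0.
rewrite ge0_integralD//; try exact: m2; try (by move=> s _; exact: p).
rewrite !ge0_integralZl//; try exact: md; try (by move=> s _; rewrite lee_fin sqr_ge0).
have -> : eta%:E = (2%:E * (eta / 4)%:E + 2%:E * (eta / 4)%:E)%E.
  by rewrite -!EFinM -EFinD; congr EFin; field.
by apply: leeD; apply: lee_wpmul2l.
Qed.

End step_triangle.

Section uniqueness.
Context {R : realType} {d : measure_display} {Omega : measurableType d}.
Variables (P : probability Omega R) (T : R) (F : R -> set_system Omega).
Hypotheses (T_gt0 : 0 < T) (hF : is_filtration T F).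
Variables (r l : nat) (w : R -> Omega -> 'cV[R]_l).
Hypothesis hw : is_brownian P T F w.
Variables (b : 'cV[R]_r -> 'cV[R]_r) (sigma : 'cV[R]_r -> 'M[R]_(r, l)).
Hypotheses (hb : borel_fun b) (hsigma : borel_fun sigma).
Variables (x : 'cV[R]_r) (eps : R).
Hypothesis eps01 : 0 < eps <= 1.
Hypothesis lipschitz : forall N : R, exists L : R, forall y z : 'cV[R]_r,
  enorm y <= N -> enorm z <= N ->
  \sum_(i < r) `|b y i 0 - b z i 0|
    + \sum_(i < r) \sum_(j < l) `|sigma y i j - sigma z i j|
    <= L * enorm (y - z).
Local Notation mu := (@lebesgue_measure R).

Section frozen_solution.
Variable X : R -> Omega -> 'cV[R]_r.
Hypothesis hX : is_solution P T F w b sigma eps x X.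

Definition frozen (n k : nat) : Omega -> 'cV[R]_r := X (dyadic T n k).

Local Notation Y n := (scheme T w b sigma x eps n%:R n (frozen n)).
Local Notation MY n := (scheme_mart T w sigma n%:R n (frozen n)).

Definition regular_path (omega : Omega) := forall i, unif_cont T (fun t => X t omega i 0).

Lemma ae_regular_path : {ae P, forall omega, regular_path omega}.
Proof.
apply: filterS (solution_continuous hX) => omega cX i.
by apply: within_unif_cont => //; exact: within_coord.
Qed.

Lemma frozen_adapted n k : (k <= 2 ^ n)%N ->
  measurable_wrt (F (dyadic T n k)) (frozen n k).
Proof. by move=> km; apply: (solution_adapted hX); exact: dyadic_in. Qed.

Lemma frozen_solution_cvg phi omega : locally_lipschitz phi -> regular_path omega ->
  forall e, 0 < e -> exists n0, forall n s, (n0 <= n)%N -> 0 <= s < T ->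
  `|(if sqnorm (frozen n (dyadic_index T n s) omega) <= n%:R then
       phi (frozen n (dyadic_index T n s) omega) else 0) - phi (X s omega)| <= e.
Proof.
move=> lphi rX; apply: (frozen_coef_cvg T_gt0 lphi rX (mesh := id)
  (v := fun n k => frozen n k omega) (N := fun n => n%:R)) => //.
  move=> B; exists (Num.trunc `|B|).+1 => n nB; rewrite (le_trans (ler_norm _))//.
  by apply: le_trans (ltW (truncnS_gt _)) _; rewrite ler_nat.
by move=> e e0; exists 0%N => n k i _ _; rewrite subrr normr0 ltW.
Qed.

Let coef_adapted (phi : 'cV[R]_r -> R) t : borel_fun phi -> 0 <= t <= T ->
  adapted_at F t (fun omega => phi (X t omega)).
Proof.
by move=> bphi tT; apply: (adapted_at_comp hF) => //; exact: (solution_adapted hX).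
Qed.

Let borel_b i : borel_fun (fun y => b y i 0).
Proof.
move=> B bB; apply: (hb (B := [set v : 'cV[R]_r | B (v i 0)])).
by apply: (continuous_borel (f := fun v : 'cV[R]_r => v i 0)) bB; exact: coord_continuous.
Qed.

Let borel_sigma i j : borel_fun (fun y => sigma y i j).
Proof.
move=> B bB; apply: (hsigma (B := [set v : 'M[R]_(r, l) | B (v i j)])).
by apply: (continuous_borel (f := fun v : 'M[R]_(r, l) => v i j)) bB; exact: coord_continuous.
Qed.

Lemma frozen_drift_vanish i c : 0 < c -> vanish P (fun n => [set omega |
  exists2 k, (k <= 2 ^ n)%N & c < `|step_integral (fun u _ => u)
     (drift_step T b n%:R n (frozen n) i) (dyadic T n k) omega
     - \int[mu]_(s in `[0, dyadic T n k]) b (X s omega) i 0|]).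
Proof.
move=> c0; have [/(_ i)lphi _] := coef_locally_lipschitz lipschitz.
have c'0 : 0 < c / T by rewrite divr_gt0.
have h1 n k : (k < 2 ^ n)%N -> adapted_at F (dyadic T n k)
    (fun omega => trunc_drift b n%:R (frozen n k omega) i).
  move=> km; apply: (trunc_drift_adapted hF hb); first exact: dyadic_in (ltnW km).
  exact: frozen_adapted (ltnW km).
have h2 t : 0 <= t <= T -> adapted_at F t (fun omega => b (X t omega) i 0).
  exact: (coef_adapted (borel_b i)).
apply: vanish_sub (step_close_vanish T_gt0 hF (mesh := id) h1 h2 _ c'0).
  move=> n omega [k kn]; rewrite ltNge => /negP lt [uh close]; apply: lt.
  rewrite -[leRHS](divfK (_ : T != 0)) ?gt_eqF// mulrC.
  apply: (step_integral_time_close T_gt0 _ _ (dyadic_in T_gt0 kn) (h := fun s => b (X s omega) i 0)) => //.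
  - exact: dyadic0.
  - exact: dyadic_step_increasing.
apply: filterS ae_regular_path => omega rX; split; first exact: (coef_unif_cont T_gt0 lphi rX).
move=> e e0; have [n0 hn0] := frozen_solution_cvg lphi rX e0.
by exists n0 => n s nn0 sT; rewrite dyadic_step_eval//; exact: hn0.
Qed.

(** The frozen integrand and the simple processes that define the Ito integral
    both approximate sigma(X) in mean square in time, so that [simple_lenglart]
    compares their integrals. Given the level n, the index m of the simple
    processes is taken so large that their integrals are close to M at the
    finitely many grid times of level n. *)
Lemma frozen_mart_vanish i j M c : 0 < c ->
  is_ito_integral P T F (fun t omega => w t omega j 0)
    (fun t omega => sigma (X t omega) i j) M ->
  vanish P (fun n => [set omega |
    exists2 k, (k <= 2 ^ n)%N & c < `|MY n i j (dyadic T n k) omega - M (dyadic T n k) omega|]).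
Proof.
move=> c0 [_ [fm [sfm cvf cvI]]] e e0; have [_ /(_ i j)lphi] := coef_locally_lipschitz lipschitz.
pose lambda := (c / 2) ^+ 2; pose eta := e / 4 * lambda / 2.
have lam0 : 0 < lambda by rewrite exprn_gt0// divr_gt0.
have eta0 : 0 < eta by rewrite !divr_gt0// mulr_gt0// divr_gt0.
have eta4 : 0 < eta / 4 by rewrite divr_gt0.
have e4 : 0 < e / 4 by rewrite divr_gt0.
have c20 : 0 < c / 2 by rewrite divr_gt0.
pose g n := diffusion_step T sigma n%:R n (frozen n) i j.
pose sX := fun s omega => sigma (X s omega) i j.
have sg n : is_simple T F (g n).
  have [C hC] := bounded_on_balls lipschitz (ler0n R n).
  apply: (diffusion_step_simple T_gt0 hF hsigma _ _ _ (ler0n R n) hC) => k km.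
  exact: frozen_adapted (ltnW km).
have cvg : cvg_prob0 P (fun n omega => \int[mu]_(s in `[0%R, T])
    ((step_eval (g n) s omega - sX s omega) ^+ 2)%:E)%E.
  apply: (step_cvg_prob0 T_gt0 hF (mesh := id) (h := sX)
    (u := fun n k omega => trunc_diffusion sigma n%:R (frozen n k omega) i j)).
  - move=> n k km; apply: (trunc_diffusion_adapted hF hsigma); first exact: dyadic_in (ltnW km).
    exact: frozen_adapted (ltnW km).
  - by move=> t tT; exact: (coef_adapted (borel_sigma i j) tT).
  apply: filterS ae_regular_path => omega rX; split; first exact: (coef_unif_cont T_gt0 lphi rX).
  move=> a a0; have [n0 hn0] := frozen_solution_cvg lphi rX a0.
  by exists n0 => n s nn0 sT; rewrite dyadic_step_eval//; exact: hn0.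
have [n0 hn0] := (cvg_prob0P _ _).1 cvg _ eta4 _ e4.
exists n0 => n nn0.
have [m1 hm1] := (cvg_prob0P _ _).1 cvf _ eta4 _ e4.
pose I m := \bigcup_(k : 'I_(2 ^ n).+1) [set omega | ((c / 2)%:E <
  `|step_integral (fun t omega => w t omega j 0) (fm m) (dyadic T n k) omega
     - M (dyadic T n k) omega|%:E)%E].
have vI : vanish P I.
  apply: (@vanish_bigcup _ _ _ P _ (fun (k : 'I_(2 ^ n).+1) m => [set omega | ((c / 2)%:E <
  `|step_integral (fun t omega => w t omega j 0) (fm m) (dyadic T n k) omega
     - M (dyadic T n k) omega|%:E)%E])) => -[k kn].
  apply: ((cvg_prob0P _ _).1 (cvI (dyadic T n k) _) _ c20).
  exact: dyadic_in.
have [m2 hm2] := vI _ e4; pose m := maxn m1 m2.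
pose S := \bigcup_(q in `I_(2 ^ n).+1) [set omega |
   lambda < (step_integral (coord_process w j) (fm m) (dyadic T n q) omega -
       step_integral (coord_process w j) (g n) (dyadic T n q) omega) ^+ 2].
have mint f q : is_simple T F f -> (q <= 2 ^ n)%N ->
    measurable_fun setT (step_integral (coord_process w j) f (dyadic T n q)).
  move=> /(simple_props hF)[f0 fT finc fin fad] qn; have qT := dyadic_in T_gt0 qn.
  apply: (adapted_at_measurable hF qT); apply: (adapted_step_integral hF) => //.
  move=> s /andP[s0 st]; apply: (brownian_coord_adapted hF hw).
  by rewrite s0 (le_trans st)//; case/andP: qT.
have mS : measurable S.
  apply: bigcup_measurable => q /= qn; apply: measurable_lt_set; apply: measurable_funX.
  by apply: measurable_funB; apply: mint => //; rewrite -ltnS.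
have lS : (mu_ext P S <= (e / 4 + (e / 4 + e / 4))%:E)%E.
  rewrite (measurable_mu_extE P mS).
  apply: le_trans (simple_lenglart hF hw j (sfm m) (sg n) eta0 lam0) _.
  have -> : 2 * eta / lambda = e / 4 by rewrite /eta; field; exact: lt0r_neq0.
  rewrite EFinD; apply: leeD => //.
  have nQ : P.-negligible (~` [set omega | regular_path omega]) by exact: ae_regular_path.
  pose A := [set omega | ((eta / 4)%:E < \int[mu]_(s in `[0%R, T])
        ((step_eval (fm m) s omega - sX s omega) ^+ 2)%:E)%E].
  pose B := [set omega | ((eta / 4)%:E < \int[mu]_(s in `[0%R, T])
        ((step_eval (g n) s omega - sX s omega) ^+ 2)%:E)%E].
  apply: (@le_trans _ _ (mu_ext P (~` [set omega | regular_path omega] `|` (A `|` B)))).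
    apply: le_mu_ext => omega lt.
    have [rX|] := pselect (regular_path omega); last by left.
    right; apply: contrapT => /not_orP[/negP nA /negP nB].
    move: lt nA nB; rewrite /= -!leNgt ltNge => /negP lt nA nB; apply: lt.
    apply: (step_dist_triangle (ltW eta0) _ nA nB); apply: unif_cont_measurable => //.
    exact: (coef_unif_cont T_gt0 lphi rX).
  apply: le_trans (mu_extU2 _ _ _) _.
  rewrite mu_ext_negligible// add0e; apply: le_trans (mu_extU2 _ _ _) _.
  rewrite EFinD; apply: leeD; last exact: hn0.
  by apply: hm1; exact: leq_maxl.
apply: (@le_trans _ _ (mu_ext P (S `|` I m))).
  apply: le_mu_ext => omega [k kn lt]; apply: contrapT => /not_orP[nS nI].
  have kn1 : (k < (2 ^ n).+1)%N by rewrite ltnS.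
  have a1 : `|step_integral (coord_process w j) (fm m) (dyadic T n k) omega - MY n i j (dyadic T n k) omega| <= c / 2.
    rewrite -(ler_pXn2r (ltn0Sn 1)) ?nnegrE ?(ltW c20)// real_normK ?num_real// leNgt.
    by apply/negP => h; apply: nS; exists k.
  have a2 : `|step_integral (coord_process w j) (fm m) (dyadic T n k) omega - M (dyadic T n k) omega| <= c / 2.
    by rewrite -lee_fin leNgt; apply/negP => h; apply: nI; exists (Ordinal kn1).
  move: lt; apply/negP; rewrite -leNgt.
  set u := step_integral _ _ _ _ in a1 a2.
  have -> : MY n i j (dyadic T n k) omega - M (dyadic T n k) omega =
    (u - M (dyadic T n k) omega) - (u - MY n i j (dyadic T n k) omega) by ring.
  by rewrite (le_trans (ler_normB _ _))// [leRHS](splitr c) lerD.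
apply: le_trans (mu_extU2 _ _ _) _.
have -> : e%:E = ((e / 4 + (e / 4 + e / 4))%:E + (e / 4)%:E)%E.
  by rewrite -EFinD; congr EFin; field.
by apply: leeD => //; apply: hm2; exact: leq_maxr.
Qed.

(** The drift and each of the stochastic integrals are compared separately. *)
Lemma frozen_scheme_vanish c : 0 < c -> vanish P (fun n => [set omega |
  exists2 k, (k <= 2 ^ n)%N &
    c < \sum_i (Y n i (dyadic T n k) omega - X (dyadic T n k) omega i 0) ^+ 2]).
Proof.
move=> c0; have [M [hM eqX]] := solution_equation hX.
(* There are r coordinates, each with one drift error and l errors of stochastic
   integrals, all of size a. *)
pose D : R := r%:R * (1 + l%:R) ^+ 2 + 1.
have l1 : 0 <= (1 + l%:R) ^+ 2 :> R by exact: sqr_ge0.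
have D0 : 0 < D by rewrite ltr_wpDl// mulr_ge0.
pose a := Num.sqrt (c / D).
have a0 : 0 < a by rewrite sqrtr_gt0 divr_gt0.
have aD : a ^+ 2 * D = c by rewrite sqr_sqrtr ?divfK ?gt_eqF// ltW// divr_gt0.
pose E omega := forall n k, (k <= 2 ^ n)%N -> forall i : 'I_r, X (dyadic T n k) omega i 0 =
  x i 0 + \int[mu]_(s in `[0, dyadic T n k]) b (X s omega) i 0
   + eps * \sum_(j < l) M i j (dyadic T n k) omega.
have aeE : {ae P, forall omega, E omega}.
  have h n : {ae P, forall omega k, (k <= 2 ^ n)%N -> forall i : 'I_r,
    X (dyadic T n k) omega i 0 =
    x i 0 + \int[mu]_(s in `[0, dyadic T n k]) b (X s omega) i 0
     + eps * \sum_(j < l) M i j (dyadic T n k) omega}.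
    apply/ae_foralln => k; have [kn|/negP kn] := boolP (k <= 2 ^ n)%N.
      by apply: filterS (eqX _ (dyadic_in T_gt0 kn)) => omega h _.
    by apply: nearW.
  by move/ae_foralln : h; apply: filterS => omega h n; exact: h.
have nE : P.-negligible (~` [set omega | E omega]) by exact: aeE.
pose DR (i : 'I_r) n := [set omega | exists2 k, (k <= 2 ^ n)%N & a < `|step_integral (fun u _ => u)
     (drift_step T b n%:R n (frozen n) i) (dyadic T n k) omega
     - \int[mu]_(s in `[0, dyadic T n k]) b (X s omega) i 0|].
pose MR (p : 'I_r * 'I_l) n := [set omega | exists2 k, (k <= 2 ^ n)%N &
  a < `|MY n p.1 p.2 (dyadic T n k) omega - M p.1 p.2 (dyadic T n k) omega|].
have vD : vanish P (fun n => \bigcup_i DR i n).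
  by apply: vanish_bigcup => i; exact: frozen_drift_vanish.
have vM : vanish P (fun n => \bigcup_p MR p n).
  by apply: vanish_bigcup => p; exact: (frozen_mart_vanish a0 (hM p.1 p.2)).
apply: vanish_sub (vanishU (vanish_negligible nE) (vanishU vD vM)) => n omega [k kn lt].
have [Eo|] := pselect (E omega); last by left.
right; apply: contrapT => /not_orP[nD nM]; move: lt; apply/negP; rewrite -leNgt.
have close i : `|Y n i (dyadic T n k) omega - X (dyadic T n k) omega i 0| <= a * (1 + l%:R).
  rewrite (Eo n k kn i) /scheme.
  set SI := step_integral _ _ _ _; set I := \int[mu]_(s in _) _.
  have b1 : `|SI - I| <= a.
    by rewrite leNgt; apply/negP => h; apply: nD; exists i => //; exists k.
  have b2 : `|\sum_j MY n i j (dyadic T n k) omega - \sum_j M i j (dyadic T n k) omega| <= a * l%:R.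
    rewrite -sumrB (le_trans (ler_norm_sum _ _ _))// mulrC.
    rewrite -[X in X%:R * _]card_ord mulr_natl -sumr_const; apply: ler_sum => j _.
    by rewrite leNgt; apply/negP => h; apply: nM; exists (i, j) => //; exists k.
  move: b2; set S := \sum_j _; set S' := \sum_j _ => b2; case/andP: eps01 => ep0 ep1.
  have -> : x i 0 + SI + eps * S - (x i 0 + I + eps * S') = (SI - I) + eps * (S - S') by ring.
  rewrite (le_trans (ler_normD _ _))// [leRHS]mulrDr mulr1 lerD//.
  by rewrite normrM (gtr0_norm ep0) (le_trans _ b2)// ler_piMl.
apply: (@le_trans _ _ (\sum_(i < r) (a * (1 + l%:R)) ^+ 2)).
  apply: ler_sum => i _; rewrite -[leLHS](real_normK (num_real _)).
  by rewrite ler_pXn2r ?nnegrE// mulr_ge0 ?addr_ge0// ltW.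
rewrite sumr_const card_ord -[_ *+ r]mulr_natl exprMn mulrCA -aD ler_wpM2l ?sqr_ge0//.
by rewrite lerDl.
Qed.

End frozen_solution.
Section two_solutions.
Variables X1 X2 : R -> Omega -> 'cV[R]_r.
Hypotheses (hX1 : is_solution P T F w b sigma eps x X1).
Hypotheses (hX2 : is_solution P T F w b sigma eps x X2).

Local Notation Y X n := (scheme T w b sigma x eps n%:R n (frozen X n)).
Local Notation MY X n := (scheme_mart T w sigma n%:R n (frozen X n)).

Definition frozen_error X n k (omega : Omega) : R :=
  \sum_i (Y X n i (dyadic T n k) omega - X (dyadic T n k) omega i 0) ^+ 2.

Definition confined N delta n k : set Omega :=
  [set omega | [/\ frozen_error X1 n k omega <= delta, frozen_error X2 n k omega <= delta,
     sqnorm (X1 (dyadic T n k) omega) <= N & sqnorm (X2 (dyadic T n k) omega) <= N]].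

Definition schemes_apart c n k : set Omega :=
  [set omega | c < \sum_i (Y X1 n i (dyadic T n k) omega - Y X2 n i (dyadic T n k) omega) ^+ 2].

Let Y_adapted X n i k : is_solution P T F w b sigma eps x X -> (k <= 2 ^ n)%N ->
  adapted_at F (dyadic T n k) (Y X n i (dyadic T n k)).
Proof.
move=> hX kn; apply: (scheme_adapted T_gt0 hF hw hb hsigma); last exact: dyadic_in.
by move=> q qn; apply: (frozen_adapted hX); exact: ltnW.
Qed.

Let X_adapted X n i k : is_solution P T F w b sigma eps x X -> (k <= 2 ^ n)%N ->
  adapted_at F (dyadic T n k) (fun omega => X (dyadic T n k) omega i 0).
Proof.
move=> hX kn; have kT := dyadic_in T_gt0 kn.
by apply: (adapted_at_coord hF _ kT); exact: (solution_adapted hX).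
Qed.

Let error_adapted X n k : is_solution P T F w b sigma eps x X -> (k <= 2 ^ n)%N ->
  adapted_at F (dyadic T n k) (frozen_error X n k).
Proof.
move=> hX kn; apply: measurable_sum => i; apply: measurable_funX; apply: measurable_funB.
  exact: Y_adapted.
exact: X_adapted.
Qed.

Lemma confined_adapted N delta n k : (k <= 2 ^ n)%N ->
  F (dyadic T n k) (confined N delta n k).
Proof.
move=> kn; have kT := dyadic_in T_gt0 kn.
have -> : confined N delta n k =
    ([set omega | frozen_error X1 n k omega <= delta] `&`
     [set omega | frozen_error X2 n k omega <= delta]) `&`
    ([set omega | sqnorm (X1 (dyadic T n k) omega) <= N] `&`
     [set omega | sqnorm (X2 (dyadic T n k) omega) <= N]).
  by apply/seteqP; split => omega /=; [move=> [h1 h2 h3 h4]|move=> [[h1 h2] [h3 h4]]].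
rewrite -(filtration_gE hF)//.
have e1 := error_adapted hX1 kn; have e2 := error_adapted hX2 kn.
have m1 := solution_adapted hX1 kT; have m2 := solution_adapted hX2 kT.
by apply: measurableI; apply: measurableI; rewrite (filtration_gE hF)//;
  [exact: (adapted_le_set hF)|exact: (adapted_le_set hF)|
   exact: (ball_adapted hF)|exact: (ball_adapted hF)].
Qed.

Lemma schemes_apart_measurable c n k : (k < 2 ^ n)%N -> measurable (schemes_apart c n k.+1).
Proof.
move=> kn; apply: measurable_lt_set; apply: (adapted_at_measurable hF (dyadic_in T_gt0 kn)).
by apply: measurable_sum => i; apply: measurable_funX; apply: measurable_funB; exact: Y_adapted.
Qed.

(** On the confined events the freezing errors are at most delta and the frozen
    values lie in the ball of squared radius N, so the comparison applies with an
    error that is proportional to delta. *)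
Lemma confined_schemes_close N c : 0 < c ->
  exists rho, forall delta n, 0 < delta -> N <= n%:R ->
  (P (\bigcup_(k in `I_(2 ^ n)) ((\bigcap_(q in `I_k.+1) confined N delta n q) `&`
       schemes_apart c n k.+1)) <= (rho * delta)%:E)%E.
Proof.
move=> c0; have [L L0 hL] := lipschitz_on_balls lipschitz N.
have [C hC] : exists C, coef_bounded_on b sigma N C.
  have [N0|N0] := leP 0 N; first exact: (bounded_on_balls lipschitz).
  exists 0 => y yN; have := lt_le_trans (le_lt_trans yN N0) (sqnorm_ge0 y).
  by rewrite ltxx.
exists (expR ((1 + comparison_rate T L) * T) * (comparison_rate T L * (T * 2)) / c).
move=> delta n delta0 Nn.
pose G k := \bigcap_(q in `I_k.+1) confined N delta n q.
have FG k : (k < 2 ^ n)%N -> F (dyadic T n k) (G k).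
  by move=> kn; apply: (bigcap_adapted T_gt0 hF) => // q qn; apply: confined_adapted; exact: ltnW.
have GA k omega : G k omega -> confined N delta n k omega.
  by move=> /(_ k); apply; rewrite /= ltnSn.
have Gd k : (k.+1 < 2 ^ n)%N -> G k.+1 `<=` G k.
  by move=> _ omega Gk q /= qk; apply: Gk => /=; exact: ltnW.
have le k : (k < 2 ^ n)%N -> dyadic T n k <= dyadic T n k.+1 by rewrite dyadic_le.
have gin k : (k <= 2 ^ n)%N -> 0 <= dyadic T n k <= T by exact: dyadic_in.
pose v X k := frozen X n (dyadic_index T n (dyadic T n k)).
have vE X k : (k < 2 ^ n)%N -> v X k = X (dyadic T n k).
  by move=> kn; rewrite /v /frozen dyadic_index_dyadic.
have S X (hX : is_solution P T F w b sigma eps x X) :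
    (forall k omega, G k omega -> sqnorm (X (dyadic T n k) omega) <= N) ->
    is_frozen_scheme F w b sigma eps N (2 ^ n) (dyadic T n) G (v X)
    (fun k i => Y X n i (dyadic T n k)) (fun k i j => MY X n i j (dyadic T n k)).
  move=> GN; apply: (scheme_is_frozen T_gt0 hF hw hb hsigma) => //.
    by move=> q qn; apply: (frozen_adapted hX); exact: ltnW.
  by move=> k omega kn Gk; rewrite -/(v X k) vE//; exact: GN.
have S1 := S _ hX1 (fun k omega Gk => let: And4 _ _ h _ := GA k omega Gk in h).
have S2 := S _ hX2 (fun k omega Gk => let: And4 _ _ _ h := GA k omega Gk in h).
have mG k : (k < 2 ^ n)%N -> measurable (G k).
  by move=> kn; apply: (filtration_measurable hF (gin k (ltnW kn))); exact: FG.
have al_bnd : (\sum_(k < 2 ^ n) ((dyadic T n k.+1 - dyadic T n k)%:E *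
   \int[P]_(omega in G k)
     (freezing_error (v X1) (fun k i => Y X1 n i (dyadic T n k)) k omega
      + freezing_error (v X2) (fun k i => Y X2 n i (dyadic T n k)) k omega)%:E)
   <= (T * (2 * delta))%:E)%E.
  apply: (@le_trans _ _ (\sum_(k < 2 ^ n) (T / (2 ^ n)%:R * (2 * delta))%:E)%E); last first.
    rewrite sumEFin sumr_const card_ord lee_fin -[_ *+ _]mulr_natl.
    by rewrite -mulrA [(_^-1) * _]mulrC mulrCA [_ * (_ / _)]mulrCA divff ?mulr1.
  apply: lee_sum => -[k km] _ /=; rewrite dyadic_incr [leRHS]EFinM.
  apply: lee_wpmul2l; first by rewrite lee_fin divr_ge0// ltW// pow2_gt0.
  have FE X : freezing_error (v X) (fun k i => Y X n i (dyadic T n k)) k = frozen_error X n k.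
    by apply/funext => omega; rewrite /freezing_error vE.
  under eq_integral do rewrite !FE.
  apply: (@le_trans _ _ (\int[P]_(omega in G k) (2 * delta)%:E)%E).
    apply: ge0_le_integral => //.
    - exact: mG.
    - move=> omega _; rewrite lee_fin addr_ge0//; apply: sumr_ge0 => i _; exact: sqr_ge0.
    - apply/measurable_EFinP; apply: measurable_funTS.
      have kT := gin k (ltnW km); apply: measurable_funD; apply: (adapted_at_measurable hF kT).
        exact: (error_adapted hX1 (ltnW km)).
      exact: (error_adapted hX2 (ltnW km)).
    by move=> omega /GA[h1 h2 _ _]; rewrite lee_fin; lra.
  rewrite integral_cst//=; last exact: mG.
  rewrite -[leRHS]mule1; apply: lee_wpmul2l; first by rewrite lee_fin mulr_ge0// ltW.
  exact: probability_le1 (mG k km).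
have cmp : (P (\bigcup_(k in `I_(2 ^ n)) (G k `&` [set omega |
      (c < scheme_dist (fun k i => Y X1 n i (dyadic T n k)) (fun k i => Y X2 n i (dyadic T n k))
             (fun k i j => MY X1 n i j (dyadic T n k)) (fun k i j => MY X2 n i j (dyadic T n k))
             k.+1 omega)%R])) <=
   (expR ((1 + comparison_rate T L) * T) * (comparison_rate T L * (T * (2 * delta))) / c)%:E)%E.
  apply: (comparison hF hw hb hsigma eps01 L0 hL hC le gin FG Gd S1 S2) => //.
  - by move=> i omega; rewrite dyadic0 !(scheme0 T_gt0).
  - by move=> i j omega; rewrite dyadic0 !(scheme_mart0 T_gt0).
have -> : expR ((1 + comparison_rate T L) * T) * (comparison_rate T L * (T * 2)) / c * delta =
  expR ((1 + comparison_rate T L) * T) * (comparison_rate T L * (T * (2 * delta))) / c by ring.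
apply: le_trans cmp; apply: le_measure; rewrite ?inE.
- by apply: bigcup_measurable => k kn; apply: measurableI; [exact: mG|exact: schemes_apart_measurable].
- apply: bigcup_measurable => k kn; apply: measurableI; first exact: mG.
  have kT := gin k.+1 kn; apply: measurable_lt_set; apply: (adapted_at_measurable hF kT).
  apply: measurable_funD; apply: measurable_sum => i.
    by apply: measurable_funX; apply: measurable_funB; exact: Y_adapted.
  apply: measurable_sum => j; apply: measurable_funX; apply: measurable_funB;
    apply: (scheme_mart_adapted T_gt0 hF hw hsigma) => // q qn.
    by apply: (frozen_adapted hX1); exact: ltnW.
  by apply: (frozen_adapted hX2); exact: ltnW.
move=> omega [k kn [Gk ap]]; exists k => //; split => //=; apply: lt_le_trans ap _.
rewrite lerDl; apply: sumr_ge0 => i _; apply: sumr_ge0 => j _; exact: sqr_ge0.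
Qed.

Definition solutions_apart lambda n : set Omega := \bigcup_(k in `I_(2 ^ n).+1)
  [set omega | lambda < sqdist (X1 (dyadic T n k) omega) (X2 (dyadic T n k) omega)].

Definition large_values (N : nat) : set Omega := \bigcup_n \bigcup_(k in `I_(2 ^ n).+1)
  ([set omega | N%:R < sqnorm (X1 (dyadic T n k) omega)] `|`
   [set omega | N%:R < sqnorm (X2 (dyadic T n k) omega)]).

Let measurable_sqnorm X n k N : is_solution P T F w b sigma eps x X -> (k <= 2 ^ n)%N ->
  measurable [set omega | N < sqnorm (X (dyadic T n k) omega)].
Proof.
move=> hX kn; apply: measurable_lt_set; apply: (adapted_at_measurable hF (dyadic_in T_gt0 kn)).
by apply: measurable_sum => i; apply: measurable_funX; exact: X_adapted.
Qed.

(** Almost every path is bounded. *)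
Lemma large_values_vanish : vanish P large_values.
Proof.
apply: vanish_ae.
  move=> N; apply: bigcupT_measurable => n; apply: bigcup_measurable => k /= kn.
  by apply: measurableU; apply: measurable_sqnorm => //; rewrite -ltnS.
apply: filterS2 (ae_regular_path hX1) (ae_regular_path hX2) => omega r1 r2.
have [B1 [B10 h1]] := path_bounded T_gt0 r1; have [B2 [B20 h2]] := path_bounded T_gt0 r2.
pose B := Num.max (r%:R * B1 ^+ 2) (r%:R * B2 ^+ 2).
exists (Num.trunc `|B|).+1 => N BN [n _ [k /= kn]].
have kT := dyadic_in T_gt0 (kn : (k <= 2 ^ n)%N).
have BleN : B <= N%:R.
  by rewrite (le_trans (ler_norm _))// (le_trans (ltW (truncnS_gt _)))// ler_nat.
have s1 : sqnorm (X1 (dyadic T n k) omega) <= B.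
  by rewrite le_max (sqnorm_le_coord B10)// => i; exact: h1.
have s2 : sqnorm (X2 (dyadic T n k) omega) <= B.
  by rewrite le_max (sqnorm_le_coord B20) ?orbT// => i; exact: h2.
by case; rewrite ltNge => /negP; apply; [exact: le_trans s1 _|exact: le_trans s2 _].
Qed.

(** First the ball is chosen, so that large values are unlikely; then delta,
    against the constant rho of this ball; then the level, so that both frozen
    schemes are within delta of their solutions. The two solutions then differ
    only as much as the two schemes. *)
Lemma solutions_apart_vanish lambda : 0 < lambda -> vanish P (solutions_apart lambda).
Proof.
move=> lam0 e e0; have e4 : 0 < e / 4 by rewrite divr_gt0.
have [N hN] := large_values_vanish e4.
have c0 : 0 < lambda / 6 by rewrite divr_gt0.
have [rho hrho] := confined_schemes_close N%:R c0.
have q0 : 0 < `|rho| + 1 by rewrite ltr_wpDl.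
pose delta := Num.min (lambda / 12) (e / 4 / (`|rho| + 1)).
have delta0 : 0 < delta by rewrite lt_min !divr_gt0.
have d1 : delta <= lambda / 12 by rewrite ge_min lexx.
have d2 : rho * delta <= e / 4.
  have : delta * (`|rho| + 1) <= e / 4 by rewrite -ler_pdivlMr// ge_min lexx orbT.
  apply: le_trans; rewrite mulrC ler_wpM2l ?(ltW delta0)//.
  by rewrite (le_trans (ler_norm _))// lerDl.
have [n1 h1] := frozen_scheme_vanish hX1 delta0 e4.
have [n2 h2] := frozen_scheme_vanish hX2 delta0 e4.
exists (maxn N (maxn n1 n2)) => n; rewrite !geq_max => /and3P[Nn n1n n2n].
have {}h1 := h1 n n1n; have {}h2 := h2 n n2n; have {}hN := hN N (leqnn _).
have NnR : N%:R <= n%:R :> R by rewrite ler_nat.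
have hA := hrho delta n delta0 NnR.
set A := \bigcup_(k in _) _ in hA.
have mA : measurable A.
  apply: bigcup_measurable => k kn; apply: measurableI; last exact: schemes_apart_measurable.
  apply: (filtration_measurable hF (dyadic_in T_gt0 (ltnW kn))).
  by apply: (bigcap_adapted T_gt0 hF) => // q qn; apply: confined_adapted; exact: ltnW.
rewrite -(measurable_mu_extE P mA) in hA.
set F1 := [set omega | _] in h1; set F2 := [set omega | _] in h2.
have sub : solutions_apart lambda n `<=` (F1 `|` F2) `|` (large_values N `|` A).
  move=> omega [k /= kn lt]; apply: contrapT => /not_orP[/not_orP[nF1 nF2] /not_orP[nL nA]].
  have f1 q : (q <= 2 ^ n)%N -> frozen_error X1 n q omega <= delta.
    by move=> qn; rewrite leNgt; apply/negP => h; apply: nF1; exists q.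
  have f2 q : (q <= 2 ^ n)%N -> frozen_error X2 n q omega <= delta.
    by move=> qn; rewrite leNgt; apply/negP => h; apply: nF2; exists q.
  have s1 q : (q <= 2 ^ n)%N -> sqnorm (X1 (dyadic T n q) omega) <= N%:R.
    by move=> qn; rewrite leNgt; apply/negP => h; apply: nL; exists n => //; exists q => //; left.
  have s2 q : (q <= 2 ^ n)%N -> sqnorm (X2 (dyadic T n q) omega) <= N%:R.
    by move=> qn; rewrite leNgt; apply/negP => h; apply: nL; exists n => //; exists q => //; right.
  have ap : \sum_i (Y X1 n i (dyadic T n k) omega - Y X2 n i (dyadic T n k) omega) ^+ 2 <= lambda / 6.
    case: k kn {lt} => [_|k kn].
      rewrite big1 ?(ltW c0)// => i _.
      by rewrite dyadic0 !(scheme0 T_gt0) subrr expr0n.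
    rewrite leNgt; apply/negP => h; apply: nA; exists k => //; split => // q /= qk.
    have qn : (q <= 2 ^ n)%N by apply: ltnW; exact: leq_ltn_trans qk kn.
    by split; [exact: f1|exact: f2|exact: s1|exact: s2].
  have {f1}f1 := f1 k kn; have {f2}f2 := f2 k kn.
  move: lt; apply/negP; rewrite -leNgt.
  have : sqdist (X1 (dyadic T n k) omega) (X2 (dyadic T n k) omega) <=
    3 * (frozen_error X1 n k omega + frozen_error X2 n k omega +
     \sum_i (Y X1 n i (dyadic T n k) omega - Y X2 n i (dyadic T n k) omega) ^+ 2).
    rewrite /sqdist /frozen_error -!big_split/= mulr_sumr; apply: ler_sum => i _.
    move: (X1 _ _ _ _) (X2 _ _ _ _) (Y X1 _ _ _ _) (Y X2 _ _ _ _) => u v y z.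
    have := sqr_ge0 ((y - u) + (z - v)); have := sqr_ge0 ((y - u) + (y - z)).
    have := sqr_ge0 ((z - v) - (y - z)).
    by rewrite !expr2; nra.
  by lra.
apply: le_trans (le_mu_ext P sub) _; apply: le_trans (mu_extU2 _ _ _) _.
have -> : e%:E = ((e / 4 + e / 4)%:E + (e / 4 + e / 4)%:E)%E.
  by rewrite -EFinD; congr EFin; field.
apply: leeD; apply: le_trans (mu_extU2 _ _ _) _; rewrite EFinD; apply: leeD => //.
by apply: le_trans hA _; rewrite lee_fin.
Qed.

(** The events increase with the level, while their probabilities tend to 0. *)
Lemma solutions_apart_negligible lambda n : 0 < lambda -> P.-negligible (solutions_apart lambda n).
Proof.
move=> lam0.
have mS : measurable (solutions_apart lambda n).
  apply: bigcup_measurable => k /= kn; apply: measurable_lt_set.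
  apply: (adapted_at_measurable hF (dyadic_in T_gt0 (kn : (k <= 2 ^ n)%N))).
  apply: measurable_sum => i; apply: measurable_funX; apply: measurable_funB; exact: X_adapted.
suff PS : P (solutions_apart lambda n) = 0%E by apply/negligibleP.
apply/eqP; rewrite eq_le measure_ge0 andbT.
apply/lee_addgt0Pr => e e0; rewrite add0e.
have [n0 hn0] := solutions_apart_vanish lam0 e0.
apply: le_trans (hn0 (maxn n n0) (leq_maxr _ _)).
rewrite -(measurable_mu_extE P mS); apply: le_mu_ext => omega [k /= kn lt].
have nm := leq_maxl n n0; move: lt; rewrite (dyadic_refine T k nm) => lt.
exists (k * 2 ^ (maxn n n0 - n))%N => //=.
by rewrite ltnS -[X in (_ <= 2 ^ X)%N](subnKC nm) expnD leq_mul2r -ltnS kn orbT.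
Qed.

Lemma solutions_equal : {ae P, forall omega, forall t, 0 <= t <= T -> X1 t omega = X2 t omega}.
Proof.
have h : {ae P, forall omega n q, ~ solutions_apart q.+1%:R^-1 n omega}.
  apply/ae_foralln => n; apply/ae_foralln => q.
  have q0 : 0 < q.+1%:R^-1 :> R by rewrite invr_gt0.
  apply: negligibleS (solutions_apart_negligible n q0) => omega /=.
  by move=> /contrapT.
apply: filterS3 (ae_regular_path hX1) (ae_regular_path hX2) h => omega r1 r2 hom t tT.
apply/colP => i; apply/eqP; rewrite -subr_eq0 -normr_le0.
apply: (dyadic_le_all T_gt0 (n0 := 0%N) (f := fun t => `|X1 t omega i 0 - X2 t omega i 0|)) => //.
  apply: unif_cont_norm; under eq_fun do rewrite -[- X2 _ _ _ _]mulN1r.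
  by apply: unif_contD; [exact: r1|apply: unif_contZ; exact: r2].
move=> n k _ kn; rewrite normr_le0.
set D := X1 _ _ _ _ - _.
have D2 : D ^+ 2 <= 0.
  apply/ler_addgt0Pr => e e0; rewrite add0r.
  apply: (@le_trans _ _ (sqdist (X1 (dyadic T n k) omega) (X2 (dyadic T n k) omega))).
    rewrite /sqdist (bigD1 i)//= lerDl; apply: sumr_ge0 => j _; exact: sqr_ge0.
  have : (Num.trunc e^-1).+1%:R^-1 <= e.
    by rewrite invf_ple ?posrE// ltW// truncnS_gt.
  apply: le_trans; rewrite leNgt; apply/negP => lt.
  by apply: (hom n (Num.trunc e^-1)); exists k.
by rewrite -sqrf_eq0 eq_le D2 sqr_ge0.
Qed.

End two_solutions.
End uniqueness.

Theorem theorem3p2 (R : realType) (d : measure_display)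
  (Omega : measurableType d) (P : probability Omega R)
  (T : R) (hT : 0 < T)
  (F : R -> set_system Omega) (hF : is_filtration T F)
  (r l : nat)
  (w : R -> Omega -> 'cV[R]_l) (hw : is_brownian P T F w)
  (b : 'cV[R]_r -> 'cV[R]_r) (sigma : 'cV[R]_r -> 'M[R]_(r, l))
  (hb : borel_fun b) (hsigma : borel_fun sigma)
  (growth : exists K : R, forall y : 'cV[R]_r,
     edot y (b y) + \sum_(i < r) \sum_(j < l) (sigma y i j) ^+ 2
       <= K ^+ 2 * (1 + enorm y ^+ 2))
  (lipschitz : forall N : R, exists L : R, forall y z : 'cV[R]_r,
     enorm y <= N -> enorm z <= N ->
     \sum_(i < r) `|b y i 0 - b z i 0|
       + \sum_(i < r) \sum_(j < l) `|sigma y i j - sigma z i j|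
       <= L * enorm (y - z))
  (x : 'cV[R]_r) (eps : R) (heps : 0 < eps <= 1) :
  (exists X : R -> Omega -> 'cV[R]_r,
     is_solution P T F w b sigma eps x X) /\
  (forall X1 X2 : R -> Omega -> 'cV[R]_r,
     is_solution P T F w b sigma eps x X1 ->
     is_solution P T F w b sigma eps x X2 ->
     {ae P, forall omega,
        ereal_sup [set (enorm (X1 s omega - X2 s omega))%:E | s in `[0, T]]
        = 0%E}).
Proof.
split.
  have [K hK] := growth.
  have growth' y : edot y (b y) + \sum_(i < r) \sum_(j < l) (sigma y i j) ^+ 2
      <= K ^+ 2 * (1 + sqnorm y).
    by rewrite -edot_sqnorm -[edot y y]sqr_sqrtr// edot_sqnorm sqnorm_ge0.
  exact: (solution_exists hT hF hw hb hsigma x heps growth' lipschitz).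
move=> X1 X2 h1 h2.
apply: filterS (solutions_equal hT hF hw hb hsigma heps lipschitz h1 h2) => omega eqX.
have E s : s \in `[0, T] -> (enorm (X1 s omega - X2 s omega))%:E = 0%E.
  rewrite in_itv/= => /eqX ->; rewrite subrr /enorm /edot big1 ?sqrtr0// => i _.
  by rewrite mxE mul0r.
rewrite (_ : [set _ | _ in _] = [set 0%E]) ?ereal_sup1//.
apply/seteqP; split => [_ [s sT <-]|_ ->]; first exact: E.
by exists 0 => //=; [rewrite in_itv/= lexx ltW|apply: E; rewrite in_itv/= lexx ltW].
Qed.
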